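(* Let $d\in\mathbb{N}$, let $r$ be a fixed non-negative integer and let $1\le p<\infty$. There is a positive constant $C_r$, depending on $r$ (but not on $f$ or $n$), such that the following holds. For every $f\in L^p(Q_d)$ with $D^{\boldsymbol{\alpha}}f\in L^p(Q_d)$ for all multi-indices $\boldsymbol{\alpha}=(\alpha_1,\ldots,\alpha_d)$ with $|\boldsymbol{\alpha}|\ge 1$ and $\alpha_i\in\{0,1\}$ for all $i$, and for all $n\in\mathbb{N}$ with $n>2r$, $$\left\|K_{n,r}^{d}(f)-f\right\|_p\le 2C_r\sum_{\substack{|\boldsymbol{\alpha}|\ge 1\\ \alpha_i\in\{0,1\}}}\left(\frac{1}{\sqrt[2d]{n+1}}\right)^{|\boldsymbol{\alpha}|}\left\|D^{\boldsymbol{\alpha}}f\right\|_p .$$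
   Context: Notation: $Q_d:=[0,1]^d$; $L^p(Q_d)$ is the space of real-valued $p$-integrable functions on $Q_d$ (Lebesgue measure) with its standard norm $\|\cdot\|_p$. A multi-index is a $d$-tuple $\boldsymbol{\alpha}=(\alpha_1,\ldots,\alpha_d)$ of non-negative integers, with length $|\boldsymbol{\alpha}|=\sum_{i=1}^d\alpha_i$, and $D^{\boldsymbol{\alpha}}f=D_1^{\alpha_1}\cdots D_d^{\alpha_d}f$, where $D_i$ is the $i$-th partial derivative operator (derivatives are understood in the distributional sense). Operators: for non-negative integers $m$ and integers $k$, $p_{m,k}(x)=\binom{m}{k}x^k(1-x)^{m-k}$ if $0\le k\le m$ and $p_{m,k}(x)=0$ if $k<0$ or $k>m$, $x\in[0,1]$. For a non-negative integer $r$ and a natural number $n>2r$, Stancu's fundamental functions are, for $x\in[0,1]$ and $0\le k\le n$, $$w_{n,k,r}(x)=\begin{cases}(1-x)p_{n-r,k}(x), & 0\le k<r,\\ (1-x)p_{n-r,k}(x)+x\,p_{n-r,k-r}(x), & r\le k\le n-r,\\ x\,p_{n-r,k-r}(x), & n-r<k\le n.\end{cases}$$ For $\mathbf{k}=(k_1,\ldots,k_d)\in\{0,\ldots,n\}^d$ and $\mathbf{x}=(x_1,\ldots,x_d)\in Q_d$ put $w_{n,\mathbf{k},r}(\mathbf{x}):=\prod_{i=1}^d w_{n,k_i,r}(x_i)$. The multivariate Brass-Stancu-Kantorovich operators are defined, for $n>2r$ and $f\in L^1(Q_d)$, by $$K_{n,r}^{d}(f;\mathbf{x})=\sum_{\mathbf{k}\in\{0,\ldots,n\}^d}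 w_{n,\mathbf{k},r}(\mathbf{x})\int_{Q_d} f\left(\frac{\mathbf{k}+\mathbf{u}}{n+1}\right)d\mathbf{u},\qquad \mathbf{x}\in Q_d,$$ and $K_{n,r}^d(f)$ denotes the function $\mathbf{x}\mapsto K_{n,r}^d(f;\mathbf{x})$. *)

(* Defs.v *)
From HB Require Import structures.
From mathcomp Require Import all_boot all_order all_algebra.
From mathcomp Require Import all_classical all_reals all_analysis.

Set Implicit Arguments.
Unset Strict Implicit.
Unset Printing Implicit Defensive.
Import Order.TTheory GRing.Theory Num.Theory.
Import numFieldNormedType.Exports.
Local Open Scope classical_set_scope.
Local Open Scope ring_scope.

Definition rV_display : measure_display.
Proof. exact: measure_tuple_display default_measure_display. Qed.

(* R^n carries the product sigma-algebra, generated by the coordinate maps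
   from the Borel sets of R; it is also the Borel sigma-algebra of R^n *)
Section measurable_rV.
Variables (R : realType) (n : nat).

Definition rV_coord (i : 'I_n) (x : 'rV[R]_n) : measurableTypeR R := x ord0 i.

Let rV_set0 : g_sigma_preimage rV_coord set0.
Proof. exact: sigma_algebra0. Qed.

Let rV_setC A : g_sigma_preimage rV_coord A -> g_sigma_preimage rV_coord (~` A).
Proof. exact: sigma_algebraC. Qed.

Let rV_bigcup (F : _^nat) : (forall i, g_sigma_preimage rV_coord (F i)) ->
  g_sigma_preimage rV_coord (\bigcup_i (F i)).
Proof. exact: sigma_algebra_bigcup. Qed.

HB.instance Definition _ := @isMeasurable.Build rV_display
  'rV[R]_n (g_sigma_preimage rV_coord) rV_set0 rV_setC rV_bigcup.

Lemma measurable_rV_coord (i : 'I_n) : measurable_fun setT (rV_coord i).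
Proof.
move=> _ Y mY; rewrite setTI; apply: sub_sigma_algebra => /=.
rewrite -bigcup_seq/=; exists i => /=; first by rewrite mem_index_enum.
by exists Y => //; rewrite setTI.
Qed.

Lemma measurable_fun_rV d (T : measurableType d) (f : T -> 'rV[R]_n) :
  (forall i, measurable_fun setT (rV_coord i \o f)) -> measurable_fun setT f.
Proof.
move=> mf _ A mA; rewrite setTI.
suff: @measurable rV_display 'rV[R]_n `<=` [set B | measurable (f @^-1` B)].
  exact.
apply: smallest_sub.
  split => /=.
  - by rewrite preimage_set0.
  - by move=> B mB; rewrite setTD preimage_setC; exact: measurableC.
  - by move=> F mF; rewrite preimage_bigcup; exact: bigcupT_measurable.
move=> B; rewrite -bigcup_seq => -[i _ /= [C mC <-]].
by rewrite setTI -comp_preimage -[X in measurable X]setTI; exact: mf.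
Qed.

End measurable_rV.

Section cons_rV.
Variables (R : realType) (n : nat).
Implicit Type p : measurableTypeR R * 'rV[R]_n.

Definition cons_rV p : 'rV[R]_n.+1 :=
  \row_i (if unlift ord0 i is Some j then p.2 ord0 j else p.1).

Definition uncons_rV (x : 'rV[R]_n.+1) : measurableTypeR R * 'rV[R]_n :=
  (x ord0 ord0, \row_i x ord0 (lift ord0 i)).

Lemma cons_rVK : cancel cons_rV uncons_rV.
Proof.
case=> a u; congr pair; first by rewrite mxE unlift_none.
by apply/rowP => i; rewrite !mxE liftK.
Qed.

Lemma uncons_rVK : cancel uncons_rV cons_rV.
Proof.
move=> x; apply/rowP => i; rewrite mxE.
by have [j ->|->] := unliftP ord0 i; rewrite ?liftK ?unlift_none //= mxE.
Qed.

Lemma measurable_cons_rV : measurable_fun setT cons_rV.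
Proof.
apply: measurable_fun_rV => i.
have [j ->|->] := unliftP ord0 i.
  rewrite (_ : _ \o _ = @rV_coord R n j \o snd).
    by apply: measurableT_comp => //; exact: measurable_rV_coord.
  by apply/funext => p /=; rewrite /rV_coord mxE liftK.
rewrite (_ : _ \o _ = fst) //.
by apply/funext => p /=; rewrite /rV_coord mxE unlift_none.
Qed.

Lemma measurable_uncons_rV : measurable_fun setT uncons_rV.
Proof.
apply: measurable_fun_pair; first exact: (@measurable_rV_coord R n.+1 ord0).
apply: measurable_fun_rV => i.
rewrite (_ : _ \o _ = @rV_coord R n.+1 (lift ord0 i)).
  exact: measurable_rV_coord.
by apply/funext => x; rewrite /rV_coord /= mxE.
Qed.

End cons_rV.

Section lebesgue_cons.
Variables (R : realType) (n : nat).
Variable mu : {sigma_finite_measure set 'rV[R]_n -> \bar R}.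

(* transport of the product measure along R x R^n ~ R^(n+1) *)
Definition lebesgue_cons : set 'rV[R]_n.+1 -> \bar R :=
  pushforward (lebesgue_measure \x mu)%E (@cons_rV R n).

HB.instance Definition _ := Measure.copy lebesgue_cons
  (measure_function_pushforward__canonical__measure_function_Measure
     (lebesgue_measure \x mu)%E (@measurable_cons_rV R n)).

Let lebesgue_cons_sigma_finite : sigma_finite setT lebesgue_cons.
Proof.
have /sigma_finiteP[F [TF ndF Foo]] := sigma_finiteT (@lebesgue_measure R).
have /sigma_finiteP[G [TG ndG Goo]] := sigma_finiteT mu.
exists (fun k => @uncons_rV R n @^-1` (F k `*` G k)).
  apply/esym; rewrite -subTset => x _.
  have [a _ Fa] : (\bigcup_i F i) (uncons_rV x).1 by rewrite -TF.
  have [b _ Gb] : (\bigcup_i G i) (uncons_rV x).2 by rewrite -TG.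
  exists (maxn a b) => //; split => /=.
    by move: Fa; exact/subsetPset/ndF/leq_maxl.
  by move: Gb; exact/subsetPset/ndG/leq_maxr.
move=> k; have [mF Fk] := Foo k; have [mG Gk] := Goo k; split.
  rewrite -[X in measurable X]setTI; apply: measurable_uncons_rV => //.
  exact: measurableX.
rewrite /lebesgue_cons /pushforward -comp_preimage.
rewrite (_ : _ \o _ = id); last by apply/funext => p /=; rewrite cons_rVK.
by rewrite preimage_id product_measure1E// lte_mul_pinfty// ge0_fin_numE.
Qed.

HB.instance Definition _ := Measure_isSigmaFinite.Build _ _ _ lebesgue_cons
  lebesgue_cons_sigma_finite.

End lebesgue_cons.

(* n-dimensional Lebesgue measure, as the n-fold product of the
   one-dimensional one *)
Fixpoint lebesgue_rV (R : realType) (n : nat) :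
    {sigma_finite_measure set 'rV[R]_n -> \bar R} :=
  match n with
  | 0%N => (\d_(0 : 'rV[R]_0))%R
  | m.+1 => lebesgue_cons (lebesgue_rV R m)
  end.

Section cube.
Variables (R : realType) (n : nat).
Implicit Types (a b : 'rV[R]_n) (A : 'I_n -> set (measurableTypeR R)).

Definition box a b : set 'rV[R]_n :=
  [set x | forall i, a ord0 i <= x ord0 i <= b ord0 i].

Definition cube : set 'rV[R]_n := [set x | forall i, 0 <= x ord0 i <= 1].

Definition open_cube : set 'rV[R]_n := [set x | forall i, 0 < x ord0 i < 1].

Lemma measurable_box a b : measurable (box a b).
Proof.
rewrite (_ : box a b = \bigcap_(i in [set: 'I_n])
    @rV_coord R n i @^-1` `[a ord0 i, b ord0 i]%classic); last first.
  by apply/seteqP; split => x /= + i => /(_ i); rewrite /= in_itv /=; exact.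
apply: fin_bigcap_measurable => // i _; rewrite -[X in measurable X]setTI.
by apply: measurable_rV_coord => //; exact: measurable_itv.
Qed.

Lemma cubeE : cube = box 0 (const_mx 1).
Proof.
by apply/seteqP; split => x /= + i => /(_ i); rewrite !mxE.
Qed.

Lemma measurable_cube : measurable cube.
Proof. by rewrite cubeE; exact: measurable_box. Qed.

(* Lebesgue measure on the unit cube; the values outside the cube of a
   function on R^n do not matter for this measure *)
Definition lebesgue_cube : {measure set 'rV[R]_n -> \bar R} :=
  mrestr (lebesgue_rV R n) measurable_cube.

End cube.
Arguments cube {R n}.
Arguments open_cube {R n}.
Arguments lebesgue_cube {R n}.

Lemma lebesgue_rV_box (R : realType) (n : nat) (a b : 'rV[R]_n) :
  (forall i, a ord0 i <= b ord0 i) ->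
  lebesgue_rV R n (box a b) = (\prod_(i < n) (b ord0 i - a ord0 i))%:E.
Proof.
elim: n a b => [|n IH] a b ab.
  by rewrite big_ord0 /= diracE mem_set //= => -[].
rewrite /= /lebesgue_cons /pushforward.
rewrite (_ : _ @^-1` _ = `[a ord0 ord0, b ord0 ord0]%classic `*`
    box (uncons_rV a).2 (uncons_rV b).2); last first.
  apply/seteqP; split => [[x u]|[x u] [/= xab uab] i] /=.
    move=> h; split => [|i] /=.
      by have := h ord0; rewrite mxE unlift_none /= in_itv.
    by have := h (lift ord0 i); rewrite !mxE liftK.
  have [j ->|->] := unliftP ord0 i; rewrite mxE ?liftK ?unlift_none /=.
    by have := uab j; rewrite !mxE.
  by move: xab; rewrite in_itv.
rewrite product_measure1E; [|exact: measurable_itv|exact: measurable_box].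
rewrite big_ord_recl EFinM; congr (_ * _)%E.
  rewrite [LHS]lebesgue_measure_itv /= lte_fin.
  case: ltP => [_|ba]; first by rewrite -EFinB.
  by rewrite (le_anti (introT andP (conj ba (ab ord0)))) subrr.
rewrite IH => [|i]; last by rewrite !mxE.
by congr EFin; apply: eq_bigr => i _; rewrite !mxE.
Qed.

Definition multi_index (d : nat) := {ffun 'I_d -> nat}.

Definition mi_length d (a : multi_index d) : nat := \sum_(i < d) a i.

(* the multi-indices with all entries in {0, 1} *)
Definition mi_of_binary d (a : {ffun 'I_d -> 'I_2}) : multi_index d :=
  [ffun i => a i : nat].

Section weak_derivative.
Variables (R : realType) (d : nat).
Implicit Types (phi f g : 'rV[R]_d -> R) (a : multi_index d).

Definition partial (i : 'I_d) phi : 'rV[R]_d -> R := 'D_(delta_mx ord0 i) phi.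

(* D_1^{a_1} ... D_d^{a_d} phi, for differentiable functions *)
Definition partials a phi : 'rV[R]_d -> R :=
  foldr (fun i => iter (a i) (partial i)) phi (enum 'I_d).

(* C^oo: the partial derivatives of all orders, in any order of
   differentiation, exist and are continuous *)
Definition smooth phi : Prop :=
  forall s : seq 'I_d, let psi := foldr partial phi s in
  continuous psi /\ forall i x, derivable psi x (delta_mx ord0 i).

Definition supp phi : set 'rV[R]_d := closure [set x | phi x != 0].

Definition test_function phi : Prop :=
  [/\ smooth phi, compact (supp phi) & supp phi `<=` open_cube].

(* g represents the distributional derivative D^a f on the open unit cube;
   meaningful for f and g integrable on the cube *)
Definition is_weak_derivative a f g : Prop :=
  forall phi, test_function phi ->
    \int[lebesgue_rV R d]_(x in cube) (f x * partials a phi x) =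
    (-1) ^+ mi_length a * \int[lebesgue_rV R d]_(x in cube) (g x * phi x).

End weak_derivative.

Section brass_stancu_kantorovich.
Variable R : realType.

(* 'C(m, k) = 0 for k > m *)
Definition bernstein (m k : nat) (x : R) : R :=
  'C(m, k)%:R * x ^+ k * (1 - x) ^+ (m - k).

(* meant for 2 * r < n and k <= n *)
Definition stancu (n k r : nat) (x : R) : R :=
  if (k < r)%N then (1 - x) * bernstein (n - r) k x
  else if (k <= n - r)%N then
    (1 - x) * bernstein (n - r) k x + x * bernstein (n - r) (k - r) x
  else x * bernstein (n - r) (k - r) x.

Definition stancu_prod d (n : nat) (k : {ffun 'I_d -> 'I_n.+1}) (r : nat)
    (x : 'rV[R]_d) : R :=
  \prod_(i < d) stancu n (k i) r (x ord0 i).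

Definition kantorovich d (n r : nat) (f : 'rV[R]_d -> R) (x : 'rV[R]_d) : R :=
  \sum_(k : {ffun 'I_d -> 'I_n.+1}) stancu_prod k r x *
    \int[lebesgue_rV R d]_(u in cube)
      f (\row_(i < d) (((k i)%:R + u ord0 i) / n.+1%:R)).

End brass_stancu_kantorovich.

(* Main.v *)
From HB Require Import structures.
Require Import Defs.
From mathcomp Require Import all_boot all_order all_algebra.
From mathcomp Require Import ring lra zify.
From mathcomp Require Import all_classical all_reals all_analysis.
From mathcomp Require Import measurable_realfun.
Import Order.TTheory GRing.Theory Num.Theory.
Import numFieldNormedType.Exports.
Local Open Scope classical_set_scope.
Local Open Scope ring_scope.

Set Implicit Arguments.
Unset Strict Implicit.
Unset Printing Implicit Defensive.

(** The operator [kantorovich n r] is an averaging operator at scale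
    [n ^ (- 1/2)], and a function moves at most by the integral of its
    gradient; the estimate is this remark, carried out in L^p.

    Averaging. For [x] in the cube, [kantorovich n r f x] is the integral of
    [f] against a product kernel [kern n r x y = \prod_i kern1 n r (x_i) (y_i)]
    of total mass 1, so that [|kantorovich n r f x - f x|] is at most the
    mean deviation [edev n r f x], the integral of
    [kern n r x y * |f y - f x|] over [y] ([kantorovich_edev]). The
    one-dimensional kernel has bounded marginals in both variables
    ([integral_kern1r], [integral_kern1l]), and its second moment around [x]
    is at most the square of [mesh R n r = 2 (r + 1) / sqrt (n + 1)]
    ([stancu_moment]).

    Moving along coordinate lines. Suppose that for almost all [x] and [y],
    replacing [x_i] by [y] changes [f] at most by the integral of [|g_i|] over
    the segment between; this is [line_bound i f (g i)]. Change the coordinates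
    of [x] into those of [y] one at a time. The contribution of a single
    coordinate is the integral of [|g_i|] on a line against the kernel
    [x, t |-> \int kern1 x y * (t lies between x and y) dy]. By the second
    moment this kernel is dominated by [4 c^2 / (|t - x| + c)^2] with
    [c = mesh R n r] ([kern1_between]), and both marginals of the latter are at
    most [8 c] ([integral_dom_kern]); Schur's test ([schur_test]) turns this
    into a factor [c] in L^p. The other coordinates contribute the mean
    deviations of slices of [f], averaged by [kern1], and Schur's test bounds
    this average as well. Induction on the dimension gives
    [edev_power_bound]: the L^p norm of the mean deviation is at most a constant
    times [c] times the L^p norms of the [g_i].

    Weak derivatives. It remains to see that a weak partial derivative [g]
    of [f] satisfies [line_bound i f g] ([weak_partial_line_bound]), that is,
    that [h = f - line_prim i g], where [line_prim i g x] integrates [g] along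
    the [i]-th coordinate from 0 to [x_i], does not depend on [x_i], up to null
    sets. Testing the weak derivative on the tensor product whose [i]-th factor
    is a primitive of [eta_i] gives [\int h * tens eta = 0] whenever [eta_i] has
    mean zero ([line_rest_tens]). The exchange of [x_i] with an additional
    variable [y], which preserves the product measure, turns this into the
    orthogonality of [h (upd i y x) - h x] to all tensor products of cutoff
    functions in [(x, y)]. As these converge to indicators, the
    difference has integral zero over every box, hence vanishes almost
    everywhere ([box_ae_eq0]).

    Conclusion. [c] is at most a constant times [(n + 1) ^ (- 1 / (2 d))]
    ([mesh_le]), which is the weight of the multi-indices of length one, and
    the sum in the theorem dominates its part over these
    ([sum_unit_mi_le]). *)

(** * Lebesgue measure on the unit interval and on the unit cube *)

Section restricted_measure.
Context d (T : measurableType d) (R : realType).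
Variables (mu : {measure set T -> \bar R}) (D : set T) (mD : measurable D).

Lemma ge0_integral_mrestr (f : T -> \bar R) : measurable_fun setT f ->
  (forall x, 0 <= f x)%E ->
  (\int[mrestr mu mD]_x f x = \int[mu]_(x in D) f x)%E.
Proof.
move=> mf f0.
have mDC : measurable (~` D) by exact: measurableC.
rewrite (@ge0_negligible_integral _ _ _ (mrestr mu mD) setT (~` D))//; last first.
  change (mu (~` D `&` D) = 0%E); by rewrite setICl measure0.
rewrite setTD setCK; apply: eq_measure_integral => A mA AD.
by rewrite /mrestr /=; congr (mu _); apply/setIidPl.
Qed.

Lemma integral_mrestr (f : T -> \bar R) : measurable_fun setT f ->
  (\int[mrestr mu mD]_x f x = \int[mu]_(x in D) f x)%E.
Proof.
move=> mf; rewrite [LHS]integralE [RHS]integralE !ge0_integral_mrestr//.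
- exact: measurable_funeneg.
- exact: measurable_funepos.
Qed.

End restricted_measure.

Section unit_interval.
Variable R : realType.

Lemma lebesgue_unit_lt : (@lebesgue_measure R `[0%R, 1%R]%classic < +oo)%E.
Proof. by rewrite lebesgue_measure_itv /= lte_fin ltr01 -EFinB ltry. Qed.

Lemma measurable_id_R : measurable_fun setT (idfun : measurableTypeR R -> R).
Proof. by move=> _ Y mY; rewrite setTI preimage_id. Qed.

Lemma measurable_id_TR : measurable_fun setT (idfun : R -> measurableTypeR R).
Proof. by move=> _ Y mY; rewrite setTI preimage_id. Qed.

(** The push-forward along the identity moves Lebesgue measure from
    [measurableTypeR R], where it is defined, to the default measurable
    structure of [R]. *)
Definition unit_leb : set R -> \bar R :=
  pushforward (@mfrestr _ (measurableTypeR R) R _ lebesgue_measure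
    (measurable_itv `[0%R, 1%R]) lebesgue_unit_lt)
    (idfun : measurableTypeR R -> R).

HB.instance Definition _ := Measure.copy unit_leb
  (measure_function_pushforward__canonical__measure_function_Measure
     (@mfrestr _ (measurableTypeR R) R _ lebesgue_measure
    (measurable_itv `[0%R, 1%R]) lebesgue_unit_lt) measurable_id_R).

Lemma unit_leb_setT : unit_leb setT = 1%E.
Proof.
rewrite /unit_leb /pushforward preimage_setT.
rewrite /mfrestr /mrestr setTI lebesgue_measure_itv /= lte_fin ltr01.
by rewrite -EFinB subr0.
Qed.

Let unit_leb_fin : fin_num_fun unit_leb.
Proof.
move=> A mA; rewrite ge0_fin_numE// (@le_lt_trans _ _ 1%E) ?ltry//.
by rewrite -unit_leb_setT; apply: le_measure => //; rewrite inE.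
Qed.

HB.instance Definition _ := Measure_isFinite.Build _ _ _ unit_leb unit_leb_fin.

Lemma integral_unit_leb_cst (c : \bar R) : (\int[unit_leb]_x c = c)%E.
Proof.
rewrite integral_cst//; transitivity (c * 1)%E; last by rewrite mule1.
by congr (c * _)%E; exact: unit_leb_setT.
Qed.

Lemma integral_unit_leb (f : R -> \bar R) : measurable_fun setT f ->
  (forall x, 0 <= f x)%E ->
  (\int[unit_leb]_x f x = \int[lebesgue_measure]_(x in `[0%R, 1%R]) f x)%E.
Proof.
move=> mf f0.
have mf' : measurable_fun setT (f : measurableTypeR R -> \bar R).
  exact: (measurableT_comp mf measurable_id_R).
rewrite -[RHS](@ge0_integral_mrestr _ (measurableTypeR R) R lebesgue_measure _
  (measurable_itv `[0%R, 1%R]) f)//.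
rewrite [LHS]ge0_integral_pushforward//.
exact: measurable_id_R.
Qed.

Lemma integral_unit_leb_signed (f : R -> \bar R) : measurable_fun setT f ->
  (\int[unit_leb]_x f x = \int[lebesgue_measure]_(x in `[0%R, 1%R]) f x)%E.
Proof.
move=> mf; rewrite [LHS]integralE [RHS]integralE !integral_unit_leb//.
- exact: measurable_funeneg.
- exact: measurable_funepos.
Qed.

Lemma ge0_le_integral_unit_leb (f g : R -> \bar R) : measurable_fun setT f ->
  measurable_fun setT g -> (forall x, 0 <= f x)%E -> (forall x, 0 <= g x)%E ->
  (forall x : R, x \in `[0%R, 1%R] -> f x <= g x)%E ->
  (\int[unit_leb]_x f x <= \int[unit_leb]_x g x)%E.
Proof.
move=> mf mg f0 g0 fg; rewrite !integral_unit_leb//.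
apply: ge0_le_integral => //.
- exact: (measurable_funTS (measurableT_comp mf measurable_id_R)).
- exact: (measurable_funTS (measurableT_comp mg measurable_id_R)).
Qed.

Lemma measurable_cons_R n :
  measurable_fun setT (fun q : R * 'rV[R]_n => cons_rV (q : measurableTypeR R * _)).
Proof.
pose T (q : R * 'rV[R]_n) : measurableTypeR R * 'rV[R]_n := (q.1, q.2).
have mT : measurable_fun setT T.
  by apply: measurable_fun_pair => //; exact: (measurableT_comp measurable_id_TR).
rewrite (_ : (fun q => _) = @cons_rV R n \o T); last by apply/funext => -[].
by apply: measurableT_comp => //; exact: measurable_cons_rV.
Qed.

Lemma cube_lt n : (lebesgue_rV R n (@cube R n) < +oo)%E.
Proof. by rewrite cubeE lebesgue_rV_box ?ltry// => i; rewrite !mxE ler01. Qed.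

(** The restriction of [lebesgue_rV] to the cube, packaged as a finite
    measure so that the theory of finite measures applies; its underlying
    measure is convertible to [lebesgue_cube]. *)
Definition unit_cube n : {finite_measure set 'rV[R]_n -> \bar R} :=
  @mfrestr _ 'rV[R]_n R _ (lebesgue_rV R n) (@measurable_cube R n) (@cube_lt n).

Lemma unit_cube_setT n : unit_cube n setT = 1%E.
Proof.
rewrite /unit_cube /= /mfrestr /mrestr setTI cubeE lebesgue_rV_box.
  by rewrite big1// => i _; rewrite !mxE subr0.
by move=> i; rewrite !mxE ler01.
Qed.

Lemma integral_unit_cube_cst n (c : \bar R) : (\int[unit_cube n]_x c = c)%E.
Proof.
rewrite integral_cst//; transitivity (c * 1)%E; last by rewrite mule1.
by congr (c * _)%E; exact: unit_cube_setT.
Qed.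

(** Tonelli's theorem for the decomposition of the cube by its first
    coordinate; every induction on the dimension goes through it. *)
Lemma ge0_integral_unit_cubeS n (F : 'rV[R]_n.+1 -> \bar R) :
  measurable_fun setT F -> (forall x, 0 <= F x)%E ->
  (\int[unit_cube n.+1]_x F x =
   \int[unit_leb]_a \int[unit_cube n]_u F (cons_rV (a, u)))%E.
Proof.
move=> mF F0.
have mFc : measurable_fun setT (fun q : R * 'rV[R]_n => F (cons_rV q)).
  by apply: (measurableT_comp mF); exact: measurable_cons_R.
have mF1 a : measurable_fun setT (fun u => F (cons_rV (a, u))).
  exact: (measurableT_comp mFc (measurable_pair1 a)).
rewrite ge0_integral_mrestr// integral_mkcond.
have mFr : measurable_fun setT (F \_ cube).
  by apply/(measurable_restrictT _ _).1 => //; [exact: measurable_cube|exact: measurable_funTS].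
have Fr0 x : (0 <= (F \_ cube) x)%E by rewrite patchE; case: ifPn.
rewrite [LHS](_ : _ = \int[pushforward (lebesgue_measure \x lebesgue_rV R n) (@cons_rV R n)]_x (F \_ cube) x)%E//.
rewrite ge0_integral_pushforward//; last exact: measurable_cons_rV.
rewrite preimage_setT fubini_tonelli1//=; last first.
  by apply: (measurableT_comp mFr); exact: measurable_cons_rV.
rewrite integral_unit_leb//; last 2 first.
- by apply: (measurable_fun_fubini_tonelli_F (fun q => F (cons_rV q))).
- by move=> a; exact: integral_ge0.
rewrite [RHS]integral_mkcond; apply: eq_integral => a _.
rewrite /fubini_F /= [RHS]patchE; case: ifPn => a01.
  rewrite ge0_integral_mrestr// [RHS]integral_mkcond; apply: eq_integral => u _.
  rewrite !patchE.
  suff -> : (cons_rV (a, u) \in cube) = (u \in cube) by [].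
  apply/idP/idP; rewrite !inE.
    by move=> h i; have := h (lift ord0 i); rewrite mxE liftK.
  move=> h i; have [j ->|->] := unliftP ord0 i; rewrite mxE.
    by rewrite liftK.
  by rewrite unlift_none; move: a01; rewrite inE /= in_itv.
rewrite -[RHS](integral0 (lebesgue_rV R n) setT); apply: eq_integral => u _.
rewrite patchE ifF//; apply: contraNF a01; rewrite !inE => /(_ ord0).
by rewrite mxE unlift_none /= in_itv.
Qed.

End unit_interval.

(** * Moments of the Bernstein and Stancu weights *)

Section bernstein_stancu.
Variable R : realType.
Implicit Types (x a : R) (phi : nat -> R).

Definition bernstein_op m phi x : R :=
  \sum_(0 <= k < m.+1) bernstein m k x * phi k.

Lemma bernstein_gt m k x : (m < k)%N -> bernstein m k x = 0.
Proof. by move=> mk; rewrite /bernstein bin_small// !mul0r. Qed.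

Lemma bernsteinS0 m x : bernstein m.+1 0 x = (1 - x) * bernstein m 0 x.
Proof. by rewrite /bernstein !bin0 !subn0 exprS; ring. Qed.

Lemma bernsteinSS m k x : bernstein m.+1 k.+1 x =
  (1 - x) * bernstein m k.+1 x + x * bernstein m k x.
Proof.
rewrite /bernstein binS natrD subSS.
have [km|mk] := ltnP k m.
  rewrite (_ : (m - k = (m - k.+1).+1)%N); last by lia.
  by rewrite !exprS; ring.
by rewrite (@bin_small m k.+1)// !mul0r add0r mulr0 add0r exprS; ring.
Qed.

Lemma bernstein_opS m phi x : bernstein_op m.+1 phi x =
  (1 - x) * bernstein_op m phi x + x * bernstein_op m (phi \o succn) x.
Proof.
rewrite /bernstein_op big_nat_recl//=.
under eq_bigr do rewrite bernsteinSS mulrDl.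
rewrite big_split/= addrA; congr (_ + _); last first.
  by rewrite mulr_sumr; apply: eq_bigr => k _; rewrite [RHS]mulrA.
rewrite big_nat_recr//= (@bernstein_gt m m.+1)// !(mulr0, mul0r) addr0.
rewrite [in RHS]big_nat_recl//= mulrDr; congr (_ + _).
  by rewrite bernsteinS0 [RHS]mulrA.
by rewrite mulr_sumr; apply: eq_bigr => k _; rewrite [RHS]mulrA.
Qed.

Lemma bernstein_op0 phi x : bernstein_op 0 phi x = phi 0%N.
Proof. by rewrite /bernstein_op big_nat1 /bernstein bin0 !expr0 !mul1r. Qed.

Lemma bernstein_op1 m x : bernstein_op m (fun=> 1) x = 1.
Proof.
elim: m => [|m IH]; first by rewrite bernstein_op0.
by rewrite bernstein_opS -/(bernstein_op _ _ _) (_ : _ \o _ = fun=> 1)// IH; ring.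
Qed.

(** The second moment of a binomial law around [a]: variance plus squared
    bias. Keeping [a] arbitrary makes the induction on [m] close, since the
    recurrence for the Bernstein weights shifts [a] by 1. *)
Lemma bernstein_op_sqr m a x : bernstein_op m (fun k => (k%:R - a) ^+ 2) x =
  m%:R * x * (1 - x) + (m%:R * x - a) ^+ 2.
Proof.
elim: m a => [|m IH] a; first by rewrite bernstein_op0; ring.
rewrite bernstein_opS.
rewrite (_ : _ \o _ = fun k => (k%:R - (a - 1)) ^+ 2); last first.
  by apply/funext => k /=; rewrite -natr1; congr (_ ^+ 2); ring.
by rewrite !IH -natr1; ring.
Qed.

Lemma bernstein_ge0 m k x : 0 <= x <= 1 -> 0 <= bernstein m k x.
Proof.
move=> /andP[x0 x1]; rewrite /bernstein !mulr_ge0// exprn_ge0//.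
by rewrite subr_ge0.
Qed.

(** The three cases of the definition are one formula, because a Bernstein
    weight vanishes when its index exceeds its degree. *)
Lemma stancuE n k r x : (2 * r < n)%N -> (k <= n)%N -> stancu n k r x =
  (1 - x) * bernstein (n - r) k x +
  x * (if (r <= k)%N then bernstein (n - r) (k - r) x else 0).
Proof.
move=> rn kn; rewrite /stancu ltnNge; case: leqP => //= [rk|_]; last first.
  by rewrite mulr0 addr0.
by case: leqP => // nk; rewrite (bernstein_gt x nk) mulr0 add0r.
Qed.

Lemma stancu_ge0 n k r x : 0 <= x <= 1 -> 0 <= stancu n k r x.
Proof.
move=> x01; have [x0 x1] := andP x01.
have := @bernstein_ge0 (n - r) k x x01.
have := @bernstein_ge0 (n - r) (k - r) x x01 => b1 b2.
have x1' : 0 <= 1 - x by rewrite subr_ge0.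
by rewrite /stancu; do 2?case: ifP => _; do ?apply: addr_ge0; exact: mulr_ge0.
Qed.

(** Stancu's weights mix two binomial laws of parameter [n - r], one
    of them shifted by [r], with probabilities [1 - x] and [x]. *)
Lemma sum_stancu n r phi x : (2 * r < n)%N ->
  \sum_(k < n.+1) stancu n k r x * phi k =
  (1 - x) * bernstein_op (n - r) phi x +
  x * bernstein_op (n - r) (fun k => phi (k + r)%N) x.
Proof.
move=> rn.
transitivity (\sum_(k < n.+1) ((1 - x) * (bernstein (n - r) k x * phi k) +
    x * ((if (r <= k)%N then bernstein (n - r) (k - r) x else 0) * phi k))).
  by apply: eq_bigr => -[k /= kn] _; rewrite stancuE//; ring.
rewrite big_split/= -!mulr_sumr; congr (_ * _ + _ * _).
  rewrite -(big_mkord xpredT (fun k => bernstein (n - r) k x * phi k)).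
  rewrite (@big_cat_nat _ _ _ (n - r).+1)/=; [|lia|lia].
  rewrite [X in _ + X]big_nat_cond [X in _ + X]big1 ?addr0//.
  by move=> i /andP[/andP[h _] _]; rewrite bernstein_gt ?mul0r//.
rewrite -(big_mkord xpredT (fun k =>
  (if (r <= k)%N then bernstein (n - r) (k - r) x else 0) * phi k)).
rewrite (@big_cat_nat _ _ _ r)/=; [|lia|lia].
rewrite big_nat_cond big1 ?add0r; last first.
  by move=> i /andP[/andP[_ h] _]; rewrite leqNgt h /= mul0r.
rewrite -{1}[r]add0n big_addn /bernstein_op.
rewrite (_ : (n.+1 - r = (n - r).+1)%N); last by lia.
by apply: eq_bigr => i _; rewrite leq_addl addnK.
Qed.

Lemma sum_stancu1 n r x : (2 * r < n)%N ->
  \sum_(k < n.+1) stancu n k r x = 1.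
Proof.
move=> rn; under eq_bigr do rewrite -[stancu _ _ _ _]mulr1.
by rewrite (sum_stancu (fun=> 1))// !bernstein_op1; ring.
Qed.

(** The scale on which the operators average. *)
Definition mesh n r : R := 2 * r.+1%:R / Num.sqrt n.+1%:R.

Lemma mesh_gt0 n r : 0 < mesh n r.
Proof. by rewrite /mesh divr_gt0 ?mulr_gt0// sqrtr_gt0. Qed.

Lemma mesh_sqr n r : mesh n r ^+ 2 = 4 * r.+1%:R ^+ 2 / n.+1%:R.
Proof. by rewrite /mesh expr_div_n sqr_sqrtr// exprMn; congr (_ * _ / _); ring. Qed.

(** Both binomial laws have variance at most [n], and the shift [r], the
    offset [u] and the denominator [n + 1] in place of [n - r] move the mean
    by at most [r + 1]. *)
Lemma stancu_moment n r x (u : R) : (2 * r < n)%N -> 0 <= x <= 1 -> 0 <= u <= 1 ->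
  \sum_(k < n.+1) stancu n k r x * ((k%:R + u) / n.+1%:R - x) ^+ 2
    <= mesh n r ^+ 2.
Proof.
move=> rn x01 u01.
pose m := (n - r)%N.
have N0 : (0 : R) < n.+1%:R by [].
have rR : (0 : R) <= r%:R by [].
have [x0 x1] := andP x01; have [u0 u1] := andP u01.
have rx0 : 0 <= r%:R * x by rewrite mulr_ge0.
have rx1 : r%:R * x <= r%:R by rewrite ler_piMr.
have Nm : n.+1%:R = m%:R + r.+1%:R :> R by rewrite -natrD /m; congr _%:R; lia.
pose D : R := r.+1%:R ^+ 2.
(* [b] collects the shifts of the mean; both laws below use [|b| <= r + 1] *)
have key (b : R) : (- r.+1%:R <= b <= r.+1%:R) ->
    bernstein_op m (fun k => (k%:R + b - m%:R * x) ^+ 2) x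
      <= m%:R * x * (1 - x) + D.
  move=> /andP[b1 b2].
  rewrite (_ : (fun _ => _) = fun k => (k%:R - (m%:R * x - b)) ^+ 2); last first.
    by apply/funext => k; congr (_ ^+ 2); ring.
  rewrite bernstein_op_sqr lerD2l /D.
  by rewrite (_ : _ - _ = b); [nra|ring].
rewrite (sum_stancu (fun k => ((k%:R + u) / n.+1%:R - x) ^+ 2))//.
have sE (phi : nat -> R) : bernstein_op m (fun k => ((phi k + u) / n.+1%:R - x) ^+ 2) x
   = (n.+1%:R ^+ 2)^-1 * bernstein_op m (fun k => (phi k + u - n.+1%:R * x) ^+ 2) x.
  rewrite /bernstein_op mulr_sumr; apply: eq_bigr => k _.
  by field; rewrite addrC natr1.
have b1 : bernstein_op m (fun k => ((k%:R + u) / n.+1%:R - x) ^+ 2) x <=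
   (n.+1%:R ^+ 2)^-1 * (m%:R * x * (1 - x) + D).
  rewrite sE ler_wpM2l ?invr_ge0 ?exprn_ge0//.
  rewrite (_ : (fun _ => _) = (fun k => (k%:R + (u - r.+1%:R * x) - m%:R * x) ^+ 2)).
    by apply: key; rewrite -natr1; lra.
  by apply/funext => k; rewrite Nm; congr (_ ^+ 2); ring.
have b2 : bernstein_op m (fun k => (((k + r)%N%:R + u) / n.+1%:R - x) ^+ 2) x <=
   (n.+1%:R ^+ 2)^-1 * (m%:R * x * (1 - x) + D).
  rewrite sE ler_wpM2l ?invr_ge0 ?exprn_ge0//.
  rewrite (_ : (fun _ => _) = (fun k => (k%:R + (r%:R + u - r.+1%:R * x) - m%:R * x) ^+ 2)).
    by apply: key; rewrite -natr1; lra.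
  by apply/funext => k; rewrite Nm natrD; congr (_ ^+ 2); ring.
apply: (@le_trans _ _ ((n.+1%:R ^+ 2)^-1 * (m%:R * x * (1 - x) + D))).
  have x1' : 0 <= 1 - x by rewrite subr_ge0.
  move: b1 b2 => /(ler_wpM2l x1') b1 /(ler_wpM2l x0) b2.
  by apply: le_trans (lerD b1 b2) _; rewrite -mulrDl subrK mul1r.
rewrite mesh_sqr ler_pdivrMl ?exprn_gt0// /D.
rewrite [X in _ <= X](_ : _ = n.+1%:R * (4 * r.+1%:R ^+ 2)); last by field; rewrite addrC natr1.
have D1 : 1 <= r.+1%:R ^+ 2 :> R by rewrite expr_ge1// ler1n.
have N1 : 1 <= n.+1%:R :> R by rewrite ler1n.
have mN : m%:R <= n.+1%:R :> R by rewrite ler_nat leqW// leq_subr.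
have : m%:R * x * (1 - x) <= n.+1%:R.
  have xx : x * (1 - x) <= 1 by nra.
  have m0 : (0 : R) <= m%:R by [].
  rewrite -mulrA (le_trans _ mN)// ler_piMr//.
nra.
Qed.

End bernstein_stancu.

(** * The one-dimensional averaging kernel *)

Section measurability.
Context d (T : measurableType d) (R : realType).

Lemma measurable_natr_bool (b : T -> bool) : measurable_fun setT b ->
  measurable_fun setT (fun x => (b x)%:R : R).
Proof.
move=> mb; apply: (measurableT_comp (f := fun b : bool => b%:R : R)) => //.
Qed.

End measurability.

Section affine_change_of_variable.
Variable R : realType.
Local Notation mu := (@lebesgue_measure R).

Lemma ge0_integral_shift_scale (N k : R) (F : R -> \bar R) : 0 < N ->
  measurable_fun setT F -> (forall x, 0 <= F x)%E ->
  (\int[mu]_u F ((k + u) / N)%R = N%:E * \int[mu]_x F x)%E.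
Proof.
move=> N0 mF F0.
pose T (u : measurableTypeR R) : measurableTypeR R := (k + u) / N.
have mT : measurable_fun setT T.
  apply: (@measurable_funM _ _ R) => //; exact: (@measurable_funD _ _ R).
have N1 : 0 <= N^-1 by rewrite invr_ge0 ltW.
have muE A : measurable A -> mu A = mscale (NngNum N1) (pushforward mu T) A.
  move=> mA; apply: (lebesgue_measure_unique (mu := mscale (NngNum N1) (pushforward mu T))) => // X [[a b] _ <-] /=.
  rewrite /mscale /= /pushforward.
  rewrite (_ : T @^-1` _ = `]N * a - k, N * b - k]%classic); last first.
    apply/seteqP; split => u /=; rewrite !in_itv /= /T ltr_pdivlMr// ler_pdivrMr//;
     by rewrite ltrBlDl lerBrDl ![N * _]mulrC.
  rewrite !lebesgue_measure_itv/= !lte_fin ltrBlDr subrK ltr_pM2l//.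
  case: ifPn => _; last by rewrite mule0.
  by rewrite -EFinM; congr EFin; field; rewrite gt_eqF.
rewrite [in RHS](eq_measure_integral (mscale (NngNum N1) (pushforward mu T))); last first.
  by move=> A mA _; exact: muE.
rewrite ge0_integral_mscale// ge0_integral_pushforward// preimage_setT muleA -EFinM/=.
by rewrite divff ?gt_eqF// mul1e.
Qed.

End affine_change_of_variable.

Section stancu_integral.
Variable R : realType.

Local Notation I01 := (`[0%R, 1%R]%classic : set R).

Lemma measurable_indic01 : measurable_fun setT (\1_I01 : R -> R).
Proof. by apply: measurable_indic; exact: measurable_itv. Qed.

Lemma indic01_ge0 x (y : R) : (x \in `[0%R, 1%R] -> 0 <= y) -> 0 <= \1_I01 x * y.
Proof.
move=> y0; rewrite indicE; case: (boolP (x \in I01)) => [|_].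
  by rewrite inE mul1r.
by rewrite mul0r.
Qed.

Lemma measurable_bernstein m k : measurable_fun setT (fun x : R => bernstein m k x).
Proof.
rewrite (_ : (fun _ => _) = fun x => 'C(m, k)%:R * XMonemX k (m - k) x).
  by apply: measurable_funM => //; exact: measurable_XMonemX.
by apply/funext => x; rewrite /bernstein /XMonemX mulrA.
Qed.

Lemma measurable_stancu n k r : measurable_fun setT (fun x : R => stancu n k r x).
Proof.
have m1 k' : measurable_fun setT (fun x : R => (1 - x) * bernstein (n - r) k' x).
  apply: measurable_funM; last exact: measurable_bernstein.
  exact: measurable_funB.
have m2 k' : measurable_fun setT (fun x : R => x * bernstein (n - r) k' x).
  by apply: measurable_funM => //; exact: measurable_bernstein.
rewrite /stancu; case: (k < r)%N; [exact: m1|case: (k <= n - r)%N; [|exact: m2]].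
exact: measurable_funD.
Qed.

(** A beta integral. *)
Lemma integral_bernstein m k : (k <= m)%N ->
  (\int[@unit_leb R]_x (\1_I01 x * bernstein m k x)%:E = (m.+1%:R^-1)%:E)%E.
Proof.
move=> km.
rewrite integral_unit_leb; last 2 first.
- apply/measurable_EFinP; apply: measurable_funM; first exact: measurable_indic01.
  exact: measurable_bernstein.
- move=> x; rewrite lee_fin; apply: indic01_ge0 => x01; apply: bernstein_ge0.
  by rewrite in_itv in x01.
transitivity (\int[lebesgue_measure]_(x in I01)
    ('C(m, k)%:R%:E * (XMonemX k (m - k) x)%:E))%E.
  apply: eq_integral => x x01; rewrite indicE x01 mul1r -EFinM.
  by rewrite /bernstein /XMonemX mulrA.
rewrite integralZl//; last exact: integrable_XMonemX.
rewrite [X in (_ * X)%E](_ : _ = (beta_fun k.+1 (m - k).+1)%:E); last first.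
  rewrite EFin_beta_fun [LHS]integral_mkcond; apply: eq_integral => x _ /=.
  by rewrite !patchE; case: ifP.
rewrite -EFinM beta_funE/= addnS subnKC// factS -(bin_fact km) !natrM.
have ? : 'C(m, k)%:R != 0 :> R by rewrite pnatr_eq0 -lt0n bin_gt0.
have ? : k`!%:R != 0 :> R by rewrite pnatr_eq0 -lt0n fact_gt0.
have ? : (m - k)`!%:R != 0 :> R by rewrite pnatr_eq0 -lt0n fact_gt0.
congr EFin; field.
by rewrite addrC natr1 pnatr_eq0; do !(apply/andP; split).
Qed.

Lemma integral_bernstein_le m k :
  (\int[@unit_leb R]_x (\1_I01 x * bernstein m k x)%:E <= (m.+1%:R^-1)%:E)%E.
Proof.
have [km|mk] := leqP k m; first by rewrite integral_bernstein.
under eq_integral do rewrite bernstein_gt// mulr0.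
by rewrite integral0 lee_fin invr_ge0.
Qed.

Lemma integral_stancu_le n r k : (2 * r < n)%N -> (k <= n)%N ->
  (\int[@unit_leb R]_x (\1_I01 x * stancu n k r x)%:E
    <= (4 / n.+1%:R)%:E)%E.
Proof.
move=> rn kn; pose m := (n - r)%N.
pose g j x := (\1_I01 x * bernstein m j x)%:E.
have g0 j x : (0 <= g j x)%E.
  by rewrite lee_fin; apply: indic01_ge0 => x01; apply: bernstein_ge0; rewrite in_itv in x01.
have mg j : measurable_fun setT (g j).
  apply/measurable_EFinP; apply: measurable_funM; first exact: measurable_indic01.
  exact: measurable_bernstein.
apply: (@le_trans _ _ (\int[@unit_leb R]_x (g k x + g (k - r)%N x)))%E.
  apply: ge0_le_integral => //.
  - move=> x _; rewrite lee_fin; apply: indic01_ge0 => x01.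
    by apply: stancu_ge0; rewrite in_itv in x01.
  - apply/measurable_EFinP; apply: measurable_funM; first exact: measurable_indic01.
    exact: measurable_stancu.
  - exact: emeasurable_funD.
  - move=> x _; rewrite /g -EFinD lee_fin -mulrDr !indicE.
    case: (boolP (x \in I01)) => [|_]; last by rewrite !mul0r.
    rewrite inE/= in_itv/= => x01; rewrite !mul1r stancuE//.
    have := @bernstein_ge0 R m k x x01; have := @bernstein_ge0 R m (k - r)%N x x01.
    move: x01 => /andP[x0 x1] b2 b1; rewrite -/m.
    apply: lerD; first by rewrite ler_piMl// lerBlDr lerDl.
    by case: ifP => _; [rewrite ler_piMl|rewrite mulr0].
rewrite ge0_integralD//.
apply: (@le_trans _ _ ((m.+1%:R^-1)%:E + (m.+1%:R^-1)%:E)%E).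
  by apply: leeD; exact: integral_bernstein_le.
have h : n.+1%:R <= 2 * m.+1%:R :> R by rewrite -natrM ler_nat /m; lia.
have m0 : (0 : R) < m.+1%:R by [].
rewrite -EFinD lee_fin ler_pdivlMr//.
rewrite (_ : _ * _ = 2 * n.+1%:R / m.+1%:R); last by field; rewrite addrC natr1.
by rewrite ler_pdivrMr//; lra.
Qed.

Definition cell n k : set R := `[k%:R / n.+1%:R, k.+1%:R / n.+1%:R[%classic.

Lemma cell_sub n k : (k <= n)%N -> cell n k `<=` I01.
Proof.
move=> kn x; rewrite /cell /= !in_itv/= => /andP[x0 x1].
rewrite (le_trans _ x0) ?divr_ge0//= (le_trans (ltW x1))// ler_pdivrMr// mul1r.
by rewrite ler_nat.
Qed.

Lemma measurable_cell n k : measurable (cell n k).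
Proof. exact: measurable_itv. Qed.

Lemma sum_cell_le1 n (y : R) : \sum_(k < n.+1) \1_(cell n k) y <= 1 :> R.
Proof.
have [/existsP[j yj]|/existsPn yn] := boolP [exists j : 'I_n.+1, y \in cell n j].
  rewrite (bigD1 j)//= big1 ?addr0 ?indicE ?lern1 ?leq_b1//.
  move=> i ij; rewrite indicE; case: (boolP (y \in _)) => // yi; exfalso.
  move: yi yj ij; rewrite !inE /cell/= !in_itv/= => /andP[i1 i2] /andP[j1 j2].
  have := le_lt_trans i1 j2; have := le_lt_trans j1 i2.
  rewrite !ltr_pM2r ?invr_gt0// !ltr_nat !ltnS => h1 h2.
  by rewrite -val_eqE/= eqn_leq h1 h2.
by rewrite big1 ?ler01// => i _; rewrite indicE (negbTE (yn i)).
Qed.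

(** The change of variable [y = (k + u) / (n + 1)] turns an average over
    the unit interval into an integral over a cell. *)
Lemma ge0_integral_cell n k (F : R -> \bar R) : (k <= n)%N ->
  measurable_fun setT F -> (forall x, 0 <= F x)%E ->
  (\int[@unit_leb R]_u F ((k%:R + u) / n.+1%:R)%R =
   \int[@unit_leb R]_y ((n.+1%:R * \1_(cell n k) y)%:E * F y))%E.
Proof.
move=> kn mF F0.
have mi : measurable_fun setT (\1_(cell n k) : R -> R).
  by apply: measurable_indic; exact: measurable_cell.
have mT : measurable_fun setT (fun u : R => (k%:R + u) / n.+1%:R).
  by apply: measurable_funM => //; exact: measurable_funD.
have mFT : measurable_fun setT (fun u : R => F ((k%:R + u) / n.+1%:R)).
  exact: (measurableT_comp mF mT).
pose G x := ((\1_(cell n k) x)%:E * F x)%E.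
have miF : measurable_fun setT G.
  by apply: emeasurable_funM => //; exact/measurable_EFinP.
have iF0 x : (0 <= G x)%E.
  by rewrite mule_ge0// lee_fin indicE.
rewrite integral_unit_leb// -integral_itv_bndo_bndc; last exact: measurable_funTS.
rewrite integral_mkcond.
rewrite (_ : _ \_ _ = fun u => G ((k%:R + u) / n.+1%:R)); last first.
  apply/funext => u; rewrite patchE /G/= indicE.
  have -> : (u \in `[0%R, 1%R[%classic) = ((k%:R + u) / n.+1%:R \in cell n k).
    apply/idP/idP; rewrite !inE /cell/= !in_itv/= ler_pM2r ?invr_gt0// lerDl;
    by rewrite ltr_pM2r ?invr_gt0// -natr1 ltrD2l.
  by case: ifPn => _; rewrite ?mul1e ?mul0e.
rewrite (@ge0_integral_shift_scale _ _ _ G)//.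
under [in RHS]eq_integral do rewrite EFinM -muleA.
rewrite (@ge0_integralZl_EFin _ _ _ _ _ _ G)//; congr (_ * _)%E.
rewrite [RHS](@integral_unit_leb _ G)// [RHS]integral_mkcond.
apply: eq_integral => x _; rewrite patchE /G; case: ifPn => // x01.
rewrite indicE memNset ?mul0e// => /(cell_sub kn) /mem_set.
by rewrite (negbTE x01).
Qed.

(** The kernel of the operator in dimension one. The indicator of the unit
    interval makes it nonnegative for all real arguments, as Schur's test
    asks. *)
Definition kern1 n r (x y : R) : R :=
  \1_I01 x * \sum_(k < n.+1) stancu n k r x * (n.+1%:R * \1_(cell n k) y).

Lemma kern1_ge0 n r x y : 0 <= kern1 n r x y.
Proof.
apply: indic01_ge0 => x01; apply: sumr_ge0 => k _.
by rewrite mulr_ge0 ?mulr_ge0// ?indicE// stancu_ge0//; rewrite in_itv in x01.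
Qed.

Lemma measurable_kern1 n r :
  measurable_fun setT (fun q : R * R => kern1 n r q.1 q.2).
Proof.
apply: measurable_funM.
  exact: (measurableT_comp measurable_indic01 measurable_fst).
apply: measurable_sum => k; apply: measurable_funM.
  exact: (measurableT_comp (measurable_stancu n k r) measurable_fst).
apply: measurable_funM => //; apply: measurableT_comp measurable_snd.
by apply: measurable_indic; exact: measurable_cell.
Qed.

Lemma measurable_kern1r n r x : measurable_fun setT (kern1 n r x).
Proof. exact: (measurableT_comp (measurable_kern1 n r) (measurable_pair1 x)). Qed.

Lemma ge0_integral_kern1 n r x (F : R -> \bar R) : x \in `[0%R, 1%R] ->
  measurable_fun setT F -> (forall x, 0 <= F x)%E ->
  (\int[@unit_leb R]_y ((kern1 n r x y)%:E * F y) =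
  \sum_(k < n.+1) (stancu n k r x)%:E *
    \int[@unit_leb R]_u F ((k%:R + u) / n.+1%:R)%R)%E.
Proof.
move=> x01 mF F0.
have s0 k : 0 <= stancu n k r x by rewrite stancu_ge0//; rewrite in_itv in x01.
pose G (k : 'I_n.+1) y := ((stancu n k r x)%:E * ((n.+1%:R * \1_(cell n k) y)%:E * F y))%E.
have mi k : measurable_fun setT (fun y => (n.+1%:R * \1_(cell n k) y)%:E * F y)%E.
  apply: emeasurable_funM => //; apply/measurable_EFinP; apply: measurable_funM => //.
  by apply: measurable_indic; exact: measurable_cell.
have i0 k y : (0 <= (n.+1%:R * \1_(cell n k) y)%:E * F y)%E.
  by rewrite mule_ge0// lee_fin mulr_ge0// indicE.
transitivity (\int[@unit_leb R]_y (\sum_(k < n.+1) G k y))%E.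
  apply: eq_integral => y _; rewrite /kern1 indicE mem_set//= mul1r.
  rewrite -sumEFin ge0_sume_distrl; last first.
    by move=> k _; rewrite lee_fin mulr_ge0// mulr_ge0// indicE.
  by apply: eq_bigr => k _; rewrite /G EFinM muleA.
rewrite ge0_integral_sum//.
- by apply: eq_bigr => -[k kn] _; rewrite /G ge0_integralZl_EFin// ge0_integral_cell.
- by move=> k; apply: emeasurable_funM.
- by move=> k y _; rewrite mule_ge0// lee_fin.
Qed.

Lemma kern1_out n r x y : x \notin `[0%R, 1%R] -> kern1 n r x y = 0.
Proof. by move=> x01; rewrite /kern1 indicE memNset ?mul0r//; exact/negP. Qed.

Lemma integral_kern1r n r x : (2 * r < n)%N -> x \in `[0%R, 1%R] ->
  (\int[@unit_leb R]_y (kern1 n r x y)%:E = 1)%E.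
Proof.
move=> rn x01; under eq_integral do rewrite -[(kern1 _ _ _ _)%:E]mule1.
rewrite (@ge0_integral_kern1 _ _ _ (cst 1%E))//.
under eq_bigr do rewrite /= integral_unit_leb_cst mule1.
by rewrite sumEFin sum_stancu1.
Qed.

(** Each Stancu weight has mass at most [4 / (n + 1)], and [y] lies in at
    most one cell. *)
Lemma integral_kern1l n r y : (2 * r < n)%N ->
  (\int[@unit_leb R]_x (kern1 n r x y)%:E <= 4%:E)%E.
Proof.
move=> rn.
pose G (k : 'I_n.+1) x := ((n.+1%:R * \1_(cell n k) y)%:E * (\1_I01 x * stancu n k r x)%:E)%E.
have s0 k x : 0 <= \1_I01 x * stancu n k r x.
  by apply: indic01_ge0 => x01; rewrite stancu_ge0//; rewrite in_itv in x01.
have ms k : measurable_fun setT (fun x => (\1_I01 x * stancu n k r x)%:E).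
  apply/measurable_EFinP; apply: measurable_funM; first exact: measurable_indic01.
  exact: measurable_stancu.
have i0 k : 0 <= n.+1%:R * \1_(cell n k) y :> R by rewrite mulr_ge0// indicE.
rewrite (_ : (fun x => _) = (fun x => \sum_(k < n.+1) G k x)%E); last first.
  apply/funext => x; rewrite /kern1 mulr_sumr -sumEFin; apply: eq_bigr => k _.
  by rewrite /G -EFinM; congr EFin; ring.
rewrite ge0_integral_sum//.
- apply: (@le_trans _ _ (\sum_(k < n.+1) (4 * \1_(cell n k) y)%:E)%E).
    apply: lee_sum => -[k kn] _; rewrite /G ge0_integralZl_EFin//=.
    apply: le_trans (lee_wpmul2l _ (integral_stancu_le rn kn)) _; first by rewrite lee_fin.
    by rewrite -EFinM lee_fin le_eqVlt; apply/orP; left; apply/eqP; field; rewrite addrC natr1.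
    by move=> x _; rewrite lee_fin.
  rewrite sumEFin lee_fin -mulr_sumr.
  by rewrite ler_piMr// sum_cell_le1.
- by move=> k; exact: emeasurable_funM.
- by move=> k x _; rewrite mule_ge0// lee_fin.
Qed.

Definition between (x y t : R) : bool := (Num.min x y <= t <= Num.max x y).

(** Up to a constant, Chebyshev's bound for the mass that a law with second
    moment [mesh ^ 2] around [x] places beyond [t]. *)
Definition dom_kern n r (x t : R) : R :=
  4 * mesh R n r ^+ 2 / (`|t - x| + mesh R n r) ^+ 2.

Lemma dom_kern_ge0 n r x t : 0 <= dom_kern n r x t.
Proof. by rewrite divr_ge0 ?sqr_ge0// mulr_ge0// sqr_ge0. Qed.

Lemma measurable_between :
  measurable_fun setT (fun q : R * R * R => between q.1.1 q.1.2 q.2).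
Proof.
rewrite /between; apply: measurable_and; apply: measurable_fun_ler => //.
- by apply: measurable_minr; exact: measurableT_comp.
- by apply: measurable_maxr; exact: measurableT_comp.
Qed.

(** Chebyshev's inequality: if [t] lies between [x] and [y] then
    [|t - x| <= |y - x|], so that
    [(|t - x| + c)^2 <= 2 ((y - x)^2 + c^2)], and the second moment of the
    kernel is at most [c^2]. *)
Lemma kern1_between n r (x t : R) : (2 * r < n)%N ->
  (\int[@unit_leb R]_y (kern1 n r x y * (between x y t)%:R)%:E <=
   (dom_kern n r x t)%:E)%E.
Proof.
move=> rn; set c := mesh R n r; have c0 : 0 < c by exact: mesh_gt0.
have [x01|x01] := boolP (x \in `[0%R, 1%R]); last first.
  under eq_integral do rewrite kern1_out// mul0r.
  by rewrite integral0 lee_fin dom_kern_ge0.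
set D := (`|t - x| + c) ^+ 2.
have D0 : 0 < D by rewrite exprn_gt0// ltr_wpDl.
(* a quadratic function of [y] above the indicator of [between x y t] *)
pose H y : R := 2 * ((y - x) ^+ 2 + c ^+ 2) / D.
have H0 y : 0 <= H y by rewrite divr_ge0 ?mulr_ge0 ?addr_ge0 ?sqr_ge0// ltW.
have mH : measurable_fun setT H.
  apply: measurable_funM => //; apply: measurable_funM => //.
  apply: measurable_funD => //; apply: measurable_funX; exact: measurable_funB.
have bH y : (between x y t)%:R <= H y.
  rewrite /H ler_pdivlMr// /between.
  case: (boolP (_ && _)) => [|_]; last first.
    by rewrite mul0r mulr_ge0 ?addr_ge0 ?sqr_ge0.
  move=> xyt; rewrite mul1r /D.
  have tx : `|t - x| <= `|y - x|.
    move: xyt; case: (lerP x y) => [xy|/ltW xy] /andP[h1 h2].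
      by rewrite !ger0_norm ?subr_ge0//; lra.
    by rewrite !ler0_norm ?subr_le0//; lra.
  rewrite -[(y - x) ^+ 2]real_normK ?num_real//.
  have := normr_ge0 (t - x); have := sqr_ge0 (`|y - x| - c); nra.
apply: (@le_trans _ _ (\int[@unit_leb R]_y ((kern1 n r x y)%:E * (H y)%:E))%E).
  apply: ge0_le_integral => //.
  - by move=> y _; rewrite lee_fin mulr_ge0// kern1_ge0.
  - apply/measurable_EFinP; apply: measurable_funM; first exact: measurable_kern1r.
    apply: measurable_natr_bool.
    rewrite (_ : between x ^~ t = (fun q => between q.1.1 q.1.2 q.2) \o (fun y => (x, y, t)))//.
    apply: measurableT_comp; first exact: measurable_between.
    by do !apply: measurable_fun_pair.
  - by apply: emeasurable_funM; apply/measurable_EFinP => //; exact: measurable_kern1r.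
  - by move=> y _; rewrite -EFinM lee_fin ler_wpM2l// kern1_ge0.
rewrite (@ge0_integral_kern1 _ _ _ (EFin \o H))//; last exact/measurable_EFinP.
have s0 k : 0 <= stancu n k r x by rewrite stancu_ge0//; rewrite in_itv in x01.
have mHk k : measurable_fun setT (fun u : R => (H ((k%:R + u) / n.+1%:R))%:E).
  apply/measurable_EFinP/(measurableT_comp mH).
  by apply: measurable_funM => //; exact: measurable_funD.
pose S (u : R) := (\sum_(k < n.+1) ((stancu n k r x)%:E * (H ((k%:R + u) / n.+1%:R))%:E))%E.
have mS k : measurable_fun setT (fun u : R => ((stancu n k r x)%:E * (H ((k%:R + u) / n.+1%:R))%:E)%E).
  exact: emeasurable_funM.
rewrite (_ : (\sum_(k < _) _)%E = \int[@unit_leb R]_u S u)%E; last first.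
  rewrite ge0_integral_sum//.
    by apply: eq_bigr => k _; rewrite ge0_integralZl_EFin// => u _; rewrite lee_fin.
  by move=> k u _; rewrite mule_ge0// lee_fin.
have S0 u : (0 <= S u)%E by apply: sume_ge0 => k _; rewrite mule_ge0// lee_fin.
have mS' : measurable_fun setT S by apply: emeasurable_sum.
rewrite -[leRHS](integral_unit_leb_cst (dom_kern n r x t)%:E) !integral_unit_leb//; last first.
  by move=> _; rewrite lee_fin dom_kern_ge0.
apply: ge0_le_integral => //; [exact: measurable_funTS|].
move=> u /=; rewrite in_itv/= => u01.
rewrite /S; under eq_bigr do rewrite -EFinM.
rewrite sumEFin lee_fin /H.
under eq_bigr do rewrite mulrA mulrCA mulrDr (mulrC _ (c ^+ 2)).
rewrite -mulr_suml -mulr_sumr big_split/= -[X in _ + X]mulr_sumr sum_stancu1// mulr1.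
rewrite /dom_kern -/c -/D ler_pM2r ?invr_gt0//.
have := stancu_moment rn (_ : 0 <= x <= 1) u01; rewrite -/c.
rewrite in_itv in x01 => /(_ x01) h; lra.
Qed.

End stancu_integral.

(** * Jensen's inequality, Schur's test and the dominating kernel *)

Section power_means.
Variable R : realType.

(** The tangent line inequality for the convex function [y ^ p]
    at [lam], which linearises the power in Jensen's inequality. *)
Lemma young_powR (p lam y : R) : 1 <= p -> 0 < lam -> 0 <= y ->
  y <= p^-1 * lam `^ (1 - p) * y `^ p + (1 - p^-1) * lam.
Proof.
move=> p1 l0 y0; move: (p1); rewrite le_eqVlt => /predU1P[<-|pgt1].
  by rewrite subrr powRr0 powRr1// invr1 subrr; lra.
have p0 : 0 < p by apply: lt_le_trans p1.
have q0 : 0 < 1 - p^-1 by rewrite subr_gt0 invf_lt1.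
have := @conjugate_powR R (y / lam) 1 p (1 - p^-1)^-1 _ _ p0 _ _.
rewrite divr_ge0 ?(ltW l0)// ler01 invr_gt0 q0 invrK subrKC => /(_ isT isT isT erefl).
rewrite powR1 mulr1 mul1r ler_pdivrMr// => /le_trans; apply.
rewrite mulrDl lerD2r powRM ?invr_ge0 ?(ltW l0)//.
rewrite -(powR_inv1 (ltW l0)) -powRrM mulN1r.
rewrite [lam `^ (1 - p)]powRD; last by rewrite (gt_eqF l0) implybT.
rewrite powRr1 ?(ltW l0)//.
rewrite le_eqVlt; apply/orP; left; apply/eqP; ring.
Qed.

Lemma young_poweR (p lam : R) (y : \bar R) : 1 <= p -> 0 < lam -> (0 <= y)%E ->
  (y <= (p^-1 * lam `^ (1 - p))%:E * y `^ p + ((1 - p^-1) * lam)%:E)%E.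
Proof.
move=> p1 l0; have p0 : 0 < p by apply: lt_le_trans p1.
case: y => [y|_|//].
  by rewrite lee_fin => y0; rewrite poweR_EFin -EFinM -EFinD lee_fin young_powR.
rewrite poweRyr ?gt_eqF// gt0_muley ?lte_fin ?mulr_gt0 ?invr_gt0 ?powR_gt0//.
Qed.

Lemma measurable_fun_poweR d (T : measurableType d) (f : T -> \bar R) (p : R) :
  measurable_fun setT f -> measurable_fun setT (fun x => f x `^ p)%E.
Proof. exact: (measurableT_comp (measurable_poweR p)). Qed.

Lemma ge0_ler_poweR (p : R) (x y : \bar R) : 0 <= p -> (0 <= x)%E -> (x <= y)%E ->
  (x `^ p <= y `^ p)%E.
Proof.
move=> p0 x0 xy; apply: gt0_ler_poweR => //; rewrite in_itv/= leey andbT//.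
exact: le_trans xy.
Qed.

Section jensen.
Context d (T : measurableType d) (mu : {measure set T -> \bar R}).
Variables (a : T -> R) (phi : T -> \bar R) (m p : R).
Hypotheses (m0 : 0 < m) (p1 : 1 <= p).
Hypotheses (a0 : forall x, 0 <= a x) (ma : measurable_fun setT a).
Hypotheses (phi0 : forall x, (0 <= phi x)%E) (mphi : measurable_fun setT phi).
Hypothesis am : (\int[mu]_x (a x)%:E <= m%:E)%E.

(** The integral of the tangent line inequality bounds the first moment [X]
    by the [p]-th moment [Y] for every [lam]; the choice
    [lam = (Y / m) ^ (1 / p)] is optimal. Infinite values of [phi] are
    allowed. *)
Lemma ge0_jensen_poweR :
  ((\int[mu]_x ((a x)%:E * phi x)) `^ p <=
   (m `^ (p - 1))%:E * \int[mu]_x ((a x)%:E * phi x `^ p))%E.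
Proof.
have p0 : 0 < p by apply: lt_le_trans p1.
have ma' : measurable_fun setT (EFin \o a) by exact/measurable_EFinP.
have a0' x : (0 <= (a x)%:E)%E by rewrite lee_fin.
have mphip := measurable_fun_poweR p mphi.
have m1 : measurable_fun setT (fun x => (a x)%:E * phi x)%E.
  exact: emeasurable_funM.
have m2 : measurable_fun setT (fun x => (a x)%:E * phi x `^ p)%E.
  exact: emeasurable_funM.
set X := (\int[mu]_x ((a x)%:E * phi x))%E.
set Y := (\int[mu]_x ((a x)%:E * phi x `^ p))%E.
have X0 : (0 <= X)%E by apply: integral_ge0 => x _; rewrite mule_ge0.
have Y0 : (0 <= Y)%E by apply: integral_ge0 => x _; rewrite mule_ge0// poweR_ge0.
have mp0 : 0 < m `^ (p - 1) by rewrite powR_gt0.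
have bound lam : 0 < lam -> (X <= (p^-1 * lam `^ (1 - p))%:E * Y +
    ((1 - p^-1) * lam * m)%:E)%E.
  move=> l0.
  have c10 : 0 <= p^-1 * lam `^ (1 - p) by rewrite mulr_ge0 ?powR_ge0// invr_ge0 ltW.
  have c20 : 0 <= (1 - p^-1) * lam.
    by rewrite mulr_ge0 ?(ltW l0)// subr_ge0 invf_le1.
  apply: (@le_trans _ _ (\int[mu]_x ((p^-1 * lam `^ (1 - p))%:E * ((a x)%:E * phi x `^ p)
     + ((1 - p^-1) * lam)%:E * (a x)%:E))%E).
    apply: ge0_le_integral => //.
    - by move=> x _; rewrite mule_ge0.
    - by apply: emeasurable_funD; exact: emeasurable_funM.
    - move=> x _; apply: le_trans (lee_wpmul2l (a0' x) (young_poweR p1 l0 (phi0 x))) _.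
      by rewrite ge0_muleDr ?mule_ge0 ?lee_fin ?poweR_ge0// muleCA [X in (_ + X)%E]muleC.
  rewrite ge0_integralD//; last 4 first.
  - by move=> x _; rewrite mule_ge0 ?mule_ge0 ?lee_fin ?poweR_ge0.
  - exact: emeasurable_funM.
  - by move=> x _; rewrite mule_ge0 ?lee_fin.
  - exact: emeasurable_funM.
  rewrite ge0_integralZl_EFin//; last by move=> x _; rewrite mule_ge0 ?poweR_ge0.
  rewrite ge0_integralZl_EFin//.
  by rewrite leeD2l// [leRHS]EFinM; apply: lee_wpmul2l => //; rewrite lee_fin.
have [Yoo|Yfin] := eqVneq Y +oo%E.
  by rewrite Yoo gt0_muley ?lte_fin// leey.
have [y Yy] : exists y, Y = y%:E.
  by exists (fine Y); rewrite fineK// ge0_fin_numE// ltey.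
have y0 : 0 <= y by rewrite -lee_fin -Yy.
rewrite {Y0 Yfin}Yy in bound *; move: y0; rewrite le_eqVlt => /predU1P[yE|y0].
  rewrite -yE mule0.
  suff -> : X = 0%E by rewrite poweR0r ?gt_eqF.
  apply/eqP; rewrite eq_le X0 andbT; apply/lee_addgt0Pr => e e0; rewrite add0e.
  have := bound (e / m) (divr_gt0 e0 m0); rewrite -yE mule0 add0e => /le_trans; apply.
  rewrite lee_fin -mulrA divfK ?gt_eqF// ler_piMl ?(ltW e0)//.
  by rewrite lerBlDr lerDl invr_ge0 ltW.
(* equality case of the tangent line inequality *)
pose lam := (y / m) `^ p^-1.
have l0 : 0 < lam by rewrite powR_gt0// divr_gt0.
have lp : lam `^ p = y / m.
  by rewrite /lam -powRrM mulVf ?gt_eqF// powRr1// divr_ge0 ?ltW.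
have l1 : lam `^ (1 - p) * y = lam * m.
  rewrite powRD; last by rewrite (gt_eqF l0) implybT.
  rewrite powRr1 ?(ltW l0)// powRN lp.
  by field; rewrite !gt_eqF.
have Xl : (X <= (lam * m)%:E)%E.
  apply: le_trans (bound _ l0) _; rewrite -EFinM -EFinD lee_fin.
  rewrite -[p^-1 * _ * _]mulrA l1; lra.
apply: le_trans (ge0_ler_poweR (ltW p0) X0 Xl) _.
rewrite poweR_EFin -EFinM lee_fin powRM ?(ltW l0) ?(ltW m0)// lp.
rewrite -(mulr_powRB1 (ltW m0) p0).
rewrite le_eqVlt; apply/orP; left; apply/eqP; field.
by rewrite gt_eqF.
Qed.

End jensen.

Section schur.
Context d1 d2 (T1 : measurableType d1) (T2 : measurableType d2).
Variables (mu : {sigma_finite_measure set T1 -> \bar R}).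
Variables (nu : {sigma_finite_measure set T2 -> \bar R}).
Variables (a : T1 -> T2 -> R) (m p : R).
Hypotheses (m0 : 0 < m) (p1 : 1 <= p).
Hypotheses (a0 : forall x y, 0 <= a x y).
Hypothesis ma : measurable_fun setT (fun q : T1 * T2 => a q.1 q.2).
Hypothesis arow : forall x, (\int[nu]_y (a x y)%:E <= m%:E)%E.
Hypothesis acol : forall y, (\int[mu]_x (a x y)%:E <= m%:E)%E.

(** Jensen's inequality for the row measures [a x y dy], of mass at most
    [m], followed by Tonelli's theorem and the bound on the column
    masses. *)
Lemma schur_test (phi : T2 -> \bar R) : measurable_fun setT phi ->
  (forall y, 0 <= phi y)%E ->
  (\int[mu]_x ((\int[nu]_y ((a x y)%:E * phi y)) `^ p) <=
   (m `^ p)%:E * \int[nu]_y (phi y `^ p))%E.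
Proof.
move=> mphi phi0.
have p0 : 0 < p by apply: lt_le_trans p1.
have ma1 x : measurable_fun setT (a x) by exact: (measurableT_comp ma (measurable_pair1 x)).
have ma2 y : measurable_fun setT (a ^~ y) by exact: (measurableT_comp ma (measurable_pair2 y)).
have maE : measurable_fun setT (fun q : T1 * T2 => (a q.1 q.2)%:E) by exact/measurable_EFinP.
have mphip := measurable_fun_poweR p mphi.
have mb (psi : T2 -> \bar R) : measurable_fun setT psi ->
    measurable_fun setT (fun q : T1 * T2 => (a q.1 q.2)%:E * psi q.2)%E.
  by move=> mpsi; apply: emeasurable_funM => //; exact: (measurableT_comp mpsi measurable_snd).
have b0 psi : (forall y, 0 <= psi y)%E -> forall q : T1 * T2, (0 <= (a q.1 q.2)%:E * psi q.2)%E.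
  by move=> h q; rewrite mule_ge0// lee_fin.
have mp0 : 0 <= m `^ (p - 1) by rewrite powR_ge0.
apply: (@le_trans _ _ (\int[mu]_x ((m `^ (p - 1))%:E * \int[nu]_y ((a x y)%:E * phi y `^ p)))%E).
  apply: ge0_le_integral => //.
  - by move=> x _; exact: poweR_ge0.
  - apply: measurable_fun_poweR.
    exact: (measurable_fun_fubini_tonelli_F _ (mb _ mphi) (b0 _ phi0)).
  - apply: emeasurable_funM => //.
    exact: (measurable_fun_fubini_tonelli_F _ (mb _ mphip) (b0 _ (fun y => poweR_ge0 _ _))).
  - by move=> x _; exact: ge0_jensen_poweR.
rewrite ge0_integralZl_EFin//; last 2 first.
- by move=> x _; apply: integral_ge0 => y _; rewrite mule_ge0 ?lee_fin ?poweR_ge0.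
- exact: (measurable_fun_fubini_tonelli_F _ (mb _ mphip) (b0 _ (fun y => poweR_ge0 _ _))).
rewrite (fubini_tonelli (fun q : T1 * T2 => ((a q.1 q.2)%:E * phi q.2 `^ p)%E))//=; last 2 first.
- exact: (mb (fun y => phi y `^ p)%E).
- by move=> q; rewrite mule_ge0 ?lee_fin ?poweR_ge0.
rewrite -(mulr_powRB1 (ltW m0) p0) mulrC EFinM -muleA; apply: lee_wpmul2l => //.
rewrite -ge0_integralZl_EFin//; last 2 first.
- by move=> y _; rewrite poweR_ge0.
- exact: ltW.
apply: ge0_le_integral => //.
- by move=> y _; apply: integral_ge0 => x _; rewrite mule_ge0 ?lee_fin ?poweR_ge0.
- exact: (measurable_fun_fubini_tonelli_G _ (mb _ mphip) (b0 _ (fun y => poweR_ge0 _ _))).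
- exact: emeasurable_funM.
- move=> y _; under eq_integral do rewrite muleC.
  rewrite ge0_integralZl ?poweR_ge0//; last 2 first.
  + by apply/measurable_EFinP; exact: ma2.
  + by move=> x _; rewrite lee_fin.
  by rewrite muleC; apply: lee_wpmul2r; rewrite ?poweR_ge0.
Qed.

End schur.

End power_means.

Section dominating_kernel.
Variable R : realType.

Lemma integral_sqr_inv (a b s : R) : a < b ->
  (forall t, t \in `[a, b] -> t + s != 0) ->
  (\int[lebesgue_measure]_(t in `[a, b]) ((t + s) ^- 2)%:E =
    ((a + s)^-1 - (b + s)^-1)%:E)%E.
Proof.
move=> ab ts0.
have dF t : t \in `[a, b] -> is_derive t 1 (fun t : R => - (t + s)^-1) ((t + s) ^- 2).
  move=> /ts0 ts.
  have d1 : is_derive t (1:R) (fun t : R => t + s) 1.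
    by have := @is_deriveD R R R id (cst s) t 1 1 0; rewrite addr0; apply.
  have d2 : derivable (fun t : R => (t + s)^-1) t 1.
    by apply: derivableV => //; case: d1.
  apply: DeriveDef; first exact: derivableN.
  rewrite deriveN// deriveV//.
  by rewrite (@derive_val _ _ _ _ _ _ _ d1) [_ *: _]mulr1 opprK.
have cF t : t \in `[a, b] -> {for t, continuous (fun t : R => - (t + s)^-1)}.
  move=> tab; apply: differentiable_continuous; apply/derivable1_diffP.
  by case: (dF t tab).
rewrite (@continuous_FTC2 _ _ (fun t => - (t + s)^-1)) //.
- by rewrite -EFinB; congr EFin; ring.
- apply: derivable_within_continuous => t /ts0 ts.
  have h : derivable (fun t : R => t + s) t 1 by apply: derivableD.
  have h2 : derivable (fun t : R => (t + s) * (t + s)) t 1 by exact: derivableM.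
  rewrite (_ : (fun t => _) = fun t => ((t + s) * (t + s))^-1); last first.
    by apply/funext => u; rewrite expr2.
  apply: (@derivableV R R (fun t : R => (t + s) * (t + s)) t 1 _ h2).
  by rewrite mulf_neq0.
- split.
  + by move=> t /subset_itv_oo_cc tab; case: (dF t tab).
  + by apply: cvg_at_right_filter; apply: cF; rewrite in_itv/= lexx ltW.
  + by apply: cvg_at_left_filter; apply: cF; rewrite in_itv/= lexx ltW.
- by move=> t /subset_itv_oo_cc tab; rewrite derive1E; apply: derive_val; exact: dF.
Qed.

Let minv (a b s : R) : (forall t, t \in `[a, b] -> t + s != 0) ->
  measurable_fun `[a, b] (fun t : R => ((t + s) ^- 2)%:E).
Proof.
move=> ne; apply/measurable_EFinP; apply: subspace_continuous_measurable_fun => //.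
apply: continuous_in_subspaceT => t; rewrite inE => /ne ts.
apply: cvgV; first by rewrite expf_neq0.
apply: (@cvg_comp _ _ _ (fun y : R => y + s) (fun y => y ^+ 2) _ (nbhs (t + s))).
  by apply: cvgD; [exact: cvg_id|exact: cvg_cst].
exact: exprn_continuous.
Qed.

Lemma measurable_dom_kern n r :
  measurable_fun setT (fun q : R * R => dom_kern n r q.1 q.2).
Proof.
rewrite /dom_kern; set c := mesh R n r.
pose g (y : R) : R := 4 * c ^+ 2 / (`|y| + c) ^+ 2.
have mg : measurable_fun setT g.
  apply: continuous_measurable_fun => y.
  have c0 : 0 < c by exact: mesh_gt0.
  apply: cvgM; first exact: cvg_cst.
  apply: cvgV; first by rewrite gt_eqF// exprn_gt0// ltr_wpDl.
  apply: (@cvg_comp _ _ _ (fun y : R => `|y| + c) (fun y => y ^+ 2) _ (nbhs (`|y| + c))).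
    by apply: cvgD; [exact: norm_continuous|exact: cvg_cst].
  exact: exprn_continuous.
have ms : measurable_fun setT (fun q : R * R => q.2 - q.1) by exact: measurable_funB.
exact: (measurableT_comp mg ms).
Qed.

Lemma dom_kernC n r (x t : R) : dom_kern n r x t = dom_kern n r t x.
Proof. by rewrite /dom_kern distrC. Qed.

Let integral_dom_kern01 n r (x : R) : x \in `[0, 1] ->
  (\int[@unit_leb R]_t (dom_kern n r x t)%:E <= (8 * mesh R n r)%:E)%E.
Proof.
move=> x01; set c := mesh R n r; have c0 : 0 < c by exact: mesh_gt0.
have md : measurable_fun setT (fun t => (dom_kern n r x t)%:E).
  by apply/measurable_EFinP; exact: (measurableT_comp (measurable_dom_kern n r) (measurable_pair1 x)).
have [x0 x1] : 0 <= x /\ x <= 1 by move: x01; rewrite in_itv/= => /andP.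
have i1 : (\int[lebesgue_measure]_(t in `[0%R, x]) (dom_kern n r x t)%:E <= (4 * c)%:E)%E.
  move: x0; rewrite le_eqVlt => /predU1P[<-|x0].
    by rewrite set_itv1 integral_set1 lee_fin mulr_ge0// ltW.
  rewrite [leLHS](_ : _ = \int[lebesgue_measure]_(t in `[0%R, x]) ((4 * c ^+ 2)%:E * ((t + (- x - c)) ^- 2)%:E))%E; last first.
    apply: eq_integral => t; rewrite inE/= in_itv/= => /andP[t0 tx].
    rewrite -EFinM /dom_kern -/c ler0_norm ?subr_le0//; congr ((_ * _^-1)%:E).
    by rewrite -sqrrN; congr (_ ^+ 2); ring.
  have ne t : t \in `[0, x] -> t + (- x - c) != 0.
    by rewrite in_itv/= => /andP[_ tx]; rewrite lt_eqF//; lra.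
  rewrite ge0_integralZl_EFin//; last 3 first.
  - by move=> t _; rewrite lee_fin invr_ge0 sqr_ge0.
  - exact: minv ne.
  - by rewrite mulr_ge0// sqr_ge0.
  rewrite integral_sqr_inv// -EFinM lee_fin add0r.
  rewrite addrA subrr sub0r invrN opprK.
  have xc : 0 < x + c by rewrite addr_gt0.
  rewrite (_ : 4 * c = 4 * c ^+ 2 * c^-1); last by field; rewrite gt_eqF.
  rewrite ler_wpM2l ?mulr_ge0 ?sqr_ge0// gerDr.
  rewrite invr_le0; lra.
have i2 : (\int[lebesgue_measure]_(t in `[x, 1%R]) (dom_kern n r x t)%:E <= (4 * c)%:E)%E.
  move: x1; rewrite le_eqVlt => /predU1P[->|x1].
    by rewrite set_itv1 integral_set1 lee_fin mulr_ge0// ltW.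
  rewrite [leLHS](_ : _ = \int[lebesgue_measure]_(t in `[x, 1%R]) ((4 * c ^+ 2)%:E * ((t + (c - x)) ^- 2)%:E))%E; last first.
    apply: eq_integral => t; rewrite inE/= in_itv/= => /andP[xt t1].
    rewrite -EFinM /dom_kern -/c ger0_norm ?subr_ge0//; congr ((_ * (_ ^+ 2)^-1)%:E).
    ring.
  have ne t : t \in `[x, 1] -> t + (c - x) != 0.
    by rewrite in_itv/= => /andP[tx _]; rewrite gt_eqF//; lra.
  rewrite ge0_integralZl_EFin//; last 3 first.
  - by move=> t _; rewrite lee_fin invr_ge0 sqr_ge0.
  - exact: minv ne.
  - by rewrite mulr_ge0// sqr_ge0.
  rewrite integral_sqr_inv// -EFinM lee_fin subrKC.
  rewrite [leRHS](_ : 4 * c = 4 * c ^+ 2 * c^-1); last by field; rewrite gt_eqF.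
  rewrite ler_wpM2l ?mulr_ge0 ?sqr_ge0// gerBl invr_ge0; lra.
have d0 t : (0 <= (dom_kern n r x t)%:E)%E by rewrite lee_fin dom_kern_ge0.
rewrite integral_unit_leb//.
have -> : `[0%R, 1%R]%classic = `[0, x] `|` `]x, 1] :> set R.
  apply/seteqP; split => t /=; rewrite !in_itv/=.
    by move=> /andP[t0 t1]; case: (leP t x) => tx; [left|right]; apply/andP.
  move=> [|] /andP[h1 h2]; apply/andP; split => //; first exact: le_trans x1.
  exact: le_trans (ltW h1).
rewrite ge0_integral_setU//=; last 2 first.
- exact: measurable_funTS.
- by apply/disj_setPS => t [] /=; rewrite !in_itv/= => /andP[_ h1] /andP[]; rewrite ltNge h1.
rewrite integral_itv_obnd_cbnd; last exact: measurable_funTS.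
rewrite (_ : 8 * c = 4 * c + 4 * c); last by ring.
by rewrite EFinD leeD.
Qed.

(** The antiderivative of [(t + s) ^ -2] is explicit. For [x] outside of
    the unit interval the kernel is smaller than for the nearest endpoint. *)
Lemma integral_dom_kern n r (x : R) :
  (\int[@unit_leb R]_t (dom_kern n r x t)%:E <= (8 * mesh R n r)%:E)%E.
Proof.
have md (y : R) : measurable_fun setT (fun t : R => (dom_kern n r y t)%:E).
  by apply/measurable_EFinP; exact: (measurableT_comp (measurable_dom_kern n r) (measurable_pair1 y)).
have d0 y t : (0 <= (dom_kern n r y t)%:E)%E by rewrite lee_fin dom_kern_ge0.
(* the projection of [x] onto the unit interval *)
pose x' := Num.max 0 (Num.min 1 x).
have x'01 : x' \in `[0, 1].
  by rewrite in_itv/= /x' le_max lexx/= ge_max ler01 ge_min lexx.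
apply: le_trans (integral_dom_kern01 n r x'01).
apply: ge0_le_integral_unit_leb => // t; rewrite in_itv/= => /andP[t0 t1].
rewrite lee_fin /dom_kern.
set c := mesh R n r; have c0 : 0 < c by exact: mesh_gt0.
have h : `|t - x'| <= `|t - x|.
  rewrite /x'; case: (leP 1 x) => [x1|x1].
    by rewrite (max_r ler01) ler0_norm ?subr_le0// ler0_norm; lra.
  case: (leP 0 x) => [//|x0]; rewrite subr0 !ger0_norm//; lra.
rewrite ler_wpM2l ?mulr_ge0 ?sqr_ge0// lef_pV2 ?posrE ?exprn_gt0 ?ltr_wpDl//.
by rewrite lerXn2r ?nnegrE ?addr_ge0 ?(ltW c0)// lerD2r.
Qed.

End dominating_kernel.

(** * Variation along coordinate lines *)

Section integral_aux.
Context d1 d2 (T1 : measurableType d1) (T2 : measurableType d2) (R : realType).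

Lemma ge0_integral_eq0_ae (mu : {measure set T1 -> \bar R}) (f : T1 -> \bar R) :
  measurable_fun setT f -> (forall x, 0 <= f x)%E ->
  (\int[mu]_x f x = 0)%E -> {ae mu, forall x, f x = 0%E}.
Proof.
move=> mf f0 i0.
have : (\int[mu]_x `|f x| = 0)%E.
  by under eq_integral do rewrite gee0_abs//.
by move/(ae_eq_integral_abs mu measurableT mf); apply: filterS => x /(_ I).
Qed.

Lemma measurable_fun_integral_r (m2 : {sigma_finite_measure set T2 -> \bar R})
    (f : T1 -> T2 -> \bar R) :
  measurable_fun setT (fun q : T1 * T2 => f q.1 q.2) ->
  (forall x y, 0 <= f x y)%E ->
  measurable_fun setT (fun x => \int[m2]_y f x y)%E.
Proof.
move=> mf f0.
exact: (measurable_fun_fubini_tonelli_F _ mf (fun q => f0 q.1 q.2)).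
Qed.

Lemma measurable_indicb (b : T1 -> bool) : measurable_fun setT b ->
  measurable_fun setT (fun x => ((b x)%:R : R)%:E).
Proof. by move=> mb; apply/measurable_EFinP; exact: measurable_natr_bool. Qed.

End integral_aux.

Section coordinates.
Context d (T : measurableType d) (R : realType).

Lemma measurable_coord n (i : 'I_n) :
  measurable_fun setT (fun x : 'rV[R]_n => x ord0 i : R).
Proof. exact: (measurableT_comp (@measurable_id_R R) (@measurable_rV_coord R n i)). Qed.

Lemma measurable_fun_rV_R n (h : T -> 'rV[R]_n) :
  (forall i, measurable_fun setT (fun x => h x ord0 i : R)) -> measurable_fun setT h.
Proof.
move=> mh; apply: measurable_fun_rV => i.
exact: (measurableT_comp (@measurable_id_TR R) (mh i)).
Qed.

Lemma measurable_fun_cons n (ha : T -> R) (hu : T -> 'rV[R]_n) :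
  measurable_fun setT ha -> measurable_fun setT hu ->
  measurable_fun setT (fun x => cons_rV (ha x : measurableTypeR R, hu x)).
Proof.
move=> mha mhu; apply: (measurableT_comp (@measurable_cons_R R n)
  (measurable_fun_pair mha mhu)).
Qed.

Definition upd n (i : 'I_n) (y : R) (x : 'rV[R]_n) : 'rV[R]_n :=
  \row_j (if j == i then y else x ord0 j).

Lemma measurable_fun_upd n (i : 'I_n) (ha : T -> R) (hu : T -> 'rV[R]_n) :
  measurable_fun setT ha -> measurable_fun setT hu ->
  measurable_fun setT (fun x => upd i (ha x) (hu x)).
Proof.
move=> mha mhu; apply: measurable_fun_rV_R => j.
under eq_fun do rewrite mxE.
case: (j == i) => //.
exact: (measurableT_comp (measurable_coord j) mhu).
Qed.

End coordinates.

Section upd_lemmas.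
Variable R : realType.
Implicit Types (a y : R).

Lemma upd_cons0 n a y (u : 'rV[R]_n) :
  upd ord0 y (cons_rV (a : measurableTypeR R, u)) = cons_rV (y : measurableTypeR R, u).
Proof.
apply/rowP => i; have [j ->|->] := unliftP ord0 i; rewrite !mxE.
  by rewrite liftK eq_sym (negbTE (neq_lift _ _)).
by rewrite eqxx unlift_none.
Qed.

Lemma upd_consS n a y (j : 'I_n) (u : 'rV[R]_n) :
  upd (lift ord0 j) y (cons_rV (a : measurableTypeR R, u)) =
  cons_rV (a : measurableTypeR R, upd j y u).
Proof.
apply/rowP => i; have [k ->|->] := unliftP ord0 i; rewrite !mxE.
  by rewrite !liftK !mxE (inj_eq (@lift_inj _ ord0)).
by rewrite !unlift_none (negbTE (neq_lift _ _)).
Qed.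

Lemma cons_rV0 n a (u : 'rV[R]_n) : cons_rV (a : measurableTypeR R, u) ord0 ord0 = a.
Proof. by rewrite mxE unlift_none. Qed.

Lemma cons_rVS n a (u : 'rV[R]_n) j :
  cons_rV (a : measurableTypeR R, u) ord0 (lift ord0 j) = u ord0 j.
Proof. by rewrite mxE liftK. Qed.

End upd_lemmas.

Section line_bound.
Variable R : realType.

Section def.
Variables (n : nat) (i : 'I_n) (f g : 'rV[R]_n -> R).

(** The integral of [|g|] over the segment from [x] to the point
    obtained from [x] by giving its [i]-th coordinate the value [y]. *)
Definition line_var (x : 'rV[R]_n) (y : R) : \bar R :=
  (\int[@unit_leb R]_t ((between (x ord0 i) y t)%:R * `|g (upd i t x)|)%:E)%E.

Definition line_good (x : 'rV[R]_n) (y : R) : bool :=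
  (`|f (upd i y x) - f x|%:E <= line_var x y)%E.

(** For almost all [x] in the cube and [y] in the unit interval, the
    change of [f] is at most [line_var]. Written as a vanishing integral, this
    passes to slices by Tonelli's theorem. *)
Definition line_bound : Prop :=
  (\int[@unit_cube R n]_x \int[@unit_leb R]_y ((~~ line_good x y)%:R : R)%:E = 0)%E.

Hypotheses (mf : measurable_fun setT f) (mg : measurable_fun setT g).

Lemma measurable_line_var :
  measurable_fun setT (fun q : 'rV[R]_n * R => line_var q.1 q.2).
Proof.
have := (@measurable_fun_integral_r _ _ ('rV[R]_n * R)%type R R (@unit_leb R)
  (fun q t => ((between (q.1 ord0 i) q.2 t)%:R * `|g (upd i t q.1)|)%:E)); apply; last first.
  by move=> q t; rewrite lee_fin mulr_ge0.
apply/measurable_EFinP; apply: measurable_funM.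
  apply: measurable_natr_bool.
  have m3 : measurable_fun setT (fun q : 'rV[R]_n * R * R => (q.1.1 ord0 i, q.1.2, q.2)).
    apply: measurable_fun_pair => //; apply: measurable_fun_pair.
      exact: (measurableT_comp (measurable_coord i) (measurableT_comp measurable_fst measurable_fst)).
    exact: (measurableT_comp measurable_snd measurable_fst).
  exact: (measurableT_comp (@measurable_between R) m3).
apply: measurableT_comp => //; apply: (measurableT_comp mg).
apply: measurable_fun_upd => //.
exact: (measurableT_comp measurable_fst measurable_fst).
Qed.

Lemma measurable_line_good :
  measurable_fun setT (fun q : 'rV[R]_n * R => line_good q.1 q.2).
Proof.
apply: measurable_fun_lee; last exact: measurable_line_var.
apply/measurable_EFinP; apply: measurableT_comp => //.
apply: measurable_funB.
  by apply: (measurableT_comp mf); exact: measurable_fun_upd.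
exact: (measurableT_comp mf measurable_fst).
Qed.

Lemma measurable_line_bad :
  measurable_fun setT (fun q : 'rV[R]_n * R => ((~~ line_good q.1 q.2)%:R : R)%:E).
Proof. by apply: measurable_indicb; apply: measurable_neg; exact: measurable_line_good. Qed.

End def.

Lemma line_good_consS n (j : 'I_n) (f g : 'rV[R]_n.+1 -> R) (a : R) u y :
  line_good (lift ord0 j) f g (cons_rV (a : measurableTypeR R, u)) y =
  line_good j (fun v => f (cons_rV (a : measurableTypeR R, v)))
     (fun v => g (cons_rV (a : measurableTypeR R, v))) u y.
Proof.
rewrite /line_good upd_consS /line_var cons_rVS; congr (_ <= _)%E.
by apply: eq_integral => t _; rewrite upd_consS.
Qed.

Lemma line_good_cons0 n (f g : 'rV[R]_n.+1 -> R) (a : R) u y :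
  line_good ord0 f g (cons_rV (a : measurableTypeR R, u)) y =
  (`|f (cons_rV (y : measurableTypeR R, u)) - f (cons_rV (a : measurableTypeR R, u))|%:E
   <= \int[@unit_leb R]_t ((between a y t)%:R * `|g (cons_rV (t : measurableTypeR R, u))|)%:E)%E.
Proof.
rewrite /line_good upd_cons0 /line_var cons_rV0; congr (_ <= _)%E.
by apply: eq_integral => t _; rewrite upd_cons0.
Qed.

Lemma measurable_line_bad_cons n (i : 'I_n.+1) (f g : 'rV[R]_n.+1 -> R) :
  measurable_fun setT f -> measurable_fun setT g ->
  measurable_fun setT (fun q : R * 'rV[R]_n =>
    \int[@unit_leb R]_y ((~~ line_good i f g (cons_rV (q : measurableTypeR R * _)) y)%:R : R)%:E)%E.
Proof.
move=> mf mg.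
have mT : measurable_fun setT (fun x : 'rV[R]_n.+1 =>
    \int[@unit_leb R]_y ((~~ line_good i f g x y)%:R : R)%:E)%E.
  apply: measurable_fun_integral_r; last by move=> x y; rewrite lee_fin.
  exact: measurable_line_bad.
exact: (measurableT_comp mT (@measurable_cons_R R n)).
Qed.

Lemma line_bound_cons_ae n (i : 'I_n.+1) (f g : 'rV[R]_n.+1 -> R) :
  measurable_fun setT f -> measurable_fun setT g ->
  line_bound i f g ->
  {ae @unit_leb R, forall a : R,
    (\int[@unit_cube R n]_u \int[@unit_leb R]_y
       ((~~ line_good i f g (cons_rV (a : measurableTypeR R, u)) y)%:R : R)%:E = 0)%E}.
Proof.
move=> mf mg; rewrite /line_bound ge0_integral_unit_cubeS//; last 2 first.
- apply: measurable_fun_integral_r; last by move=> x y; rewrite lee_fin.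
  exact: measurable_line_bad.
- by move=> x; apply: integral_ge0 => y _; rewrite lee_fin.
move=> h; apply: ge0_integral_eq0_ae => //.
- apply: (@measurable_fun_integral_r _ _ R _ R (@unit_cube R n)
    (fun (a : R) (u : 'rV[R]_n) => \int[@unit_leb R]_y
      ((~~ line_good i f g (cons_rV (a : measurableTypeR R, u)) y)%:R : R)%:E)%E).
    rewrite [X in measurable_fun _ X](_ : _ = (fun q : R * 'rV[R]_n =>
    \int[@unit_leb R]_y ((~~ line_good i f g (cons_rV (q : measurableTypeR R * _)) y)%:R : R)%:E)%E);
     last by apply/funext => -[].
    exact: measurable_line_bad_cons.
  by move=> a u; apply: integral_ge0 => y _; rewrite lee_fin.
- by move=> a; apply: integral_ge0 => u _; apply: integral_ge0 => y _; rewrite lee_fin.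
Qed.

Lemma line_boundS n (j : 'I_n) (f g : 'rV[R]_n.+1 -> R) :
  measurable_fun setT f -> measurable_fun setT g ->
  line_bound (lift ord0 j) f g ->
  {ae @unit_leb R, forall a : R, line_bound j (fun v => f (cons_rV (a : measurableTypeR R, v)))
     (fun v => g (cons_rV (a : measurableTypeR R, v)))}.
Proof.
move=> mf mg /(line_bound_cons_ae mf mg); apply: filterS => a h; rewrite /line_bound -[RHS]h.
by apply: eq_integral => u _; apply: eq_integral => y _; rewrite line_good_consS.
Qed.

Lemma line_bound0 n (f g : 'rV[R]_n.+1 -> R) :
  measurable_fun setT f -> measurable_fun setT g -> line_bound ord0 f g ->
  {ae @unit_leb R, forall a : R, {ae @unit_cube R n, forall u, {ae @unit_leb R, forall y : R,
    (`|f (cons_rV (y : measurableTypeR R, u)) - f (cons_rV (a : measurableTypeR R, u))|%:E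
   <= \int[@unit_leb R]_t ((between a y t)%:R * `|g (cons_rV (t : measurableTypeR R, u))|)%:E)%E}}}.
Proof.
move=> mf mg /(line_bound_cons_ae mf mg); apply: filterS => a.
move=> /ge0_integral_eq0_ae h.
have {h} : {ae @unit_cube R n, forall u, (\int[@unit_leb R]_y
   ((~~ line_good ord0 f g (cons_rV (a : measurableTypeR R, u)) y)%:R : R)%:E = 0)%E}.
  apply: h; last by move=> u; apply: integral_ge0 => y _; rewrite lee_fin.
  exact: (measurableT_comp (measurable_line_bad_cons ord0 mf mg) (measurable_pair1 a)).
apply: filterS => u /ge0_integral_eq0_ae h.
have {h} : {ae @unit_leb R, forall y,
   ((~~ line_good ord0 f g (cons_rV (a : measurableTypeR R, u)) y)%:R : R)%:E = 0%E}.
  apply: h; last by move=> y; rewrite lee_fin.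
  exact: (measurableT_comp (measurable_line_bad ord0 mf mg)
    (measurable_pair1 (cons_rV (a : measurableTypeR R, u)))).
apply: filterS => y; rewrite line_good_cons0; case: (_ <= _)%E => //= -[] /eqP.
by rewrite oner_eq0.
Qed.

End line_bound.

(** * Mean deviation in L^p *)

Section deviation.
Variables (R : realType) (n r : nat).
Hypothesis rn : (2 * r < n)%N.
Local Notation consR a u := (cons_rV ((a : measurableTypeR R), u)).
Local Notation "'lam'" := (@unit_leb R).
Local Notation "'Q' d" := (@unit_cube R d) (at level 10, d at level 9).

Lemma poweRD_le (p : R) (x y : \bar R) : 1 <= p -> (0 <= x)%E -> (0 <= y)%E ->
  ((x + y) `^ p <= (2 `^ p)%:E * (x `^ p + y `^ p))%E.
Proof.
move=> p1; have p0 : 0 <= p by apply: le_trans p1.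
wlog xy : x y / (x <= y)%E.
  move=> h x0 y0; have [xy|/ltW yx] := leP x y; first exact: h.
  by rewrite addeC [X in (_ * X)%E]addeC; exact: h.
move=> x0 y0.
have h : (x + y <= 2%:E * y)%E.
  by rewrite -[2]/(1 + 1) EFinD ge0_muleDl ?lee_fin// mul1e leeD2r.
apply: le_trans (ge0_ler_poweR p0 (adde_ge0 x0 y0) h) _.
rewrite poweRM ?lee_fin// poweR_EFin; apply: lee_wpmul2l; first by rewrite lee_fin powR_ge0.
by rewrite leeDr// poweR_ge0.
Qed.

Definition kern d (x y : 'rV[R]_d) : R := \prod_(i < d) kern1 n r (x ord0 i) (y ord0 i).

Lemma kern_ge0 d (x y : 'rV[R]_d) : 0 <= kern x y.
Proof. by apply: prodr_ge0 => i _; exact: kern1_ge0. Qed.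

Lemma kern_cons d (a b : R) (u v : 'rV[R]_d) :
  kern (consR a u) (consR b v) = kern1 n r a b * kern u v.
Proof.
rewrite /kern big_ord_recl !cons_rV0; congr (_ * _).
by apply: eq_bigr => i _; rewrite !cons_rVS.
Qed.

Lemma measurable_kern d :
  measurable_fun setT (fun q : 'rV[R]_d * 'rV[R]_d => kern q.1 q.2).
Proof.
apply: measurable_prod => i _.
have m2 : measurable_fun setT (fun q : 'rV[R]_d * 'rV[R]_d => (q.1 ord0 i, q.2 ord0 i) : R * R).
  apply: measurable_fun_pair.
    exact: (measurableT_comp (measurable_coord i) measurable_fst).
  exact: (measurableT_comp (measurable_coord i) measurable_snd).
exact: (measurableT_comp (@measurable_kern1 R n r) m2).
Qed.

Lemma measurable_kernr d (x : 'rV[R]_d) : measurable_fun setT (kern x).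
Proof. exact: (measurableT_comp (@measurable_kern d) (measurable_pair1 x)). Qed.

Lemma integral_kern1r_le1 (a : R) : (\int[lam]_b (kern1 n r a b)%:E <= 1)%E.
Proof.
have [a01|a01] := boolP (a \in `[0, 1]); first by rewrite integral_kern1r.
by under eq_integral do rewrite kern1_out//; rewrite integral0.
Qed.

Lemma integral_kern_le1 d (x : 'rV[R]_d) : (\int[Q d]_y (kern x y)%:E <= 1)%E.
Proof.
elim: d x => [|d IH] x.
  under eq_integral do rewrite /kern big_ord0.
  by rewrite integral_unit_cube_cst.
rewrite ge0_integral_unit_cubeS; last 2 first.
- by apply/measurable_EFinP; exact: measurable_kernr.
- by move=> y; rewrite lee_fin kern_ge0.
rewrite -(uncons_rVK x); case: (uncons_rV x) => a u.
apply: le_trans (integral_kern1r_le1 a).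
have mk : measurable_fun setT (fun b => (kern1 n r a b)%:E).
  by apply/measurable_EFinP; exact: measurable_kern1r.
have mku : measurable_fun setT (fun v => (kern u v)%:E).
  by apply/measurable_EFinP; exact: measurable_kernr.
have iE b : (\int[Q d]_v (kern (consR a u) (consR b v))%:E =
   (kern1 n r a b)%:E * \int[Q d]_v (kern u v)%:E)%E.
  under eq_integral do rewrite kern_cons EFinM.
  by rewrite ge0_integralZl_EFin ?kern1_ge0// => v _; rewrite lee_fin kern_ge0.
under eq_integral do rewrite iE.
apply: ge0_le_integral => //.
- move=> b _; rewrite mule_ge0 ?lee_fin ?kern1_ge0//.
  by apply: integral_ge0 => v _; rewrite lee_fin kern_ge0.
- exact: emeasurable_funM.
- by move=> b _; rewrite -[leRHS]mule1; apply: lee_wpmul2l; rewrite ?lee_fin ?kern1_ge0.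
Qed.

(** The mean deviation of [f] from its value at [x]. *)
Definition edev d (f : 'rV[R]_d -> R) (x : 'rV[R]_d) : \bar R :=
  (\int[Q d]_y (kern x y * `|f y - f x|)%:E)%E.

Lemma edev_ge0 d (f : 'rV[R]_d -> R) x : (0 <= edev f x)%E.
Proof. by apply: integral_ge0 => y _; rewrite lee_fin mulr_ge0// kern_ge0. Qed.

Lemma measurable_edev_param dT (T : measurableType dT) d (F : T -> 'rV[R]_d -> R)
    (hx : T -> 'rV[R]_d) :
  measurable_fun setT (fun q : T * 'rV[R]_d => F q.1 q.2) ->
  measurable_fun setT hx ->
  measurable_fun setT (fun t => edev (F t) (hx t)).
Proof.
move=> mF mh.
have mhf : measurable_fun setT (fun q : T * 'rV[R]_d => hx q.1).
  exact: (measurableT_comp mh measurable_fst).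
have := (@measurable_fun_integral_r _ _ T 'rV[R]_d R (Q d)
  (fun t y => (kern (hx t) y * `|F t y - F t (hx t)|)%:E)); apply; last first.
  by move=> t y; rewrite lee_fin mulr_ge0// kern_ge0.
apply/measurable_EFinP; apply: measurable_funM.
  exact: (measurableT_comp (@measurable_kern d) (measurable_fun_pair mhf measurable_snd)).
apply: measurableT_comp => //; apply: measurable_funB => //.
exact: (measurableT_comp mF (measurable_fun_pair measurable_fst mhf)).
Qed.

Lemma measurable_edev d (f : 'rV[R]_d -> R) : measurable_fun setT f ->
  measurable_fun setT (edev f).
Proof.
move=> mf; apply: (measurable_edev_param (F := fun=> f) (hx := idfun)).
  exact: (measurableT_comp mf measurable_snd).
exact: measurable_id.
Qed.

Lemma measurable_fcons dT (T : measurableType dT) d (f : 'rV[R]_d.+1 -> R)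
    (ha : T -> R) (hu : T -> 'rV[R]_d) : measurable_fun setT f ->
  measurable_fun setT ha -> measurable_fun setT hu ->
  measurable_fun setT (fun t => f (consR (ha t) (hu t))).
Proof. by move=> mf mha mhu; apply: (measurableT_comp mf); exact: measurable_fun_cons. Qed.

(** The triangle inequality through [consR b u]: first all the
    coordinates but the first are changed, then the first one. *)
Lemma edev_cons_le d (f : 'rV[R]_d.+1 -> R) (a : R) (u : 'rV[R]_d) :
  measurable_fun setT f ->
  (edev f (consR a u) <=
   \int[lam]_b ((kern1 n r a b)%:E * edev (fun v => f (consR b v)) u) +
   \int[lam]_b ((kern1 n r a b)%:E * `|f (consR b u) - f (consR a u)|%:E))%E.
Proof.
move=> mf.
have mk : measurable_fun setT (fun b => (kern1 n r a b)%:E).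
  by apply/measurable_EFinP; exact: measurable_kern1r.
have mku : measurable_fun setT (fun v => (kern u v)%:E).
  by apply/measurable_EFinP; exact: measurable_kernr.
have k10 b : (0 <= (kern1 n r a b)%:E)%E by rewrite lee_fin kern1_ge0.
have me : measurable_fun setT (fun b => edev (fun v => f (consR b v)) u).
  apply: (measurable_edev_param (F := fun b v => f (consR b v)) (hx := fun=> u)) => //.
  exact: measurable_fcons.
have mfb : measurable_fun setT (fun b : R => `|f (consR b u) - f (consR a u)|%:E).
  apply/measurable_EFinP; apply: measurableT_comp => //; apply: measurable_funB => //.
  exact: measurable_fcons.
rewrite {1}/edev ge0_integral_unit_cubeS; last 2 first.
- apply/measurable_EFinP; apply: measurable_funM; first exact: measurable_kernr.
  by apply: measurableT_comp => //; apply: measurable_funB.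
- by move=> y; rewrite lee_fin mulr_ge0// kern_ge0.
rewrite -ge0_integralD//; last 4 first.
- by move=> b _; rewrite mule_ge0// edev_ge0.
- exact: emeasurable_funM.
- by move=> b _; rewrite mule_ge0.
- exact: emeasurable_funM.
apply: ge0_le_integral => //.
- by move=> b _; apply: integral_ge0 => v _; rewrite lee_fin mulr_ge0// kern_ge0.
- have := (@measurable_fun_integral_r _ _ R 'rV[R]_d R (Q d)
    (fun b v => (kern (consR a u) (consR b v) * `|f (consR b v) - f (consR a u)|)%:E)); apply.
    apply/measurable_EFinP; apply: measurable_funM.
      apply: (measurableT_comp (measurable_kernr (consR a u))).
      exact: measurable_fun_cons.
    apply: measurableT_comp => //; apply: measurable_funB => //.
    exact: measurable_fcons.
  by move=> b v; rewrite lee_fin mulr_ge0// kern_ge0.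
- by apply: emeasurable_funD; exact: emeasurable_funM.
move=> b _.
have mf1 : measurable_fun setT (fun v => `|f (consR b v) - f (consR b u)|).
  by apply: measurableT_comp => //; apply: measurable_funB => //; exact: measurable_fcons.
rewrite -ge0_muleDr ?edev_ge0//.
have mfv : measurable_fun setT (fun v => `|f (consR b v) - f (consR a u)|).
  by apply: measurableT_comp => //; apply: measurable_funB => //; exact: measurable_fcons.
apply: (@le_trans _ _ ((kern1 n r a b)%:E * \int[Q d]_v ((kern u v * `|f (consR b v) - f (consR b u)|)%:E +
   (kern u v)%:E * `|f (consR b u) - f (consR a u)|%:E))%E).
  under eq_integral do rewrite kern_cons -mulrA EFinM.
  rewrite ge0_integralZl_EFin ?kern1_ge0//; last 2 first.
  - by move=> v _; rewrite lee_fin mulr_ge0// kern_ge0.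
  - by apply/measurable_EFinP; apply: measurable_funM => //; exact: measurable_kernr.
  apply: lee_wpmul2l => //; apply: ge0_le_integral => //.
  - by move=> v _; rewrite lee_fin mulr_ge0// kern_ge0.
  - by apply/measurable_EFinP; apply: measurable_funM => //; exact: measurable_kernr.
  - apply: emeasurable_funD; last exact: emeasurable_funM.
    by apply/measurable_EFinP; apply: measurable_funM => //; exact: measurable_kernr.
  - move=> v _; rewrite -EFinM -EFinD lee_fin -mulrDr ler_wpM2l ?kern_ge0//.
    by rewrite (le_trans _ (ler_normD _ _))// subrKA.
apply: lee_wpmul2l => //.
rewrite ge0_integralD//; last 4 first.
- by move=> v _; rewrite lee_fin mulr_ge0// kern_ge0.
- by apply/measurable_EFinP; apply: measurable_funM => //; exact: measurable_kernr.
- by move=> v _; rewrite mule_ge0 ?lee_fin ?kern_ge0.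
- exact: emeasurable_funM.
rewrite leeD2l//.
rewrite ge0_integralZr//; last by move=> v _; rewrite lee_fin kern_ge0.
by rewrite -[leRHS]mul1e; apply: lee_wpmul2r => //; exact: integral_kern_le1.
Qed.

(** The recursion of [edev_power_step], with [g_0] separated from
    the other partial derivatives. *)
Fixpoint dev_const (p : R) d : R :=
  if d is d'.+1 then 2 `^ p * (4 `^ p * dev_const p d' + 8 `^ p) else 0.

Lemma dev_const_ge0 p d : 0 <= dev_const p d.
Proof. by elim: d => //= d IH; rewrite !(mulr_ge0, addr_ge0)// powR_ge0. Qed.

Section step.
Variables (d : nat) (f g : 'rV[R]_d.+1 -> R) (p : R).
Hypotheses (p1 : 1 <= p) (mf : measurable_fun setT f) (mg : measurable_fun setT g).
Hypothesis fg : line_bound ord0 f g.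

Let I1 (a : R) (u : 'rV[R]_d) : \bar R :=
  (\int[lam]_b ((kern1 n r a b)%:E * edev (fun v => f (consR b v)) u))%E.
Let J (a : R) (u : 'rV[R]_d) : \bar R :=
  (\int[lam]_t ((dom_kern n r a t)%:E * `|g (consR t u)|%:E))%E.

Let I10 a u : (0 <= I1 a u)%E.
Proof. by apply: integral_ge0 => b _; rewrite mule_ge0 ?edev_ge0// lee_fin kern1_ge0. Qed.

Let J0 a u : (0 <= J a u)%E.
Proof. by apply: integral_ge0 => t _; rewrite mule_ge0 ?lee_fin// dom_kern_ge0. Qed.

Let mI1 : measurable_fun setT (fun q : R * 'rV[R]_d => I1 q.1 q.2).
Proof.
have := (@measurable_fun_integral_r _ _ (R * 'rV[R]_d)%type R R lam
  (fun q b => (kern1 n r q.1 b)%:E * edev (fun v => f (consR b v)) q.2)%E); apply; last first.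
  by move=> q b; rewrite mule_ge0 ?edev_ge0// lee_fin kern1_ge0.
have m11 : measurable_fun setT (fun q : R * 'rV[R]_d * R => q.1.1).
  exact: (measurableT_comp measurable_fst measurable_fst).
have m12 : measurable_fun setT (fun q : R * 'rV[R]_d * R => q.1.2).
  exact: (measurableT_comp measurable_snd measurable_fst).
apply: emeasurable_funM.
  apply/measurable_EFinP.
  exact: (measurableT_comp (@measurable_kern1 R n r) (measurable_fun_pair m11 measurable_snd)).
apply: (measurable_edev_param (F := fun q : R * 'rV[R]_d * R => fun v => f (consR q.2 v))) => //.
by apply: measurable_fcons => //; exact: (measurableT_comp measurable_snd measurable_fst).
Qed.

Let mJ : measurable_fun setT (fun q : R * 'rV[R]_d => J q.1 q.2).
Proof.
have := (@measurable_fun_integral_r _ _ (R * 'rV[R]_d)%type R R lam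
  (fun q t => (dom_kern n r q.1 t)%:E * `|g (consR t q.2)|%:E)%E); apply; last first.
  by move=> q t; rewrite mule_ge0 ?lee_fin ?dom_kern_ge0.
have m11 : measurable_fun setT (fun q : R * 'rV[R]_d * R => q.1.1).
  exact: (measurableT_comp measurable_fst measurable_fst).
have m12 : measurable_fun setT (fun q : R * 'rV[R]_d * R => q.1.2).
  exact: (measurableT_comp measurable_snd measurable_fst).
apply: emeasurable_funM; apply/measurable_EFinP.
  exact: (measurableT_comp (@measurable_dom_kern R n r) (measurable_fun_pair m11 measurable_snd)).
by apply: measurableT_comp => //; exact: measurable_fcons.
Qed.

(** The second term of [edev_cons_le] after the increment in the first
    coordinate has been bounded by an integral of [|g|] and the order of
    integration exchanged. *)
Lemma edev_cons_ae : {ae lam, forall a : R, {ae Q d, forall u,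
  (edev f (consR a u) <= I1 a u + J a u)%E}}.
Proof.
have := line_bound0 mf mg fg; apply: filterS => a; apply: filterS => u h.
apply: le_trans (edev_cons_le a u mf) _; rewrite leeD2l//.
have mk : measurable_fun setT (fun b => (kern1 n r a b)%:E).
  by apply/measurable_EFinP; exact: measurable_kern1r.
have mgt : measurable_fun setT (fun t : R => `|g (consR t u)|%:E).
  by apply/measurable_EFinP; apply: measurableT_comp => //; exact: measurable_fcons.
have mbtw : measurable_fun setT (fun q : R * R => ((between a q.1 q.2)%:R : R)%:E).
  apply: measurable_indicb.
  have m3 : measurable_fun setT (fun q : R * R => (a, q.1, q.2)).
    by apply: measurable_fun_pair => //; apply: measurable_fun_pair.
  exact: (measurableT_comp (@measurable_between R) m3).
have mgb : measurable_fun setT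
    (fun b : R => \int[lam]_t ((between a b t)%:R * `|g (consR t u)|)%:E)%E.
  apply: measurable_fun_integral_r => [|b t]; last by rewrite lee_fin mulr_ge0.
  under eq_fun do rewrite EFinM.
  by apply: emeasurable_funM => //; exact: (measurableT_comp mgt measurable_snd).
have mfb : measurable_fun setT (fun b : R => `|f (consR b u) - f (consR a u)|%:E).
  apply/measurable_EFinP; apply: measurableT_comp => //; apply: measurable_funB => //.
  exact: measurable_fcons.
have gb0 b : (0 <= \int[lam]_t ((between a b t)%:R * `|g (consR t u)|)%:E)%E.
  by apply: integral_ge0 => t _; rewrite lee_fin mulr_ge0.
apply: (@le_trans _ _ (\int[lam]_b ((kern1 n r a b)%:E *
    \int[lam]_t ((between a b t)%:R * `|g (consR t u)|)%:E))%E).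
  apply: ae_ge0_le_integral => //.
  - by move=> b _; rewrite mule_ge0 ?lee_fin ?kern1_ge0.
  - exact: emeasurable_funM.
  - by move=> b _; rewrite mule_ge0 ?lee_fin ?kern1_ge0.
  - exact: emeasurable_funM.
  - apply: filterS h => b hb _; apply: lee_wpmul2l => //.
    by rewrite lee_fin kern1_ge0.
pose H (b t : R) := ((kern1 n r a b * (between a b t)%:R)%:E * `|g (consR t u)|%:E)%E.
have H0 b t : (0 <= H b t)%E by rewrite mule_ge0// lee_fin mulr_ge0// kern1_ge0.
have mH : measurable_fun setT (fun q : R * R => H q.1 q.2).
  apply: emeasurable_funM; last exact: (measurableT_comp mgt measurable_snd).
  under eq_fun do rewrite EFinM.
  by apply: emeasurable_funM => //; exact: (measurableT_comp mk measurable_fst).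
rewrite [leLHS](_ : _ = \int[lam]_b \int[lam]_t H b t)%E; last first.
  apply: eq_integral => b _; rewrite -ge0_integralZl_EFin ?kern1_ge0//.
  - by apply: eq_integral => t _; rewrite /H !EFinM muleA.
  - under eq_fun do rewrite EFinM.
    apply: emeasurable_funM => //.
    exact: (measurableT_comp mbtw (measurable_pair1 b)).
rewrite (fubini_tonelli (fun q : R * R => H q.1 q.2))//=.
apply: ge0_le_integral => //.
- by move=> t _; apply: integral_ge0 => b _.
- exact: (measurable_fun_fubini_tonelli_G (fun q : R * R => H q.1 q.2)).
- apply: emeasurable_funM => //; apply/measurable_EFinP.
  exact: (measurableT_comp (@measurable_dom_kern R n r) (measurable_pair1 a)).
- move=> t _; rewrite /H ge0_integralZr//.
  + by apply: lee_wpmul2r => //; exact: kern1_between.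
  + under eq_fun do rewrite EFinM; apply: emeasurable_funM => //.
    exact: (measurableT_comp mbtw (measurable_pair2 t)).
  + by move=> b _; rewrite lee_fin mulr_ge0// kern1_ge0.
Qed.

(** Schur's test for [kern1], with marginals at most 4, and for
    [dom_kern], with marginals at most [8 mesh]. *)
Lemma edev_power_step :
  (\int[Q d.+1]_x (edev f x `^ p) <=
   (2 `^ p)%:E * ((4 `^ p)%:E * \int[lam]_b \int[Q d]_u (edev (fun v => f (consR b v)) u `^ p) +
     ((8 * mesh R n r) `^ p)%:E * \int[Q d.+1]_x (`|g x|%:E `^ p)))%E.
Proof.
have p0 : 0 <= p by apply: le_trans p1.
have mI1p : measurable_fun setT (fun q : R * 'rV[R]_d => I1 q.1 q.2 `^ p)%E.
  exact: measurable_fun_poweR.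
have mJp : measurable_fun setT (fun q : R * 'rV[R]_d => J q.1 q.2 `^ p)%E.
  exact: measurable_fun_poweR.
have me := measurable_fun_poweR p (measurable_edev mf).
have mgp : measurable_fun setT (fun x => `|g x|%:E `^ p)%E.
  by apply: measurable_fun_poweR; apply/measurable_EFinP; exact: measurableT_comp.
rewrite !ge0_integral_unit_cubeS//; last 2 first.
- by move=> x; exact: poweR_ge0.
- by move=> x; exact: poweR_ge0.
have mL : measurable_fun setT (fun q : R * 'rV[R]_d => edev f (consR q.1 q.2) `^ p)%E.
  by apply: (measurableT_comp me); exact: measurable_fun_cons.
have mS : measurable_fun setT (fun q : R * 'rV[R]_d => I1 q.1 q.2 `^ p + J q.1 q.2 `^ p)%E.
  exact: emeasurable_funD.
apply: (@le_trans _ _ (\int[lam]_a \int[Q d]_u ((2 `^ p)%:E * (I1 a u `^ p + J a u `^ p)))%E).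
  apply: ae_ge0_le_integral => //.
  - by move=> a _; apply: integral_ge0 => u _; exact: poweR_ge0.
  - exact: (@measurable_fun_integral_r _ _ R 'rV[R]_d R (Q d) (fun a u => edev f (consR a u) `^ p)%E
      mL (fun a u => poweR_ge0 _ _)).
  - move=> a _; apply: integral_ge0 => u _.
    by rewrite mule_ge0 ?lee_fin ?powR_ge0 ?adde_ge0 ?poweR_ge0.
  - apply: (@measurable_fun_integral_r _ _ R 'rV[R]_d R (Q d)
      (fun a u => (2 `^ p)%:E * (I1 a u `^ p + J a u `^ p))%E).
      exact: emeasurable_funM.
    by move=> a u; rewrite mule_ge0 ?lee_fin ?powR_ge0 ?adde_ge0 ?poweR_ge0.
  - have := edev_cons_ae; apply: filterS => a ha _.
    apply: ae_ge0_le_integral => //.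
    + by move=> u _; exact: poweR_ge0.
    + exact: (measurableT_comp mL (measurable_pair1 a)).
    + by move=> u _; rewrite mule_ge0 ?lee_fin ?powR_ge0 ?adde_ge0 ?poweR_ge0.
    + apply: emeasurable_funM => //.
      exact: (measurableT_comp mS (measurable_pair1 a)).
    + apply: filterS ha => u hu _.
      apply: le_trans (ge0_ler_poweR p0 (edev_ge0 _ _) hu) _.
      exact: poweRD_le.
have S0 a u : (0 <= I1 a u `^ p + J a u `^ p)%E by rewrite adde_ge0 ?poweR_ge0.
have mIr a : measurable_fun setT (fun u => I1 a u `^ p)%E.
  exact: (measurableT_comp mI1p (measurable_pair1 a)).
have mJr a : measurable_fun setT (fun u => J a u `^ p)%E.
  exact: (measurableT_comp mJp (measurable_pair1 a)).
have iE a : (\int[Q d]_u ((2 `^ p)%:E * (I1 a u `^ p + J a u `^ p)) =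
    (2 `^ p)%:E * (\int[Q d]_u (I1 a u `^ p) + \int[Q d]_u (J a u `^ p)))%E.
  rewrite ge0_integralZl_EFin ?powR_ge0//; last exact: emeasurable_funD.
  by rewrite ge0_integralD// => *; exact: poweR_ge0.
under eq_integral do rewrite iE.
have mI1i := @measurable_fun_integral_r _ _ R 'rV[R]_d R (Q d) (fun a u => I1 a u `^ p)%E mI1p
  (fun a u => poweR_ge0 _ _).
have mJi := @measurable_fun_integral_r _ _ R 'rV[R]_d R (Q d) (fun a u => J a u `^ p)%E mJp
  (fun a u => poweR_ge0 _ _).
have i0 K a : (0 <= \int[Q d]_u (K a u : \bar R) `^ p)%E.
  by apply: integral_ge0 => u _; exact: poweR_ge0.
rewrite ge0_integralZl_EFin ?powR_ge0//; last 2 first.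
- by move=> a _; exact: adde_ge0.
- exact: (emeasurable_funD mI1i mJi).
apply: lee_wpmul2l; first by rewrite lee_fin powR_ge0.
rewrite (ge0_integralD lam measurableT (fun a _ => i0 _ I1 a) mI1i (fun a _ => i0 _ J a) mJi).
have mef : measurable_fun setT (fun q : R * 'rV[R]_d => edev (fun v => f (consR q.1 v)) q.2).
  apply: (measurable_edev_param (F := fun q : R * 'rV[R]_d => fun v => f (consR q.1 v))) => //.
  by apply: measurable_fcons => //; exact: (measurableT_comp measurable_fst measurable_fst).
have mefp := measurable_fun_poweR p mef.
have mgc : measurable_fun setT (fun q : R * 'rV[R]_d => `|g (consR q.1 q.2)|%:E).
  by apply/measurable_EFinP; apply: measurableT_comp => //; exact: measurable_fcons.
have mgcp := measurable_fun_poweR p mgc.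
have c0 : 0 < 8 * mesh R n r by rewrite mulr_gt0// mesh_gt0.
apply: leeD.
- rewrite (fubini_tonelli (fun q : R * 'rV[R]_d => I1 q.1 q.2 `^ p)%E)//=; last first.
    by move=> q; exact: poweR_ge0.
  rewrite (fubini_tonelli (fun q : R * 'rV[R]_d => edev (fun v => f (consR q.1 v)) q.2 `^ p)%E)//=; last first.
    by move=> q; exact: poweR_ge0.
  have mii := @measurable_fun_fubini_tonelli_G _ _ _ _ _ lam
    (fun q : R * 'rV[R]_d => edev (fun v => f (consR q.1 v)) q.2 `^ p)%E mefp (fun q => poweR_ge0 _ _).
  rewrite -ge0_integralZl_EFin ?powR_ge0//; last first.
    by move=> u _; apply: integral_ge0 => a _; exact: poweR_ge0.
  apply: ge0_le_integral => //.
  + by move=> u _; apply: integral_ge0 => a _; exact: poweR_ge0.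
  + exact: (@measurable_fun_fubini_tonelli_G _ _ _ _ _ lam
      (fun q : R * 'rV[R]_d => I1 q.1 q.2 `^ p)%E mI1p (fun q => poweR_ge0 _ _)).
  + exact: emeasurable_funM.
  + move=> u _; apply: (schur_test (mu := lam) (nu := lam)) => //.
    * by move=> x y; exact: kern1_ge0.
    * exact: measurable_kern1.
    * by move=> x; apply: le_trans (integral_kern1r_le1 x) _; rewrite lee_fin ler1n.
    * by move=> y; exact: integral_kern1l.
    * exact: (measurableT_comp mef (measurable_pair2 u)).
    * by move=> y; exact: edev_ge0.
- rewrite (fubini_tonelli (fun q : R * 'rV[R]_d => J q.1 q.2 `^ p)%E)//=; last first.
    by move=> q; exact: poweR_ge0.
  pose gg (a : R) (u : 'rV[R]_d) := `|g (consR a u)|%:E.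
  rewrite [X in (_ <= _ * X)%E](_ : _ = \int[lam]_a \int[Q d]_u (gg a u `^ p))%E//.
  have sw : (\int[lam]_a \int[Q d]_u (gg a u `^ p) = \int[Q d]_u \int[lam]_a (gg a u `^ p))%E.
    exact: (fubini_tonelli (fun q : R * 'rV[R]_d => gg q.1 q.2 `^ p)%E mgcp (fun q => poweR_ge0 _ _)).
  rewrite sw.
  have mii := @measurable_fun_fubini_tonelli_G _ _ _ _ _ lam
    (fun q : R * 'rV[R]_d => gg q.1 q.2 `^ p)%E mgcp (fun q => poweR_ge0 _ _).
  rewrite -ge0_integralZl_EFin ?powR_ge0//; last first.
    by move=> u _; apply: integral_ge0 => a _; exact: poweR_ge0.
  apply: ge0_le_integral => //.
  + by move=> u _; apply: integral_ge0 => a _; exact: poweR_ge0.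
  + exact: (@measurable_fun_fubini_tonelli_G _ _ _ _ _ lam
      (fun q : R * 'rV[R]_d => J q.1 q.2 `^ p)%E mJp (fun q => poweR_ge0 _ _)).
  + exact: emeasurable_funM.
  + move=> u _; apply: (schur_test (mu := lam) (nu := lam)) => //.
    * by move=> x y; exact: dom_kern_ge0.
    * exact: measurable_dom_kern.
    * by move=> x; exact: integral_dom_kern.
    * move=> y; under eq_integral do rewrite dom_kernC.
      exact: integral_dom_kern.
    * exact: (measurableT_comp mgc (measurable_pair2 u)).
Qed.

End step.

Lemma edev_power_bound d (f : 'rV[R]_d -> R) (g : 'I_d -> 'rV[R]_d -> R) (p : R) :
  1 <= p -> measurable_fun setT f -> (forall i, measurable_fun setT (g i)) ->
  (forall i, line_bound i f (g i)) ->
  (\int[Q d]_x (edev f x `^ p) <= (dev_const p d * mesh R n r `^ p)%:E *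
    \sum_(i < d) \int[Q d]_x (`|g i x|%:E `^ p))%E.
Proof.
move=> p1; have p0 : 0 <= p by apply: le_trans p1.
elim: d f g => [|d IH] f g mf mg fg.
  rewrite mul0r mul0e integral0_eq// => x _.
  rewrite /edev integral0_eq; first by rewrite poweR0r ?gt_eqF ?(lt_le_trans ltr01).
  by move=> y _; rewrite (thinmx0 x) (thinmx0 y) subrr normr0 mulr0.
apply: le_trans (edev_power_step p1 mf (mg ord0) (fg ord0)) _ => /=.
set G := fun i => (\int[Q d.+1]_x (`|g i x|%:E `^ p))%E.
have G0 i : (0 <= G i)%E by apply: integral_ge0 => x _; exact: poweR_ge0.
have mc0 : 0 <= mesh R n r by rewrite ltW// mesh_gt0.
have B0 := dev_const_ge0 p d.
have mgc i : measurable_fun setT (fun q : R * 'rV[R]_d => `|g i (consR q.1 q.2)|%:E `^ p)%E.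
  apply: measurable_fun_poweR; apply/measurable_EFinP; apply: measurableT_comp => //.
  exact: measurable_fcons.
have key : (\int[lam]_b \int[Q d]_u (edev (fun v => f (consR b v)) u `^ p) <=
   (dev_const p d * mesh R n r `^ p)%:E * \sum_(i < d) G (lift ord0 i))%E.
  have GE (i : 'I_d.+1) : (G i = \int[lam]_b \int[Q d]_u (`|g i (consR b u)|%:E `^ p))%E.
    rewrite /G ge0_integral_unit_cubeS// => [|x]; last exact: poweR_ge0.
    by apply: measurable_fun_poweR; apply/measurable_EFinP; exact: measurableT_comp.
  under eq_bigr do rewrite GE.
  have mgi i := @measurable_fun_integral_r _ _ R 'rV[R]_d R (Q d)
    (fun b u => `|g i (consR b u)|%:E `^ p)%E (mgc i) (fun a u => poweR_ge0 _ _).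
  have gi0 i b : (0 <= \int[Q d]_u `|g i (consR b u)|%:E `^ p)%E.
    by apply: integral_ge0 => u _; exact: poweR_ge0.
  have C0 : 0 <= dev_const p d * mesh R n r `^ p by rewrite mulr_ge0// powR_ge0.
  rewrite -ge0_integral_sum// -ge0_integralZl_EFin//; last 2 first.
  - by move=> b _; apply: sume_ge0.
  - exact: emeasurable_sum.
  have mef : measurable_fun setT (fun q : R * 'rV[R]_d => edev (fun v => f (consR q.1 v)) q.2).
    apply: (measurable_edev_param (F := fun q : R * 'rV[R]_d => fun v => f (consR q.1 v))) => //.
    by apply: measurable_fcons => //; exact: (measurableT_comp measurable_fst measurable_fst).
  have mefp := measurable_fun_poweR p mef.
  apply: ae_ge0_le_integral => //.
  - by move=> b _; apply: integral_ge0 => u _; exact: poweR_ge0.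
  - exact: (@measurable_fun_integral_r _ _ R 'rV[R]_d R (Q d)
      (fun b u => edev (fun v => f (consR b v)) u `^ p)%E mefp (fun a u => poweR_ge0 _ _)).
  - by move=> b _; rewrite mule_ge0 ?lee_fin//; apply: sume_ge0.
  - by apply: emeasurable_funM => //; exact: emeasurable_sum.
  - have : {ae lam, forall b : R, forall j : 'I_d, line_bound j (fun v => f (consR b v))
       (fun v => g (lift ord0 j) (consR b v))}.
      apply: filter_forall => j; exact: line_boundS.
    apply: filterS => b hb _.
    apply: (IH (fun v => f (consR b v)) (fun j v => g (lift ord0 j) (consR b v))) => //.
      exact: measurable_fcons.
    by move=> i; exact: measurable_fcons.
rewrite big_ord_recl -/(G ord0).
have pp0 (x : R) : 0 <= x `^ p by exact: powR_ge0.
have S0 : (0 <= \sum_(i < d) G (lift ord0 i))%E by exact: sume_ge0.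
apply: (@le_trans _ _ ((2 `^ p)%:E * ((4 `^ p)%:E * ((dev_const p d * mesh R n r `^ p)%:E *
    \sum_(i < d) G (lift ord0 i)) + ((8 * mesh R n r) `^ p)%:E * G ord0))%E).
  apply: lee_wpmul2l; first by rewrite lee_fin.
  by rewrite leeD2r//; apply: lee_wpmul2l => //; rewrite lee_fin.
rewrite powRM// !muleA -!EFinM ge0_muleDr ?mule_ge0 ?lee_fin ?mulr_ge0//.
rewrite [leRHS]ge0_muleDr// addeC !muleA -!EFinM; apply: leeD.
  apply: lee_wpmul2r => //; rewrite lee_fin mulrA ler_wpM2r// ler_wpM2l//.
  by rewrite lerDr mulr_ge0.
apply: lee_wpmul2r => //; rewrite lee_fin !mulrA ler_wpM2r//.
by rewrite -mulrA ler_wpM2l// lerDl.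
Qed.

End deviation.

(** * Smooth cutoff functions on the line *)

Section smooth_functions.
Variable R : realType.
Implicit Types f g : R -> R.

(** [n]-fold differentiability, with the derivatives existentially
    quantified so that sums and products need no explicit formulas. *)
Fixpoint Cn n f : Prop :=
  if n is m.+1 then exists2 f', (forall x, is_derive x (1:R) f (f' x)) & Cn m f'
  else True.

Definition smooth1 f := forall n, Cn n f.

Lemma Cn_le m n f : (m <= n)%N -> Cn n f -> Cn m f.
Proof.
elim: n m f => [|n IH] [|m] f //= mn [f' df cf].
by exists f' => //; exact: IH cf.
Qed.

Lemma CnD n f g : Cn n f -> Cn n g -> Cn n (fun x => f x + g x).
Proof.
elim: n f g => //= n IH f g [f' df cf] [g' dg cg].
by exists (fun x => f' x + g' x); [move=> x; exact: is_deriveD|exact: IH].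
Qed.

Lemma CnM n f g : Cn n f -> Cn n g -> Cn n (fun x => f x * g x).
Proof.
elim: n f g => //= n IH f g [f' df cf] [g' dg cg].
exists (fun x => f x * g' x + g x * f' x); first by move=> x; exact: is_deriveM.
apply: CnD; apply: IH => //.
- by apply: (@Cn_le n n.+1) => //; exists f'.
- by apply: (@Cn_le n n.+1) => //; exists g'.
Qed.

Lemma Cn_cst n c : Cn n (fun=> c).
Proof.
elim: n c => //= n IH c; exists (fun=> 0) => // x.
exact: is_derive_cst.
Qed.

Lemma CnZ n c f : Cn n f -> Cn n (fun x => c * f x).
Proof. by move=> cf; apply: CnM => //; exact: Cn_cst. Qed.

Lemma Cn_affine n f a b : Cn n f -> Cn n (fun x => f (a * x + b)).
Proof.
elim: n f => //= n IH f [f' df cf].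
exists (fun x => a * f' (a * x + b)); last by apply: CnZ; exact: IH.
move=> x; rewrite mulrC.
apply: (@is_derive1_comp _ f (fun x => a * x + b) x (f' (a * x + b)) a).
rewrite (_ : (fun x => _) = a *: id + cst b); last by apply/funext.
by apply: is_derive_eq; rewrite addr0 [_ *: _]mulr1.
Qed.

Lemma smooth1_derive f : smooth1 f -> smooth1 (derive1 f).
Proof.
move=> sf n; have [f' df cf] := sf n.+1.
rewrite (_ : derive1 f = f')//; apply/funext => x.
by rewrite derive1E; case: (df x).
Qed.

Lemma smooth1_is_derive f x : smooth1 f -> is_derive x (1:R) f (derive1 f x).
Proof.
move=> sf; have [f' df _] := sf 1%N; rewrite derive1E; apply: derivableP.
by case: (df x).
Qed.

Lemma smooth1_continuous f : smooth1 f -> continuous f.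
Proof.
move=> sf x; apply: differentiable_continuous; apply/derivable1_diffP.
by case: (smooth1_is_derive x sf).
Qed.

(** [x ^ - k * exp (- 1 / x)], extended by zero to the left of 0. The
    negative powers make the family stable under differentiation. *)
Definition expinv (k : nat) (x : R) : R :=
  if 0 < x then x ^- k * expR (- x^-1) else 0.

Lemma expinv_ge0 k x : 0 <= expinv k x.
Proof.
rewrite /expinv; case: ifP => // x0; rewrite mulr_ge0 ?expR_ge0//.
by rewrite invr_ge0 exprn_ge0// ltW.
Qed.

(** The exponential series at [1 / x] exceeds its term of order [k]. *)
Lemma expinv_le k x : expinv k x <= k`!%:R.
Proof.
rewrite /expinv; case: ifP => // x0.
rewrite expRN -ler_pdivlMr ?invr_gt0 ?expR_gt0// invrK.
have y0 : 0 < x^-1 by rewrite invr_gt0.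
rewrite -exprVn; case: k => [|k].
  by rewrite expr0 mul1r -expR0 ler_expR ltW.
rewrite -ler_pdivrMl ?ltr0n ?fact_gt0// mulrC.
by apply: le_trans (expR_ge1Dxn k (ltW y0)); rewrite lerDr.
Qed.

Lemma expinvS k x : expinv k x = expinv k.+1 x * x.
Proof.
rewrite /expinv; case: ifP => x0; last by rewrite mul0r.
rewrite exprS invfM -[LHS]mul1r -(@mulVf _ x) ?gt_eqF//; ring.
Qed.

Lemma expinv_continuous0 k : {for 0, continuous (expinv k)}.
Proof.
have e0 : expinv k 0 = 0 by rewrite /expinv ltxx.
rewrite /prop_for /continuous_at e0.
apply/cvgrPdist_le => e egt0; near=> x.
rewrite sub0r normrN expinvS normrM (ger0_norm (expinv_ge0 _ _)).
apply: (@le_trans _ _ (k.+1`!%:R * `|x|)).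
  by rewrite ler_wpM2r// expinv_le.
rewrite -ler_pdivlMl ?ltr0n ?fact_gt0//.
near: x; apply: (@nbhs0_le R R); rewrite mulr_gt0// invr_gt0 ltr0n fact_gt0//.
Unshelve. all: by end_near. Qed.

Let is_deriveVX k (x : R) : x != 0 ->
  is_derive x (1:R) (fun x => x^-1 ^+ k) (- k%:R * x^-1 ^+ k.+1).
Proof.
move=> x0.
have dV : is_derive x (1:R) (fun x => x^-1) (- x^-1 ^+ 2).
  have := is_deriveV x0 (is_derive_id x (1:R)).
  by rewrite [_ *: _]mulr1 -exprVn.
elim: k => [|k IH].
  rewrite oppr0 mul0r; exact: is_derive_cst.
rewrite (_ : (fun x => _) = (fun x => x^-1) * (fun x : R => x^-1 ^+ k)); last first.
  by apply/funext => y; rewrite exprS.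
apply: is_derive_eq; rewrite /GRing.scale/= -natr1 !exprS; ring.
Qed.

(** At 0, the difference quotient of [expinv k] is [expinv k.+1], which
    is continuous there and vanishes. *)
Lemma is_derive_expinv k (x : R) : is_derive x (1:R) (expinv k)
  (expinv k.+2 x - k%:R * expinv k.+1 x).
Proof.
case: (ltrgt0P x) => [x0|x0|->].
- have x_neq0 : x != 0 by rewrite gt_eqF.
  have dV : is_derive x (1:R) (fun x => - x^-1) (x^-1 ^+ 2).
    have := is_deriveN (is_deriveV x_neq0 (is_derive_id x (1:R))).
    by rewrite [_ *: _]mulr1 -exprVn opprK.
  have dE : is_derive x (1:R) (fun x => expR (- x^-1)) (expR (- x^-1) * x^-1 ^+ 2).
    exact: (@is_derive1_comp _ expR (fun x => - x^-1) x (expR (- x^-1)) (x^-1 ^+ 2)).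
  have h := is_deriveM (is_deriveVX k x_neq0) dE.
  apply: (@near_eq_is_derive _ _ _ ((fun x : R => x^-1 ^+ k) * (fun x => expR (- x^-1)))).
    near=> y; rewrite /expinv ifT; last by near: y; exact: lt_nbhsr.
    by rewrite -exprVn.
  apply: is_derive_eq; rewrite /expinv x0 /GRing.scale/= -!exprVn !exprS; ring.
- apply: (@near_eq_is_derive _ _ _ (cst 0)).
    near=> y; rewrite /expinv ifF//; apply/negbTE; rewrite -leNgt ltW//.
    by near: y; exact: lt_nbhsl.
  by rewrite /expinv ltNge (ltW x0)/= mulr0 subrr; exact: is_derive_cst.
- apply/is_derive1_caratheodory; exists (expinv k.+1); split.
  + by move=> z; rewrite {2}/expinv ltxx subr0 subr0 -expinvS.
  + exact: expinv_continuous0.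
  + by rewrite /expinv ltxx mulr0 subr0.
Unshelve. all: by end_near. Qed.

Lemma smooth1_expinv k : smooth1 (expinv k).
Proof.
move=> n; elim: n k => //= n IH k.
exists (fun x => expinv k.+2 x - k%:R * expinv k.+1 x); first exact: is_derive_expinv.
rewrite (_ : (fun x => _) = fun x => expinv k.+2 x + (- k%:R) * expinv k.+1 x).
  by apply: CnD => //; exact: CnZ.
by apply/funext => x; rewrite mulNr.
Qed.

(** A smooth function supported in the interval from [Num.max a e] to
    [Num.min b (1 - e)], hence in the open unit interval; it tends to the
    indicator of the points of the open unit interval between [a] and [b] when
    [e] tends to 0. *)
Definition cutoff (a b e x : R) : R :=
  expinv 0 ((x - Num.max a e) / e) * expinv 0 ((Num.min b (1 - e) - x) / e).

Lemma cutoff_ge0 a b e x : 0 <= cutoff a b e x.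
Proof. by rewrite mulr_ge0// expinv_ge0. Qed.

Lemma cutoff_le1 a b e x : cutoff a b e x <= 1.
Proof. by rewrite -[1]mulr1 ler_pM ?expinv_ge0// (le_trans (expinv_le 0 _)). Qed.

Lemma cutoff_out a b e x : 0 < e -> x \notin `[e, 1 - e] -> cutoff a b e x = 0.
Proof.
move=> e0; rewrite in_itv/= negb_and -!ltNge /cutoff /expinv => /orP[h|h].
  rewrite ifF ?mul0r//; apply/negbTE; rewrite -leNgt pmulr_lle0 ?invr_gt0//.
  by rewrite subr_le0 le_max (ltW h) orbT.
rewrite [X in _ * X]ifF ?mulr0//; apply/negbTE; rewrite -leNgt pmulr_lle0 ?invr_gt0//.
by rewrite subr_le0 ge_min (ltW h) orbT.
Qed.

Lemma smooth1_cutoff a b e : smooth1 (cutoff a b e).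
Proof.
move=> n; apply: CnM.
  rewrite (_ : (fun x => _) = fun x => expinv 0 (e^-1 * x + (- Num.max a e / e))).
    by apply: Cn_affine; exact: smooth1_expinv.
  by apply/funext => x; congr (expinv 0 _); ring.
rewrite (_ : (fun x => _) = fun x => expinv 0 (- e^-1 * x + (Num.min b (1 - e) / e))).
  by apply: Cn_affine; exact: smooth1_expinv.
by apply/funext => x; congr (expinv 0 _); ring.
Qed.

Definition eps (k : nat) : R := k.+2%:R^-1.

Lemma eps_gt0 k : 0 < eps k. Proof. by rewrite invr_gt0. Qed.

Definition itv01 (a b : R) : set R := [set x | (a < x < b) && (0 < x < 1)].

Let expinv_cvg (u : R^nat) (l : R) : 0 < l -> (\forall k \near \oo, l / eps k <= u k) ->
  expinv 0 (u k) @[k --> \oo] --> (1 : R).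
Proof.
move=> l0 ul; apply/cvgrPdist_le => e e0.
near=> k.
have uk : l / eps k <= u k by near: k.
have uk0 : 0 < u k by apply: lt_le_trans uk; rewrite divr_gt0// eps_gt0.
rewrite /expinv uk0 expr0 invr1 mul1r ger0_norm; last first.
  by rewrite subr_ge0 expR_le1 oppr_le0 invr_ge0 ltW.
rewrite lerBlDr -lerBlDl (le_trans _ (expR_ge1Dx _))// lerD2l lerN2.
apply: (@le_trans _ _ (l / eps k)^-1); first by rewrite lef_pV2// posrE divr_gt0// eps_gt0.
rewrite invf_div ler_pdivrMr// /eps.
have : (k.+2%:R : R)^-1 <= (e * l).
  rewrite invf_ple ?posrE ?mulr_gt0//.
  apply: (@le_trans _ _ k%:R); last by rewrite ler_nat; lia.
  by near: k; exact: nbhs_infty_ger.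
by [].
Unshelve. all: by end_near. Qed.

Lemma cutoff_cvg a b x : cutoff a b (eps k) x @[k --> \oo] --> (\1_(itv01 a b) x : R).
Proof.
have eps0 : eps k @[k --> \oo] --> (0 : R).
  apply/cvgrPdist_le => e e0; near=> k.
  rewrite sub0r normrN ger0_norm ?(ltW (eps_gt0 k))// /eps invf_ple ?posrE//.
  apply: (@le_trans _ _ k%:R); last by rewrite ler_nat; lia.
  by near: k; exact: nbhs_infty_ger.
rewrite indicE; case: (boolP (x \in itv01 a b)) => [|xab].
  rewrite inE /itv01/= => /andP[/andP[ax xb] /andP[x0 x1]] /=.
  rewrite -[1%:R]mulr1; apply: cvgM.
    pose l := Num.min (x - a) (x / 2).
    have l0 : 0 < l by rewrite lt_min subr_gt0 ax divr_gt0.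
    apply: (expinv_cvg l0); near=> k.
    rewrite ler_pM2r ?invr_gt0 ?eps_gt0//.
    have ek : eps k <= x / 2.
      near: k; move/cvgrPdist_le : eps0 => /(_ (x / 2)).
      rewrite divr_gt0// => /(_ isT); apply: filterS => k.
      by rewrite sub0r normrN ger0_norm// ltW// eps_gt0.
    rewrite /l lerBrDr addrC -lerBrDr ge_max; apply/andP; split.
      by rewrite lerBrDr -lerBrDl ge_min lexx.
    rewrite lerBrDr -lerBrDl ge_min; apply/orP; right; lra.
  pose l := Num.min (b - x) ((1 - x) / 2).
  have l0 : 0 < l by rewrite lt_min subr_gt0 xb divr_gt0// subr_gt0.
  apply: (expinv_cvg l0); near=> k.
  rewrite ler_pM2r ?invr_gt0 ?eps_gt0//.
  have ek : eps k <= (1 - x) / 2.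
    near: k; move/cvgrPdist_le : eps0 => /(_ ((1 - x) / 2)).
    rewrite divr_gt0 ?subr_gt0// => /(_ isT); apply: filterS => k.
    by rewrite sub0r normrN ger0_norm// ltW// eps_gt0.
  rewrite /l lerBrDr le_min; apply/andP; split.
    by rewrite -lerBrDr ge_min lexx.
  rewrite -lerBrDr ge_min; apply/orP; right; lra.
rewrite (_ : (fun k => _) = cst 0); first exact: cvg_cst.
apply/funext => k /=; have e0 := eps_gt0 k.
have [xe|xe] := boolP (x \in `[eps k, 1 - eps k]); last exact: cutoff_out.
move: xe; rewrite in_itv/= => /andP[x0 x1].
have : ~~ ((a < x < b) && (0 < x < 1)).
  by apply/negP => h; move/negP : xab; apply; rewrite inE.
have x01 : 0 < x < 1 by rewrite (lt_le_trans e0 x0) (le_lt_trans x1)// gtrBl.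
rewrite x01 andbT negb_and -!leNgt /cutoff /expinv.
move=> /orP[h|h].
  rewrite ifF ?mul0r//; apply/negbTE; rewrite -leNgt pmulr_lle0 ?invr_gt0//.
  by rewrite subr_le0 le_max h.
rewrite [X in _ * X]ifF ?mulr0//; apply/negbTE; rewrite -leNgt pmulr_lle0 ?invr_gt0//.
by rewrite subr_le0 ge_min h.
Unshelve. all: by end_near. Qed.

End smooth_functions.

(** * Tensor products of test functions *)

Section tensor_test_functions.
Variables (R : realType) (d : nat).
Implicit Types (th : 'I_d -> R -> R) (x : 'rV[R]_d).

Definition tens th x : R := \prod_(j < d) th j (x ord0 j).

Definition tens_derive (i : 'I_d) th : 'I_d -> R -> R :=
  fun j => if j == i then derive1 (th j) else th j.

Lemma is_derive_tens th i x : (forall j, smooth1 (th j)) ->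
  is_derive x (delta_mx ord0 i : 'rV[R]_d) (tens th) (tens (tens_derive i th) x).
Proof.
move=> sth.
pose c : R := \prod_(j < d | j != i) th j (x ord0 j).
pose psi (t : R) : R := c * th i t.
have dpsi : is_derive (x ord0 i) (1:R) psi (c * derive1 (th i) (x ord0 i)).
  have h := smooth1_is_derive (x ord0 i) (sth i).
  rewrite (_ : psi = c *: th i)//; exact: is_deriveZ.
have qE : (fun h : R => h^-1 *: ((tens th \o shift x) (h *: delta_mx ord0 i) - tens th x)) =
    (fun h : R => h^-1 *: ((psi \o shift (x ord0 i)) (h *: 1) - psi (x ord0 i))).
  apply/funext => h /=; congr (_ *: (_ - _)).
    rewrite /tens (bigD1 i)//= mulrC /psi; congr (_ * th i _); last first.
      by rewrite !mxE !eqxx.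
    by apply: eq_bigr => j ji; rewrite !mxE (negbTE ji) andbF mulr0 add0r.
  by rewrite /tens (bigD1 i)//= mulrC.
have -> : tens (tens_derive i th) x = c * derive1 (th i) (x ord0 i).
  rewrite /tens (bigD1 i)//= /tens_derive eqxx mulrC; congr (_ * _).
  by apply: eq_bigr => j /negbTE ->.
case: dpsi => d1 d2; apply: DeriveDef; rewrite /derivable ?/derive qE//.
Qed.

Lemma smooth1_tens_derive th i : (forall j, smooth1 (th j)) ->
  forall j, smooth1 (tens_derive i th j).
Proof.
by move=> sth j; rewrite /tens_derive; case: (j == i) => //; exact: smooth1_derive.
Qed.

Lemma partial_tens th i : (forall j, smooth1 (th j)) ->
  partial i (tens th) = tens (tens_derive i th).
Proof. by move=> sth; apply/funext => x; case: (is_derive_tens i x sth). Qed.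

Lemma continuous_tens th : (forall j, smooth1 (th j)) -> continuous (tens th).
Proof.
move=> sth; rewrite /tens; apply: (@continuous_big R 'I_d *%R 1 xpredT).
  exact: mul_continuous.
move=> j _ x; apply: (@continuous_comp _ _ _ (fun M : 'rV[R]_d => M ord0 j) (th j)).
  exact: coord_continuous.
exact: smooth1_continuous.
Qed.

Lemma smooth_tens th : (forall j, smooth1 (th j)) -> smooth (tens th).
Proof.
move=> sth s /=.
have [th' sth' ->] : exists2 th', forall j, smooth1 (th' j) &
    foldr (@partial R d) (tens th) s = tens th'.
  elim: s => [|i s [th' sth' IH]]; first by exists th.
  exists (tens_derive i th'); first exact: smooth1_tens_derive.
  by rewrite /= IH partial_tens.
split; first exact: continuous_tens.
by move=> i x; case: (is_derive_tens i x sth').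
Qed.

Lemma closed_box (a b : 'rV[R]_d) : closed (box a b).
Proof.
rewrite (_ : box a b = \bigcap_(i in [set: 'I_d])
   ((fun M : 'rV[R]_d => M ord0 i) @^-1` `[a ord0 i, b ord0 i])); last first.
  by apply/seteqP; split => x /= + i => /(_ i); rewrite /= in_itv /=; exact.
apply: closed_bigI => i _; apply: closed_comp; last exact: itv_closed.
by move=> x _; exact: coord_continuous.
Qed.

Lemma compact_box (a b : 'rV[R]_d) : compact (box a b).
Proof.
have := @rV_compact R d (fun i => `[a ord0 i, b ord0 i]%classic)
  (fun i => @segment_compact _ _ _).
by congr compact; apply/seteqP; split => x /= + i => /(_ i); rewrite in_itv.
Qed.

(** The closed box between [e] and [1 - e] is compact and contains the
    support. *)
Lemma test_function_tens th (e : R) : 0 < e -> (forall j, smooth1 (th j)) ->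
  (forall j t, t \notin `[e, 1 - e] -> th j t = 0) -> test_function (tens th).
Proof.
move=> e0 sth th0.
have sb : supp (tens th) `<=` box (const_mx e) (const_mx (1 - e)).
  rewrite /supp [box _ _](closure_id _).1; last exact: closed_box.
  apply: closureS => x /= xn0 i; rewrite !mxE.
  move: xn0; apply: contraNT => h; apply/eqP.
  have tz : th i (x ord0 i) = 0 by apply: th0; rewrite in_itv.
  by rewrite /tens (bigD1 i)//= tz mul0r.
split; first exact: smooth_tens.
- apply: subclosed_compact sb; first exact: closed_closure.
  exact: compact_box.
- move=> x /sb xb i; have := xb i; rewrite !mxE => /andP[h1 h2].
  by rewrite (lt_le_trans e0 h1) (le_lt_trans h2)// gtrBl.
Qed.

End tensor_test_functions.

Section primitive.
Variable R : realType.
Variables (eta : R -> R) (e : R).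
Hypotheses (e0 : 0 < e) (seta : smooth1 eta).
Hypothesis eta0 : forall t, t \notin `[e, 1 - e] -> eta t = 0.

Let mu := @lebesgue_measure R.

Let eta_integrable : mu.-integrable setT (EFin \o eta).
Proof.
have me : measurable_fun setT eta by apply: continuous_measurable_fun; exact: smooth1_continuous.
have i1 : mu.-integrable `[e, 1 - e] (EFin \o eta).
  apply: continuous_compact_integrable; first exact: segment_compact.
  by apply: continuous_subspaceT; exact: smooth1_continuous.
have := (@integrable_mkcond _ _ R mu `[e, 1 - e] (EFin \o eta) _).1.
rewrite (_ : _ \_ _ = EFin \o eta); first by apply => //; exact: measurable_itv.
apply/funext => t; rewrite patchE; case: ifPn => // tn /=.
by rewrite eta0//; move: tn; rewrite notin_setE/= => /negP.
Qed.

Definition primitive (x : R) : R := (\int[mu]_(t in `]-oo, x]) eta t)%R.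

Lemma is_derive_primitive x : is_derive x (1:R) primitive (eta x).
Proof.
have x1 : x < x + 1 by rewrite ltrDl.
have [] := @continuous_FTC1 R eta -oo%O x (x + 1) x1 _ _ _.
- by apply: integrableS eta_integrable => //; exact: measurable_itv.
- by rewrite /= ltNyr.
- exact: smooth1_continuous.
move=> h1 h2; apply: DeriveDef; first exact: h1.
by rewrite -derive1E; exact: h2.
Qed.

Lemma smooth1_primitive : smooth1 primitive.
Proof. by move=> [|n] //=; exists eta => //; exact: is_derive_primitive. Qed.

Lemma derive1_primitive : derive1 primitive = eta.
Proof. by apply/funext => x; rewrite derive1E; case: (is_derive_primitive x). Qed.

Let integral_unit (f : R -> R) : measurable_fun setT f ->
  (forall t, t \notin `[e, 1 - e] -> f t = 0) ->
  (\int[@unit_leb R]_t (f t)%:E = \int[mu]_t (f t)%:E)%E.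
Proof.
move=> mf f0; rewrite integral_unit_leb_signed; last exact/measurable_EFinP.
rewrite [LHS]integral_mkcond; apply: eq_integral => t _.
rewrite patchE; case: ifPn => // t01; rewrite f0//.
apply: contra t01; rewrite inE/= !in_itv/= => /andP[h1 h2].
by rewrite (le_trans (ltW e0) h1) (le_trans h2)// gerBl ltW.
Qed.

Let meta : measurable_fun setT eta.
Proof. by apply: continuous_measurable_fun; exact: smooth1_continuous. Qed.

Hypothesis ieta : (\int[@unit_leb R]_t (eta t)%:E = 0)%E.

(** Since [eta] has integral zero, its integral above [z] is the opposite
    of its integral below. *)
Lemma primitive_tail (z : R) :
  (\int[@unit_leb R]_y ((z <= y)%R%:R * eta y)%:E = (- primitive z)%:E)%E.
Proof.
rewrite integral_unit; last 2 first.
- apply: measurable_funM => //; apply: measurable_natr_bool.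
  exact: measurable_fun_ler.
- by move=> t te; rewrite eta0// mulr0.
have i0 : (\int[mu]_t (eta t)%:E = 0)%E by rewrite -integral_unit.
have splitE : (\int[mu]_t (eta t)%:E = \int[mu]_(t in `]-oo, z]) (eta t)%:E +
   \int[mu]_(t in `]z, +oo[) (eta t)%:E)%E.
  rewrite -integral_setU//=.
  - congr (integral _ _ _); apply/seteqP; split => t //= _.
    by rewrite !in_itv/= andbT; case: (leP t z); [left|right].
  - by apply: measurable_funTS; exact/measurable_EFinP.
  - by apply/disj_setPS => t [] /=; rewrite !in_itv/= andbT ltNge => ->.
have fin1 : (\int[mu]_(t in `]-oo, z]) (eta t)%:E \is a fin_num)%E.
  apply: integrable_fin_num; first exact: measurable_itv.
  by apply: integrableS eta_integrable => //; exact: measurable_itv.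
rewrite (_ : primitive z = fine (\int[mu]_(t in `]-oo, z]) (eta t)%:E))//.
set A := (\int[mu]_(t in _) _)%E in fin1 splitE *.
have -> : ((- fine A)%:E = \int[mu]_(t in `]z, +oo[) (eta t)%:E)%E.
  move: splitE; rewrite i0 -{1}(fineK fin1).
  case: (integral _ _ _) => // b [] /esym/eqP; rewrite addr_eq0 => /eqP ->.
  by rewrite opprK.
rewrite integral_itv_obnd_cbnd; last first.
  by apply: measurable_funTS; exact/measurable_EFinP.
rewrite [RHS]integral_mkcond; apply: eq_integral => t _.
rewrite patchE; case: ifPn; rewrite ?inE ?notin_setE/= in_itv/= andbT.
  by move=> ->; rewrite mul1r.
by move=> /negP/negbTE ->; rewrite mul0r.
Qed.

(** The primitive of a function of mean zero supported in the unit
    interval is again supported there, hence available as a test function. *)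
Lemma primitive_out z : z \notin `[e, 1 - e] -> primitive z = 0.
Proof.
rewrite in_itv/= negb_and -!ltNge => /orP[ze|ze].
  rewrite /primitive /Rintegral integral0_eq// => t; rewrite /= in_itv/= => tz.
  by rewrite eta0// in_itv/= negb_and -!ltNge (le_lt_trans tz ze).
apply/eqP; rewrite -oppr_eq0 -eqe -primitive_tail; apply/eqP.
rewrite integral0_eq// => t _; case: (leP z t) => [zt|]; last by rewrite mul0r.
by rewrite eta0 ?mulr0// in_itv/= negb_and -!ltNge (lt_le_trans ze zt) orbT.
Qed.

End primitive.

(** * Integrals over boxes and exchange of coordinates *)

Section cube_boxes.
Variable R : realType.
Local Notation consR a u := (cons_rV ((a : measurableTypeR R), u)).
Local Notation "'lam'" := (@unit_leb R).
Local Notation "'Q' d" := (@unit_cube R d) (at level 10, d at level 9).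

Lemma integral_unit_cube d (f : 'rV[R]_d -> \bar R) : measurable_fun setT f ->
  (\int[Q d]_x f x = \int[lebesgue_rV R d]_(x in cube) f x)%E.
Proof. by move=> mf; rewrite -(integral_mrestr _ (@measurable_cube R d)). Qed.

Lemma eq_integral_unit_cube d (f g : 'rV[R]_d -> \bar R) :
  measurable_fun setT f -> measurable_fun setT g ->
  (forall x, cube x -> f x = g x) -> (\int[Q d]_x f x = \int[Q d]_x g x)%E.
Proof.
move=> mf mg fg; rewrite !integral_unit_cube//.
by apply: eq_integral => x; rewrite inE => /fg.
Qed.

Definition obox d (a b : 'rV[R]_d) : set 'rV[R]_d :=
  [set x | forall i, a ord0 i < x ord0 i < b ord0 i].

Lemma measurable_obox d (a b : 'rV[R]_d) : measurable (obox a b).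
Proof.
rewrite (_ : obox a b = \bigcap_(i in [set: 'I_d])
    (fun x : 'rV[R]_d => x ord0 i) @^-1` `]a ord0 i, b ord0 i[%classic); last first.
  by apply/seteqP; split => x /= + i => /(_ i); rewrite /= in_itv /=; exact.
apply: fin_bigcap_measurable => // i _; rewrite -[X in measurable X]setTI.
exact: (measurable_coord i).
Qed.

Lemma oboxI d (a b a' b' : 'rV[R]_d) :
  obox a b `&` obox a' b' =
  obox (\row_i Num.max (a ord0 i) (a' ord0 i)) (\row_i Num.min (b ord0 i) (b' ord0 i)).
Proof.
apply/seteqP; split => x /=.
  move=> [h1 h2] i; rewrite !mxE gt_max lt_min.
  by have /andP[-> ->] := h1 i; have /andP[-> ->] := h2 i.
move=> h; split => i; have := h i; rewrite !mxE gt_max lt_min;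
  by move=> /andP[/andP[h1 h2] /andP[h3 h4]]; apply/andP.
Qed.

Definition oboxes d : set (set 'rV[R]_d) := [set A | exists a b, A = obox a b].
Arguments oboxes : clear implicits.

Lemma measurable_oboxE d : @measurable _ 'rV[R]_d = <<s oboxes d >>.
Proof.
apply/seteqP; split; last first.
  apply: smallest_sub; first exact: sigma_algebra_measurable.
  by move=> _ [a [b ->]]; exact: measurable_obox.
apply: smallest_sub; first exact: smallest_sigma_algebra.
move=> B; rewrite -bigcup_seq => -[i _ /= [C mC <-]]; rewrite setTI.
pose T := g_sigma_algebraType (oboxes d).
suff mT : measurable_fun setT (fun x : T => (x : 'rV[R]_d) ord0 i : R).
  by have := mT measurableT C mC; rewrite setTI.
move=> mT'; apply: (measurability _ (RGenOpens.measurableE R)) => //.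
move=> _ [_ [x [y ->]] <-]; rewrite setTI.
(* a strip in one coordinate is an increasing union of boxes *)
pose lo k : 'rV[R]_d := \row_j (if j == i then x else - k%:R).
pose hi k : 'rV[R]_d := \row_j (if j == i then y else k%:R).
rewrite (_ : _ @^-1` _ = \bigcup_k (obox (lo k) (hi k) : set T)).
  apply: bigcupT_measurable => k; apply: sub_sigma_algebra.
  by exists (lo k), (hi k).
apply/seteqP; split => u /=; rewrite in_itv/=; last first.
  by move=> [k _ /(_ i)]; rewrite !mxE eqxx.
move=> uxy; pose K := (\sum_(j < d) Num.truncn `|(u : 'rV[R]_d) ord0 j|).+1.
exists K => // j; rewrite !mxE; case: eqP => [->//|_].
have uK : `|(u : 'rV[R]_d) ord0 j| < K%:R.
  apply: lt_le_trans (truncnS_gt _) _; rewrite ler_nat ltnS (bigD1 j)//=.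
  exact: leq_addr.
by rewrite -ltr_norml.
Qed.

(** Open boxes form a pi-system that generates the Borel sets, so that the
    integral vanishes on all Borel sets by Dynkin's theorem. *)
Lemma box_ae_eq0 d (F : 'rV[R]_d -> \bar R) : (Q d).-integrable setT F ->
  (forall a b, \int[Q d]_(x in obox a b) F x = 0)%E ->
  {ae Q d, forall x, F x = 0%E}.
Proof.
move=> iF Fbox; have mF := measurable_int _ iF.
have iFA A : measurable A -> (Q d).-integrable A F.
  by move=> mA; apply: integrableS iF.
have F1 : (\int[Q d]_x F x = 0)%E.
  pose m1 : 'rV[R]_d := const_mx (-1); pose m2 : 'rV[R]_d := const_mx 2.
  rewrite -(Fbox m1 m2) [RHS]integral_mkcond; apply: eq_integral_unit_cube => //.
    apply/(measurable_restrictT _ _).1; first exact: measurable_obox.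
    exact: measurable_funTS.
  move=> x x01; rewrite patchE mem_set// => i; rewrite !mxE.
  by have /andP[x0 x1] := x01 i; rewrite (lt_le_trans _ x0) ?(le_lt_trans x1)//; lra.
suff : ae_eq (Q d) setT F (cst 0%E) by apply: filterS => x /(_ I).
apply: integral_ae_eq => // E _; rewrite integral0; move: E.
rewrite measurable_oboxE.
apply: (@dynkin_induction _ _ (oboxes d) (fun E => \int[Q d]_(x in E) F x = 0)%E) => //.
- exact: measurable_oboxE.
- by move=> _ _ [a [b ->]] [a' [b' ->]]; rewrite oboxI; do 2 eexists.
- by move=> _ [a [b ->]].
- move=> S mS FS; have := F1; rewrite -(setUv S) integral_setU//.
  + by rewrite FS add0e.
  + exact: measurableC.
  + by rewrite setUv.
  + by apply/disj_setPS => x [].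
- move=> G mG tG FG; rewrite integral_bigcup//; last exact: iFA (bigcupT_measurable _ mG).
  by rewrite eseries0.
Qed.

End cube_boxes.

Section swap.
Variable R : realType.
Local Notation consR a u := (cons_rV ((a : measurableTypeR R), u)).
Local Notation "'lam'" := (@unit_leb R).
Local Notation "'Q' d" := (@unit_cube R d) (at level 10, d at level 9).

(** The exchange of the coordinate [x_i] with a further variable
    preserves the product measure. The induction reaches the [i]-th coordinate
    by peeling off the coordinates before it, and is Tonelli's theorem for
    [i = 0]. *)
Lemma ge0_integral_swap d (i : 'I_d) (F : 'rV[R]_d * R -> \bar R) :
  measurable_fun setT F -> (forall q, 0 <= F q)%E ->
  (\int[Q d]_x \int[lam]_y F (upd i y x, x ord0 i) =
   \int[Q d]_x \int[lam]_y F (x, y))%E.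
Proof.
elim: d i F => [[]//|d IH] i F mF F0.
have mup : measurable_fun setT (fun q : 'rV[R]_d.+1 * R => (upd i q.2 q.1, q.1 ord0 i)).
  apply: measurable_fun_pair; first exact: measurable_fun_upd.
  exact: (measurableT_comp (measurable_coord i) measurable_fst).
have mFu : measurable_fun setT (fun q : 'rV[R]_d.+1 * R => F (upd i q.2 q.1, q.1 ord0 i)).
  exact: (measurableT_comp mF mup).
have mFe : measurable_fun setT (fun q : 'rV[R]_d.+1 * R => F (q.1, q.2)).
  by rewrite (_ : (fun q => _) = F)//; apply/funext => -[].
rewrite !ge0_integral_unit_cubeS; last 4 first.
- exact: (@measurable_fun_integral_r _ _ 'rV[R]_d.+1 R R lam (fun x y => F (x, y))).
- by move=> x; exact: integral_ge0.
- exact: (@measurable_fun_integral_r _ _ 'rV[R]_d.+1 R R lam (fun x y => F (upd i y x, x ord0 i))).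
- by move=> x; exact: integral_ge0.
have mFc : measurable_fun setT (fun q : R * 'rV[R]_d * R => F (consR q.1.1 q.1.2, q.2)).
  apply: (measurableT_comp mF); apply: measurable_fun_pair => //.
  apply: measurable_fun_cons; first exact: (measurableT_comp measurable_fst measurable_fst).
  exact: (measurableT_comp measurable_snd measurable_fst).
have [j ->|->] := unliftP ord0 i.
  apply: eq_integral => a _.
  pose Fa (q : 'rV[R]_d * R) := F (consR a q.1, q.2).
  have mFa : measurable_fun setT Fa.
    apply: (measurableT_comp mF); apply: measurable_fun_pair => //.
    exact: measurable_fun_cons.
  transitivity (\int[Q d]_u \int[lam]_y Fa (upd j y u, u ord0 j))%E; last first.
    by apply: IH => // q; exact: F0.
  apply: eq_integral => u _; apply: eq_integral => y _.
  by rewrite upd_consS cons_rVS.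
under eq_integral => a _ do under eq_integral => u _ do
  under eq_integral => y _ do rewrite upd_cons0 cons_rV0.
(* the innermost of three integrals is moved to the front *)
have perm3 (G : R -> 'rV[R]_d -> R -> \bar R) :
    measurable_fun setT (fun q : R * 'rV[R]_d * R => G q.1.1 q.1.2 q.2) ->
    (forall a u y, 0 <= G a u y)%E ->
  (\int[lam]_a \int[Q d]_u \int[lam]_y G a u y =
   \int[lam]_y \int[lam]_a \int[Q d]_u G a u y)%E.
  move=> mG G0.
  have m21 : measurable_fun setT (fun q : R * R * 'rV[R]_d => G q.1.1 q.2 q.1.2).
    have mT : measurable_fun setT (fun q : R * R * 'rV[R]_d => (q.1.1, q.2, q.1.2)).
      apply: measurable_fun_pair; last exact: (measurableT_comp measurable_snd measurable_fst).
      apply: measurable_fun_pair => //; exact: (measurableT_comp measurable_fst measurable_fst).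
    exact: (measurableT_comp mG mT).
  have mGa a : measurable_fun setT (fun q : 'rV[R]_d * R => G a q.1 q.2).
    have mT : measurable_fun setT (fun q : 'rV[R]_d * R => (a, q.1, q.2)).
      by apply: measurable_fun_pair => //; apply: measurable_fun_pair.
    exact: (measurableT_comp mG mT).
  under eq_integral => a _.
    rewrite (fubini_tonelli (fun q : 'rV[R]_d * R => G a q.1 q.2))//=.
    over.
  rewrite (fubini_tonelli (fun q : R * R => \int[Q d]_u G q.1 u q.2)%E)//=.
    exact: (@measurable_fun_integral_r _ _ (R * R)%type 'rV[R]_d R (Q d) (fun q u => G q.1 u q.2)).
  by move=> q; exact: integral_ge0.
have mFc' : measurable_fun setT (fun q : R * 'rV[R]_d * R => F (consR q.2 q.1.2, q.1.1)).
  apply: (measurableT_comp mF); apply: measurable_fun_pair.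
    apply: measurable_fun_cons => //; exact: (measurableT_comp measurable_snd measurable_fst).
  exact: (measurableT_comp measurable_fst measurable_fst).
rewrite (perm3 (fun a u y => F (consR y u, a)))//.
apply: eq_integral => y _.
rewrite (fubini_tonelli (fun q : R * 'rV[R]_d => F (consR y q.2, q.1)))//=.
exact: (measurableT_comp mF (measurable_fun_pair
  (measurable_fun_cons (@measurable_cst _ _ _ _ _ y) measurable_snd) measurable_fst)).
Qed.

Definition swap d (i : 'I_d) (q : 'rV[R]_d * R) : 'rV[R]_d * R :=
  (upd i q.2 q.1, q.1 ord0 i).

Lemma measurable_coord_swap d (i : 'I_d) : measurable_fun setT (swap i).
Proof.
apply: measurable_fun_pair; first exact: measurable_fun_upd.
exact: (measurableT_comp (measurable_coord i) measurable_fst).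
Qed.

Lemma ge0_integral_swapP d (i : 'I_d) (F : 'rV[R]_d * R -> \bar R) :
  measurable_fun setT F -> (forall q, 0 <= F q)%E ->
  (\int[Q d \x lam]_q F (swap i q) = \int[Q d \x lam]_q F q)%E.
Proof.
move=> mF F0; have mFs := measurableT_comp mF (measurable_coord_swap i).
rewrite !fubini_tonelli1//.
exact: ge0_integral_swap.
Qed.

Lemma integral_swapP d (i : 'I_d) (F : 'rV[R]_d * R -> \bar R) :
  measurable_fun setT F ->
  (\int[Q d \x lam]_q F (swap i q) = \int[Q d \x lam]_q F q)%E.
Proof.
move=> mF; rewrite [LHS]integralE [RHS]integralE; congr (_ - _)%E.
- rewrite -[RHS](@ge0_integral_swapP d i (F^\+)%E (measurable_funepos mF) (fun q => funepos_ge0 _ _)).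
  by apply: eq_integral => q _; rewrite !funeposE.
- rewrite -[RHS](@ge0_integral_swapP d i (F^\-)%E (measurable_funeneg mF) (fun q => funeneg_ge0 _ _)).
  by apply: eq_integral => q _; rewrite !funenegE.
Qed.

Lemma integrable_swapP d (i : 'I_d) (F : 'rV[R]_d * R -> \bar R) :
  (Q d \x lam)%E.-integrable setT F -> (Q d \x lam)%E.-integrable setT (F \o swap i).
Proof.
move=> /integrableP[mF iF]; apply/integrableP; split.
  exact: (measurableT_comp mF (measurable_coord_swap i)).
rewrite (ge0_integral_swapP i (F := abse \o F))//; last by move=> q; exact: abse_ge0.
exact: measurableT_comp.
Qed.

End swap.

(** * The part of a function that is constant along a coordinate *)

Section bounded_multipliers.
Context d (T : measurableType d) (R : realType).
Variable mu : {measure set T -> \bar R}.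

Lemma integrable_bounded_mul (f b : T -> R) (M : R) :
  mu.-integrable setT (EFin \o f) -> measurable_fun setT b ->
  (forall x, `|b x| <= M) -> mu.-integrable setT (fun x => (f x * b x)%:E).
Proof.
move=> iF mb bM.
have h : [bounded b x | x in [set: T]].
  exists M; split; first by rewrite num_real.
  by move=> M' MM' x _; apply: le_trans (bM x) (ltW MM').
have := integrableMl measurableT iF mb h.
by apply: eq_integrable => // x _; rewrite /= EFinM.
Qed.

Lemma integrable_bounded (b : T -> R) (M : R) : (mu setT < +oo)%E ->
  measurable_fun setT b -> (forall x, `|b x| <= M) ->
  mu.-integrable setT (EFin \o b).
Proof.
move=> fin mb bM; apply: measurable_bounded_integrable => //.
exists M; split; first by rewrite num_real.
by move=> M' MM' x _; apply: le_trans (bM x) (ltW MM').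
Qed.

End bounded_multipliers.

Section tens_facts.
Variables (R : realType) (d : nat).
Implicit Types (th : 'I_d -> R -> R).

Lemma measurable_tens th : (forall j, measurable_fun setT (th j)) ->
  measurable_fun setT (tens th).
Proof.
move=> mth; apply: measurable_prod => j _.
exact: (measurableT_comp (mth j) (measurable_coord j)).
Qed.

Lemma tens_bounded th (M : R) : (forall j t, `|th j t| <= M) ->
  forall x, `|tens th x| <= M ^+ d.
Proof.
move=> thM x; rewrite /tens normr_prod -[X in M ^+ X]card_ord -prodr_const.
by apply: ler_prod => j _; rewrite normr_ge0 thM.
Qed.

Lemma smooth_compact_bounded (th : R -> R) (e : R) : smooth1 th ->
  (forall t, t \notin `[e, 1 - e] -> th t = 0) -> exists M, forall t, `|th t| <= M.
Proof.
move=> sth th0; have [e1|e1] := leP e (1 - e); last first.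
  exists 0 => t; rewrite th0 ?normr0//; apply/negP; rewrite in_itv/= => /andP[h1 h2].
  by have := le_trans h1 h2; rewrite leNgt e1.
have [|c _ cM] := @EVT_max R (fun t => `|th t|) e (1 - e) e1.
  apply: continuous_subspaceT => t.
  apply: (@continuous_comp _ _ _ th (fun x => `|x|)); first exact: smooth1_continuous.
  exact: norm_continuous.
exists `|th c| => t; have [/cM//|te] := boolP (t \in `[e, 1 - e]).
by rewrite th0// normr0.
Qed.

Lemma tens_smooth_bounded th (e : R) : (forall j, smooth1 (th j)) ->
  (forall j t, t \notin `[e, 1 - e] -> th j t = 0) ->
  exists M, forall x, `|tens th x| <= M.
Proof.
move=> sth th0.
have /choice[M hM] : forall j, exists M, forall t, `|th j t| <= M.
  by move=> j; exact: smooth_compact_bounded (sth j) (th0 j).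
exists ((\sum_j `|M j|) ^+ d); apply: tens_bounded => j t.
rewrite (le_trans (hM j t))// (le_trans (ler_norm _))// (bigD1 j)//= lerDl.
by apply: sumr_ge0 => k _; exact: normr_ge0.
Qed.

Lemma tens_split th i (x : 'rV[R]_d) :
  tens th x = th i (x ord0 i) * \prod_(j < d | j != i) th j (x ord0 j).
Proof. by rewrite /tens (bigD1 i). Qed.

End tens_facts.

Section weak_partial.
Variables (R : realType) (d : nat) (i : 'I_d).
Local Notation "'lam'" := (@unit_leb R).
Local Notation Q := (@unit_cube R d).
Local Notation P := (Q \x lam)%E.
Variables (f g : 'rV[R]_d -> R).
Hypotheses (mf : measurable_fun setT f) (mg : measurable_fun setT g).
Hypotheses (if_ : Q.-integrable setT (EFin \o f)) (ig : Q.-integrable setT (EFin \o g)).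

(** [g] is a weak derivative of [f] in the direction [i], tested on
    tensor products only. The last condition gives the boundedness of
    [tens (tens_derive i th)] directly. *)
Definition weak_partial_tens := forall (th : 'I_d -> R -> R) (e : R), 0 < e ->
  (forall j, smooth1 (th j)) -> (forall j t, t \notin `[e, 1 - e] -> th j t = 0) ->
  (forall j t, t \notin `[e, 1 - e] -> tens_derive i th j t = 0) ->
  (\int[Q]_x (f x * tens (tens_derive i th) x)%:E =
   - (\int[Q]_x (g x * tens th x)%:E))%E.

Hypothesis fg : weak_partial_tens.

(** The integral of [g] on the line through [x] parallel to the [i]-th
    axis, from 0 to [x_i]. *)
Definition line_prim (x : 'rV[R]_d) : R :=
  fine (\int[lam]_t ((t <= x ord0 i)%R%:R * g (upd i t x))%:E)%E.

(** When [g] is the [i]-th partial derivative of [f], this function is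
    constant along the [i]-th coordinate. *)
Definition line_rest (x : 'rV[R]_d) : R := f x - line_prim x.

Lemma integrable_fst (u : 'rV[R]_d -> R) : Q.-integrable setT (EFin \o u) ->
  P.-integrable setT (fun q => (u q.1)%:E).
Proof.
move=> iu; have mu := measurable_int _ iu.
apply/integrable12ltyP; first exact: (measurableT_comp mu measurable_fst).
rewrite [X in (X < _)%E](_ : _ = \int[Q]_x `|(u x)%:E|)%E; last first.
  by apply: eq_integral => x _ /=; exact: integral_unit_leb_cst.
by move/integrableP : iu => [].
Qed.

Lemma integrable_upd (u : 'rV[R]_d -> R) : Q.-integrable setT (EFin \o u) ->
  P.-integrable setT (fun q => (u (upd i q.2 q.1))%:E).
Proof. by move=> iu; exact: (integrable_swapP i (integrable_fst iu)). Qed.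

Let ilinec : P.-integrable setT
  (fun q : 'rV[R]_d * R => ((q.2 <= q.1 ord0 i)%R%:R * g (upd i q.2 q.1))%:E).
Proof.
have mb : measurable_fun setT (fun q : 'rV[R]_d * R => (q.2 <= q.1 ord0 i)%R%:R : R).
  apply: measurable_natr_bool; apply: measurable_fun_ler => //.
  exact: (measurableT_comp (measurable_coord i) measurable_fst).
have := integrable_bounded_mul (integrable_upd ig) mb (M := 1).
rewrite (_ : (fun x => _) = (fun q : 'rV[R]_d * R => ((q.2 <= q.1 ord0 i)%R%:R * g (upd i q.2 q.1))%:E)).
  by apply => q; rewrite ger0_norm// lern1 leq_b1.
by apply/funext => q; rewrite mulrC.
Qed.

Lemma line_prim_ae : {ae Q, forall x, (line_prim x)%:E =
  (\int[lam]_t ((t <= x ord0 i)%R%:R * g (upd i t x))%:E)%E}.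
Proof.
have := integrable_fubini_F ilinec => /(integrable_ae measurableT).
by apply: filterS => x /(_ I) h; rewrite /line_prim fineK.
Qed.

Lemma measurable_line_prim : measurable_fun setT line_prim.
Proof.
have mF : measurable_fun setT (fun x : 'rV[R]_d =>
    \int[lam]_t ((t <= x ord0 i)%R%:R * g (upd i t x))%:E)%E.
  exact: (measurable_int _ (integrable_fubini_F ilinec)).
by apply: measurableT_comp mF; exact: fine_measurable.
Qed.

Lemma integrable_line_prim : Q.-integrable setT (EFin \o line_prim).
Proof.
apply/integrableP; split; first by apply/measurable_EFinP; exact: measurable_line_prim.
have /integrableP[mF] := integrable_fubini_F ilinec; apply: le_lt_trans.
apply: ge0_le_integral => //.
- by apply: measurableT_comp => //; apply/measurable_EFinP; exact: measurable_line_prim.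
- exact: measurableT_comp.
- by move=> x _; rewrite /= /line_prim /fubini_F; case: (integral _ _ _) => //=; rewrite ?normr0 ?leey.
Qed.

Lemma measurable_line_rest : measurable_fun setT line_rest.
Proof. by apply: measurable_funB => //; exact: measurable_line_prim. Qed.

Lemma integrable_line_rest : Q.-integrable setT (EFin \o line_rest).
Proof.
have := integrableB measurableT if_ integrable_line_prim.
by apply: eq_integrable => // x _; rewrite /= EFinB.
Qed.

(** The test function is [tens eta] with [eta_i] replaced by its
    primitive [Th], an admissible factor because [eta_i] has mean zero.
    The weak derivative then equates the integral of [f * tens eta] with that
    of [g] times the product of [- Th (x_i)] and the other factors, where
    [- Th z] is the integral of [eta_i] above [z]. Exchanging [x_i] with the
    variable of that integral leads to the integral of
    [line_prim * tens eta]. *)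
Lemma line_rest_tens (eta : 'I_d -> R -> R) (e : R) : 0 < e ->
  (forall j, smooth1 (eta j)) -> (forall j t, t \notin `[e, 1 - e] -> eta j t = 0) ->
  (\int[lam]_t (eta i t)%:E = 0)%E ->
  (\int[Q]_x (line_rest x * tens eta x)%:E = 0)%E.
Proof.
move=> e0 seta eta0 ieta.
pose Th := primitive (eta i).
pose th j := if j == i then Th else eta j.
have sth j : smooth1 (th j).
  rewrite /th; case: (j == i) => //.
  exact: (@smooth1_primitive R (eta i) e (seta i) (eta0 i)).
have th0 j t : t \notin `[e, 1 - e] -> th j t = 0.
  rewrite /th; case: (j == i) => te; last exact: eta0.
  exact: (@primitive_out R (eta i) e e0 (seta i) (eta0 i) ieta).
have mcont (u : R -> R) : smooth1 u -> measurable_fun setT u.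
  by move=> su; apply: continuous_measurable_fun; exact: smooth1_continuous.
have [Me hMe] := tens_smooth_bounded seta eta0.
have mte : measurable_fun setT (tens eta) by apply: measurable_tens => j; exact: mcont.
have thD : tens_derive i th = eta.
  apply/funext => j; rewrite /tens_derive /th.
  case: eqP => [->|//]; rewrite /Th (derive1_primitive (seta i) (eta0 i))//.
have := fg e0 sth th0; rewrite thD => /(_ eta0) W1.
pose b (x : 'rV[R]_d) := \prod_(j < d | j != i) eta j (x ord0 j).
have bu y x : b (upd i y x) = b x.
  by apply: eq_bigr => j /negbTE ji; rewrite mxE ji.
have mb : measurable_fun setT b.
  rewrite (_ : b = fun x => \prod_(j < d) if j != i then eta j (x ord0 j) else 1).
    apply: measurable_prod => j _; case: (j != i) => //.
    exact: (measurableT_comp (mcont _ (seta j)) (measurable_coord j)).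
  by apply/funext => x; rewrite /b big_mkcond.
(* both sides below are integrals of [G] over [x] and one more variable *)
pose G (q : 'rV[R]_d * R) : R := g q.1 * (b q.1 * ((q.1 ord0 i <= q.2)%R%:R * eta i q.2)).
have mG : measurable_fun setT G.
  apply: measurable_funM; first exact: (measurableT_comp mg measurable_fst).
  apply: measurable_funM; first exact: (measurableT_comp mb measurable_fst).
  apply: measurable_funM; last exact: (measurableT_comp (mcont _ (seta i)) measurable_snd).
  apply: measurable_natr_bool; apply: measurable_fun_ler => //.
  exact: (measurableT_comp (measurable_coord i) measurable_fst).
have [Mi hMi] := smooth_compact_bounded (seta i) (eta0 i).
have [M hM] : exists M, forall x, `|b x| <= M.
  have /choice[N hN] : forall j, exists N, forall t, `|eta j t| <= N.
    by move=> j; exact: smooth_compact_bounded (seta j) (eta0 j).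
  exists (\prod_(j < d | j != i) `|N j|) => x; rewrite /b normr_prod.
  by apply: ler_prod => j _; rewrite normr_ge0 (le_trans (hN j _))// ler_norm.
have iG : P.-integrable setT (EFin \o G).
  apply: (@integrable_bounded_mul _ _ _ P (fun q => g q.1) _ (M * Mi)) => //.
      exact: integrable_fst.
    apply: measurable_funM; first exact: (measurableT_comp mb measurable_fst).
    apply: measurable_funM; last exact: (measurableT_comp (mcont _ (seta i)) measurable_snd).
    apply: measurable_natr_bool; apply: measurable_fun_ler => //.
    exact: (measurableT_comp (measurable_coord i) measurable_fst).
  move=> q; rewrite normrM ler_pM//.
  rewrite normrM -[Mi]mul1r ler_pM// normr_nat lern1; exact: leq_b1.
have teE x : tens eta x = eta i (x ord0 i) * b x by exact: tens_split.
have thE x : tens th x = Th (x ord0 i) * b x.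
  rewrite (tens_split _ i) /th eqxx; congr (_ * _).
  by apply: eq_bigr => j /negbTE ->.
have tailE z : (\int[lam]_y ((z <= y)%R%:R * eta i y)%:E = (- Th z)%:E)%E.
  exact: (@primitive_tail R (eta i) e e0 (seta i) (eta0 i) ieta).
have rhsE : (- (\int[Q]_x (g x * tens th x)%:E) = \int[P]_q (G q)%:E)%E.
  have [Mt hMt] := tens_smooth_bounded sth th0.
  have igt : Q.-integrable setT (fun x => (g x * tens th x)%:E).
    apply: (integrable_bounded_mul ig _ hMt).
    by apply: measurable_tens => j; exact: mcont.
  rewrite -(integral12_prod_meas1 iG).
  transitivity (\int[Q]_x (- (g x * tens th x)%:E))%E.
    by rewrite integralN//; exact: integrable_add_def.
  apply: eq_integral => x _; rewrite /fubini_F /G/=.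
  rewrite thE.
  transitivity (\int[lam]_y ((g x * b x)%:E * ((x ord0 i <= y)%R%:R * eta i y)%:E))%E.
    rewrite integralZl//.
      rewrite tailE -EFinM; congr EFin; ring.
    apply: (@integrable_bounded _ _ _ lam _ Mi).
    - by apply: le_lt_trans (ltry 1); rewrite le_eqVlt; apply/orP; left; apply/eqP; exact: unit_leb_setT.
    - apply: measurable_funM; last exact: mcont.
      by apply: measurable_natr_bool; exact: measurable_fun_ler.
    - move=> y; rewrite normrM -[Mi]mul1r ler_pM// normr_nat lern1; exact: leq_b1.
  by apply: eq_integral => y _; rewrite -EFinM; congr EFin; ring.
have lhsE : (\int[P]_q (G q)%:E = \int[Q]_x (line_prim x * tens eta x)%:E)%E.
  rewrite -(integral_swapP i (F := EFin \o G)); last exact/measurable_EFinP.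
  have iGs := integrable_swapP i iG.
  rewrite -(integral12_prod_meas1 iGs)/=.
  apply: ae_eq_integral => //.
  - exact: (measurable_int _ (integrable_fubini_F iGs)).
  - by apply/measurable_EFinP; apply: measurable_funM => //; exact: measurable_line_prim.
  have := ae_integrable1 ilinec; move: line_prim_ae; apply: filterS2 => x hx ix _.
  rewrite /fubini_F /G /=.
  transitivity (\int[lam]_t ((tens eta x)%:E * ((t <= x ord0 i)%R%:R * g (upd i t x))%:E))%E.
    apply: eq_integral => t _; rewrite -EFinM; congr EFin.
    rewrite bu mxE eqxx teE; ring.
  by rewrite integralZl// -hx -EFinM mulrC.
have iprod (u : 'rV[R]_d -> R) : Q.-integrable setT (EFin \o u) ->
    Q.-integrable setT (fun x => (u x * tens eta x)%:E).
  by move=> iu; exact: integrable_bounded_mul iu mte hMe.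
transitivity ((\int[Q]_x (f x * tens eta x)%:E) - (\int[Q]_x (line_prim x * tens eta x)%:E))%E.
  rewrite -integralB//; [|exact: iprod|exact: iprod integrable_line_prim].
  by apply: eq_integral => x _; rewrite -EFinB /line_rest mulrBl.
rewrite W1 rhsE lhsE subee//.
apply: integrable_fin_num => //; exact: iprod integrable_line_prim.
Qed.

End weak_partial.

(** * Weak partial derivatives control the variation along lines *)

Section open_unit.
Variables (R : realType).
Local Notation "'lam'" := (@unit_leb R).

Lemma unit_leb_open : {ae lam, forall y : R, 0 < y < 1}.
Proof.
pose N : set R := [set 0] `|` [set 1] `|` ~` `[0, 1]%classic.
have mN : measurable N.
  by apply: measurableU; [exact: measurableU|exact: measurableC].
exists N; split => //.
- change (lebesgue_measure (N `&` `[0%R, 1%R]%classic) = 0%E).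
  rewrite (_ : _ `&` _ = [set 0 : R] `|` [set 1]).
    apply/eqP; rewrite -measure_le0.
    have := @measureU2 _ (measurableTypeR R) R lebesgue_measure [set 0 : R] [set 1 : R].
    move=> /(_ (measurable_set1 _) (measurable_set1 _)).
    rewrite [X in (_ <= X + _)%E](lebesgue_measure_set1 0).
    by rewrite [X in (_ <= _ + X)%E](lebesgue_measure_set1 1) adde0.
  apply/seteqP; split => x /=; rewrite in_itv/=.
    by move=> [[[]->|h] h']; [left|right|have := h h'].
  by move=> [|] ->; split; rewrite ?lexx ?ler01//; left; [left|right].
- move=> x /= h; have [->|x0] := eqVneq x 0; first by left; left.
  have [->|x1] := eqVneq x 1; first by left; right.
  right => /=; rewrite in_itv/= => /andP[h0 h1]; apply: h.
  by rewrite !lt_neqAle h0 h1 x1 eq_sym x0.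
Qed.

(** A coordinate function and the exchange of that coordinate with a
    further variable reduce this to the unit interval. *)
Lemma unit_cube_open d :
  {ae @unit_cube R d, forall x : 'rV[R]_d, forall j, 0 < x ord0 j < 1}.
Proof.
apply: filter_forall => j.
pose b (y : R) : bool := ~~ (0 < y < 1).
have mb : measurable_fun setT b.
  by apply: measurable_neg; apply: measurable_and; exact: measurable_fun_ltr.
have b0 : (\int[lam]_y ((b y)%:R : R)%:E = 0)%E.
  transitivity (\int[lam]_y (cst 0%E y : \bar R))%E; last exact: integral0.
  apply: ae_eq_integral => //; first exact: measurable_indicb.
  by move: unit_leb_open; apply: filterS => y h _; rewrite /b h.
have mbj : measurable_fun setT (fun x : 'rV[R]_d => b (x ord0 j)).
  exact: (measurableT_comp mb (measurable_coord j)).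
have h : (\int[@unit_cube R d]_x ((b (x ord0 j))%:R : R)%:E = 0)%E.
  have := @ge0_integral_swap R d j (fun q => ((b q.2)%:R : R)%:E).
  rewrite /=; under eq_integral => x _ do rewrite integral_unit_leb_cst.
  move=> ->//; last first.
    by apply: measurable_indicb; exact: (measurableT_comp mb measurable_snd).
  by apply: integral0_eq.
have := ge0_integral_eq0_ae _ _ h; case => //.
- exact: measurable_indicb.
- move=> A [mA A0 Ab]; exists A; split => // x /= hx; apply: Ab => /= -[] /eqP.
  by rewrite pnatr_eq0 eqb0 negbK.
Qed.

End open_unit.

Section concatenation.
Variables (R : realType) (d : nat).
Local Notation "'lam'" := (@unit_leb R).
Local Notation consR a u := (cons_rV ((a : measurableTypeR R), u)).

Lemma measurable_consP :
  measurable_fun setT (fun q : 'rV[R]_d * R => consR q.2 q.1).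
Proof. exact: measurable_fun_cons. Qed.

Lemma ge0_integral_consP (F : 'rV[R]_d.+1 -> \bar R) :
  measurable_fun setT F -> (forall x, 0 <= F x)%E ->
  (\int[@unit_cube R d.+1]_z F z =
   \int[@unit_cube R d \x lam]_q F (consR q.2 q.1))%E.
Proof.
move=> mF F0; rewrite ge0_integral_unit_cubeS//.
rewrite fubini_tonelli2//.
exact: (measurableT_comp mF measurable_consP).
Qed.

(** The cube of dimension [d + 1] as the product of the cube of dimension
    [d] and the unit interval, the additional variable being listed last
    as in [swap]. *)
Lemma integral_consP (F : 'rV[R]_d.+1 -> \bar R) : measurable_fun setT F ->
  (\int[@unit_cube R d.+1]_z F z =
   \int[@unit_cube R d \x lam]_q F (consR q.2 q.1))%E.
Proof.
move=> mF; rewrite [LHS]integralE [RHS]integralE.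
rewrite !ge0_integral_consP//; last 2 first.
- exact: measurable_funeneg.
- exact: measurable_funepos.
by congr (_ - _)%E; apply: eq_integral => q _; rewrite ?funeposE ?funenegE.
Qed.

End concatenation.

Section weak_partial_line_bound.
Variables (R : realType) (d : nat) (i : 'I_d).
Local Notation "'lam'" := (@unit_leb R).
Local Notation Q := (@unit_cube R d).
Local Notation P := (Q \x lam)%E.
Local Notation consR a u := (cons_rV ((a : measurableTypeR R), u)).
Variables (f g : 'rV[R]_d -> R).
Hypotheses (mf : measurable_fun setT f) (mg : measurable_fun setT g).
Hypotheses (if_ : Q.-integrable setT (EFin \o f)) (ig : Q.-integrable setT (EFin \o g)).
Hypothesis fg : weak_partial_tens i f g.

Let h := line_rest i f g.
Let ih : Q.-integrable setT (EFin \o h).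
Proof. exact: integrable_line_rest. Qed.
Let mh : measurable_fun setT h.
Proof. exact: measurable_line_rest. Qed.

(** The increment of [line_rest] when the [i]-th coordinate of [q.1] is
    replaced by [q.2]. *)
Definition rest_diff (q : 'rV[R]_d * R) : R := h (upd i q.2 q.1) - h q.1.

Lemma integrable_rest_diff : P.-integrable setT (EFin \o rest_diff).
Proof.
have := integrableB measurableT (integrable_upd i ih) (integrable_fst ih).
by apply: eq_integrable => // q _; rewrite /= EFinB.
Qed.

(** Exchanging [x_i] and [y] in the first half of the increment and
    integrating over [y], the left-hand side becomes the integral of
    [h * tens eta], where [eta_i] is the combination
    [m (chi_i) * zeta - m (zeta) * chi_i], [m] being the mean, and
    [eta_j = chi_j] for the other indices. This [eta_i] has mean zero. *)
Lemma rest_diff_tens (chi : 'I_d -> R -> R) (zeta : R -> R) (e : R) : 0 < e ->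
  (forall j, smooth1 (chi j)) -> smooth1 zeta ->
  (forall j t, t \notin `[e, 1 - e] -> chi j t = 0) ->
  (forall t, t \notin `[e, 1 - e] -> zeta t = 0) ->
  (forall j t, `|chi j t| <= 1) -> (forall t, `|zeta t| <= 1) ->
  (\int[P]_q (rest_diff q * (tens chi q.1 * zeta q.2))%:E = 0)%E.
Proof.
move=> e0 schi szeta chi0 zeta0 bchi bzeta.
have mb (u : R -> R) : smooth1 u -> measurable_fun setT u.
  by move=> su; apply: continuous_measurable_fun; exact: smooth1_continuous.
have mchi : measurable_fun setT (tens chi) by apply: measurable_tens => j; exact: mb.
have tchi x : `|tens chi x| <= 1.
  by rewrite -(expr1n _ d); exact: tens_bounded.
pose X (q : 'rV[R]_d * R) := tens chi q.1 * zeta q.2.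
have mX : measurable_fun setT X.
  apply: measurable_funM; first exact: (measurableT_comp mchi measurable_fst).
  exact: (measurableT_comp (mb _ szeta) measurable_snd).
have X1 q : `|X q| <= 1 by rewrite normrM -[1]mulr1 ler_pM ?tchi.
have i1 := integrable_bounded_mul (integrable_upd i ih) mX X1.
have i2 := integrable_bounded_mul (integrable_fst ih) mX X1.
transitivity ((\int[P]_q (h (upd i q.2 q.1) * X q)%:E) - (\int[P]_q (h q.1 * X q)%:E))%E.
  rewrite -integralB//; apply: eq_integral => q _.
  by rewrite -EFinB /rest_diff mulrBl.
rewrite -(integral_swapP i (F := fun q => (h (upd i q.2 q.1) * X q)%:E)); last first.
  exact: measurable_int i1.
have uu (q : 'rV[R]_d * R) : upd i (swap i q).2 (swap i q).1 = q.1.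
  by apply/rowP => j; rewrite !mxE; case: eqP => [->|].
have i3 : P.-integrable setT (fun q => (h q.1 * X (swap i q))%:E).
  apply: (integrable_bounded_mul (integrable_fst ih) _ (M := 1)) => [|q]; last exact: X1.
exact: (measurableT_comp mX (measurable_coord_swap i)).
under eq_integral => q _ do rewrite uu.
rewrite -integralB// -(integral12_prod_meas1 (integrableB measurableT i3 i2)).
pose m (u : R -> R) : R := fine (\int[lam]_t (u t)%:E)%E.
have iu (u : R -> R) : smooth1 u -> (forall t, `|u t| <= 1) -> lam.-integrable setT (EFin \o u).
  move=> su u1; apply: (integrable_bounded (M := 1)) => //; last exact: mb.
  by rewrite [X in (X < _)%E]unit_leb_setT ltry.
have mE u : smooth1 u -> (forall t, `|u t| <= 1) -> (\int[lam]_t (u t)%:E = (m u)%:E)%E.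
  move=> su u1; rewrite /m fineK//; apply: integrable_fin_num => //; exact: iu.
have ichi := iu _ (schi i) (bchi i).
have izeta := iu _ szeta bzeta.
have chiE := mE _ (schi i) (bchi i).
have zetaE := mE _ szeta bzeta.
pose eta j := if j == i then (fun t => m (chi i) * zeta t - m zeta * chi i t) else chi j.
have : (\int[Q]_x (h x * tens eta x)%:E = 0)%E.
  apply: (line_rest_tens mg if_ ig fg e0).
  - move=> j; rewrite /eta; case: (j == i) => // n; apply: CnD; first exact: (CnZ _ (szeta n)).
    rewrite (_ : (fun x => _) = fun x => - m zeta * chi i x); first exact: (CnZ _ (schi i n)).
    by apply/funext => t; rewrite mulNr.
  - by move=> j t te; rewrite /eta; case: (j == i); rewrite ?zeta0 ?chi0// !mulr0 subr0.
  - rewrite /eta eqxx; under eq_integral do rewrite EFinB !EFinM.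
    rewrite integralB//; [|exact: integrableZl|exact: integrableZl].
    by rewrite !integralZl// chiE zetaE -!EFinM -EFinB mulrC subrr.
move=> <-; apply: eq_integral => x _; rewrite /fubini_F /=.
pose B := \prod_(j < d | j != i) chi j (x ord0 j).
rewrite (tens_split eta i) /eta eqxx.
rewrite (_ : \prod_(j < d | j != i) _ = B); last by apply: eq_bigr => j /negbTE ->.
(* the integral over [y] only sees [chi_i] or [zeta] *)
transitivity (\int[lam]_y ((h x * B * zeta (x ord0 i))%:E * (chi i y)%:E -
    (h x * B * chi i (x ord0 i))%:E * (zeta y)%:E))%E.
  apply: eq_integral => y _; rewrite -!EFinM -!EFinB; congr EFin.
  rewrite /X /= (tens_split chi i) (tens_split chi i x) mxE eqxx.
  rewrite (_ : \prod_(j < d | j != i) chi j (upd i y x ord0 j) = B).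
    by rewrite -/B; ring.
  by apply: eq_bigr => j /negbTE ji; rewrite mxE ji.
rewrite integralB//; [|exact: integrableZl|exact: integrableZl].
by rewrite !integralZl// chiE zetaE -!EFinM -EFinB; congr EFin; ring.
Qed.

Lemma rest_diff_cutoff (a b : 'rV[R]_d.+1) k :
  (\int[P]_q (rest_diff q * (tens (fun j => cutoff (a ord0 (lift ord0 j)) (b ord0 (lift ord0 j)) (eps R k)) q.1
    * cutoff (a ord0 ord0) (b ord0 ord0) (eps R k) q.2))%:E = 0)%E.
Proof.
have e0 := eps_gt0 R k.
have bnd a' b' t : `|cutoff a' b' (eps R k) t| <= 1.
  by rewrite ger0_norm ?cutoff_ge0 ?cutoff_le1.
apply: (rest_diff_tens e0) => *; first [exact: smooth1_cutoff|exact: cutoff_out|exact: bnd].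
Qed.

(** The limit of [rest_diff_cutoff] by dominated convergence. *)
Lemma rest_diff_itv (a b : 'rV[R]_d.+1) :
  (\int[P]_q (rest_diff q * (tens (fun j => \1_(itv01 (a ord0 (lift ord0 j)) (b ord0 (lift ord0 j)))) q.1
    * \1_(itv01 (a ord0 ord0) (b ord0 ord0)) q.2))%:E = 0)%E.
Proof.
pose X (k : nat) (q : 'rV[R]_d * R) :=
  tens (fun j => cutoff (a ord0 (lift ord0 j)) (b ord0 (lift ord0 j)) (eps R k)) q.1 *
  cutoff (a ord0 ord0) (b ord0 ord0) (eps R k) q.2.
have mb a' b' k : measurable_fun setT (cutoff a' b' (eps R k)).
  by apply: continuous_measurable_fun; exact/smooth1_continuous/smooth1_cutoff.
have bnd a' b' k t : `|cutoff a' b' (eps R k) t| <= 1.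
  by rewrite ger0_norm ?cutoff_ge0 ?cutoff_le1.
have mX k : measurable_fun setT (X k).
  apply: measurable_funM; last exact: (measurableT_comp (mb _ _ _) measurable_snd).
  apply: measurableT_comp measurable_fst.
  by apply: measurable_tens => j; exact: mb.
have X1 k q : `|X k q| <= 1.
  rewrite normrM -[1]mulr1 ler_pM ?bnd//.
  by rewrite -(expr1n _ d); apply: tens_bounded => j t; exact: bnd.
have irest := integrable_rest_diff.
have := @dominated_cvg _ _ _ P setT measurableT (fun k q => (rest_diff q * X k q)%:E)
  (fun q => (rest_diff q * (tens (fun j => \1_(itv01 (a ord0 (lift ord0 j)) (b ord0 (lift ord0 j)))) q.1
    * \1_(itv01 (a ord0 ord0) (b ord0 ord0)) q.2))%:E) (fun q => `|rest_diff q|%:E).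
have zero k : (\int[P]_q (rest_diff q * X k q)%:E = 0)%E by exact: rest_diff_cutoff.
under eq_cvg => k do rewrite zero.
move=> hc; apply/esym; apply: (cvg_unique _ (@cvg_cst _ _ _ _ _) (hc _ _ _ _ _)) => //.
- move=> k; apply/measurable_EFinP; apply: measurable_funM => //.
  by apply/measurable_EFinP; exact: measurable_int irest.
- move=> q _; apply: cvg_EFin; first by near=> k.
  apply: cvgM; first exact: cvg_cst.
  apply: cvgM; last exact: cutoff_cvg.
  apply: (@cvg_big R _ *%R 1 xpredT (@mul_continuous R)) => j _.
  exact: cutoff_cvg.
- exact: integrable_abse irest.
- move=> k q _; rewrite lee_fin normrM -[leRHS]mulr1 ler_wpM2l//.
Unshelve. all: by end_near. Qed.

Definition unit_obox : set 'rV[R]_d.+1 := obox 0 (const_mx 1).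

Lemma unit_oboxE (y : R) (x : 'rV[R]_d) :
  unit_obox (consR y x) <-> 0 < y < 1 /\ forall j, 0 < x ord0 j < 1.
Proof.
split=> [H|[y01 x01] j].
  split; first by have := H ord0; rewrite cons_rV0 !mxE.
  by move=> j; have := H (lift ord0 j); rewrite cons_rVS !mxE.
by have [k ->|->] := unliftP ord0 j; rewrite ?cons_rV0 ?cons_rVS !mxE.
Qed.

(** The tensor product of the limit indicators is, in dimension [d + 1],
    the indicator of a box intersected with the open unit cube. *)
Lemma tens_itv01 (a b : 'rV[R]_d.+1) (q : 'rV[R]_d * R) :
  tens (fun j => \1_(itv01 (a ord0 (lift ord0 j)) (b ord0 (lift ord0 j)))) q.1
    * \1_(itv01 (a ord0 ord0) (b ord0 ord0)) q.2 =
  \1_unit_obox (consR q.2 q.1) * \1_(obox a b) (consR q.2 q.1) :> R.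
Proof.
rewrite /tens; under eq_bigr do rewrite indicE.
rewrite !indicE.
have prodE (c : pred 'I_d) : \prod_(j < d) (c j)%:R = [forall j, c j]%:R :> R.
  have [/forallP hc|/forallPn[j /negbTE hj]] := boolP [forall j, c j].
    by rewrite big1// => j _; rewrite hc.
  by rewrite (bigD1 j)//= hj mul0r.
rewrite prodE -!natrM !mulnb; congr (_%:R); congr nat_of_bool.
apply/andP/andP; rewrite !inE.
  move=> [/forallP h1 /andP[h2 h3]]; split.
    apply/unit_oboxE; split => // j; have := h1 j.
    by rewrite inE => /andP[].
  move=> j; have [k ->|->] := unliftP ord0 j; last by rewrite cons_rV0.
  by rewrite cons_rVS; have := h1 k; rewrite inE => /andP[].
move=> [/unit_oboxE[h2 h1] h3]; split.
  apply/forallP => j; rewrite inE; apply/andP; split => //.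
  by have := h3 (lift ord0 j); rewrite cons_rVS.
by apply/andP; split => //; have := h3 ord0; rewrite cons_rV0.
Qed.

Let F (z : 'rV[R]_d.+1) : R :=
  rest_diff ((uncons_rV z).2, (uncons_rV z).1) * \1_unit_obox z.

Let Fcons (q : 'rV[R]_d * R) : F (consR q.2 q.1) = rest_diff q * \1_unit_obox (consR q.2 q.1).
Proof. by case: q => x y; rewrite /F cons_rVK. Qed.

Let mrest : measurable_fun setT rest_diff.
Proof. by apply/measurable_EFinP; exact: measurable_int integrable_rest_diff. Qed.

Let mF : measurable_fun setT F.
Proof.
apply: measurable_funM; last by apply: measurable_indic; exact: measurable_obox.
apply: (measurableT_comp mrest); apply: measurable_fun_pair; last exact: measurable_coord.
apply: measurable_fun_rV_R => j; under eq_fun do rewrite mxE.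
exact: measurable_coord.
Qed.

Let indic1 T (A : set T) x : `|\1_A x : R| <= 1.
Proof. by rewrite indicE normr_nat lern1 leq_b1. Qed.

Let iF : (@unit_cube R d.+1).-integrable setT (EFin \o F).
Proof.
apply/integrableP; split; first exact/measurable_EFinP.
rewrite ge0_integral_consP//; last first.
  by apply: measurableT_comp => //; exact/measurable_EFinP.
have /integrableP[m1] := integrable_rest_diff; apply: le_lt_trans.
apply: ge0_le_integral => //.
- have mF' : measurable_fun setT (fun z => `|(EFin \o F) z|)%E.
    by apply: measurableT_comp => //; exact/measurable_EFinP.
  exact: (measurableT_comp mF' (@measurable_consP R d)).
- exact: measurableT_comp.
- by move=> q _; rewrite lee_fin Fcons normrM -[leRHS]mulr1 ler_wpM2l.
Qed.

(** The increment, cut off outside of the open unit cube, has integral zero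
    over every open box of dimension [d + 1]. *)
Lemma rest_diff_ae : {ae Q, forall x : 'rV[R]_d, {ae lam, forall y : R,
  h (upd i y x) = h x}}.
Proof.
have F0 : {ae @unit_cube R d.+1, forall z, (EFin \o F) z = 0%E}.
  apply: box_ae_eq0 => // a b; rewrite integral_mkcond.
  have mb := measurable_obox a b.
  rewrite integral_consP; last first.
    by apply/(measurable_restrictT _ _).1 => //; apply: measurable_funTS; exact/measurable_EFinP.
  rewrite -(rest_diff_itv a b); apply: eq_integral => q _.
  rewrite tens_itv01 patchE /= Fcons indicE [X in _ = (_ * (_ * X))%:E]indicE.
  by case: ifPn => _; rewrite ?mulr1// !mulr0.
have Fi : (\int[@unit_cube R d.+1]_z `|(EFin \o F) z| = 0)%E.
  transitivity (\int[@unit_cube R d.+1]_z (cst 0%E z : \bar R))%E; last exact: integral0.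
  apply: ae_eq_integral => //.
    by apply: measurableT_comp => //; exact/measurable_EFinP.
  by move: F0; apply: filterS => z -> _; rewrite abse0.
have mFc : measurable_fun setT (fun q : 'rV[R]_d * R => `|(EFin \o F) (consR q.2 q.1)|%E).
  apply: measurableT_comp => //; apply/measurable_EFinP.
  exact: (measurableT_comp mF (@measurable_consP R d)).
move: Fi; rewrite ge0_integral_consP//; last first.
  by apply: measurableT_comp => //; exact/measurable_EFinP.
rewrite fubini_tonelli1//= => /ge0_integral_eq0_ae Fx.
have {}Fx : {ae Q, forall x : 'rV[R]_d, (\int[lam]_y `|F (consR y x)|%:E)%E = 0%E}.
  apply: Fx => [|x]; last by apply: integral_ge0.
  exact: (@measurable_fun_integral_r _ _ 'rV[R]_d R R lam (fun x y => `|F (consR y x)|%:E)).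
move: (unit_cube_open R d) Fx; apply: filterS2 => x x01 /ge0_integral_eq0_ae Fy.
have {}Fy : {ae lam, forall y : R, `|F (consR y x)|%:E = 0%E}.
  by apply: Fy => // ; exact: (measurableT_comp mFc (measurable_pair1 x)).
move: (unit_leb_open R) Fy; apply: filterS2 => y y01 [] /eqP.
rewrite normr_eq0 (Fcons (x, y)) /= indicE mem_set; last exact/unit_oboxE.
by rewrite mulr1 subr_eq0 => /eqP.
Qed.

(** For almost all [x] the section of [g] through [x] is integrable, so that
    the increments of [line_prim] on this line are integrals of [g] over
    segments; by [rest_diff_ae] they are also the increments of [f]. *)
Lemma weak_partial_line_bound : line_bound i f g.
Proof.
rewrite /line_bound.
transitivity (\int[Q]_x (cst 0%E x : \bar R))%E; last exact: integral0.
apply: ae_eq_integral => //.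
  apply: measurable_fun_integral_r; last by move=> x y; rewrite lee_fin.
  exact: measurable_line_bad.
have := ae_integrable1 (integrable_upd i ig); move: rest_diff_ae.
apply: filterS2 => x hx ix _.
transitivity (\int[lam]_y (cst 0%E y : \bar R))%E; last exact: integral0.
apply: ae_eq_integral => //.
  exact: (measurableT_comp (measurable_line_bad i mf mg) (measurable_pair1 x)).
have ib (b : R -> bool) : measurable_fun setT b ->
    lam.-integrable setT (fun t => ((b t)%:R * g (upd i t x))%:E).
  move=> mb; apply: eq_integrable (integrable_bounded_mul ix (measurable_natr_bool mb) (M := 1) _) => //.
    by move=> t _; rewrite /= mulrC.
  by move=> t; rewrite normr_nat lern1 leq_b1.
have mle (z : R) : measurable_fun setT (fun t : R => t <= z)%R by exact: measurable_fun_ler.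
have primE y : (line_prim i g (upd i y x))%:E =
    (\int[lam]_t ((t <= y)%R%:R * g (upd i t x))%:E)%E.
  rewrite /line_prim mxE eqxx.
  under eq_integral => t _.
    rewrite (_ : upd i t (upd i y x) = upd i t x); last first.
      by apply/rowP => j; rewrite !mxE; case: eqP.
    over.
  by rewrite fineK//; apply: integrable_fin_num => //; exact: ib.
have upd_id : upd i (x ord0 i) x = x.
  by apply/rowP => j; rewrite !mxE; case: eqP => [->|].
move: hx; apply: filterS => y hxy _.
suff -> : line_good i f g x y by [].
rewrite /line_good.
have -> : f (upd i y x) - f x = line_prim i g (upd i y x) - line_prim i g x.
  by move: hxy; rewrite /h /line_rest; lra.
rewrite -{2}upd_id -abse_EFin EFinB !primE -integralB//; [|exact: ib|exact: ib].
have i1 := integrableB measurableT (ib _ (mle y)) (ib _ (mle (x ord0 i))).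
apply: le_trans (le_abse_integral _ measurableT (measurable_int _ i1)) _.
have mx : measurable_fun setT (fun t => g (upd i t x)).
  apply: (measurableT_comp mg); exact: measurable_fun_upd.
apply: ge0_le_integral => //.
- apply: measurableT_comp => //; exact: measurable_int i1.
- apply/measurable_EFinP; apply: measurable_funM; last exact: measurableT_comp.
  apply: measurable_natr_bool; apply: measurable_and; exact: measurable_fun_ler.
move=> t _; rewrite /= -mulrBl lee_fin normrM ler_wpM2r//.
rewrite /between ge_min le_max.
have [h1|h1] := leP t y; have [h2|h2] := leP t (x ord0 i); rewrite ?subrr ?normr0 ?ler0n//.
- by rewrite (ltW h2) /= subr0 normr1.
- by rewrite (ltW h1) orbT /= sub0r normrN normr1.
Qed.

End weak_partial_line_bound.

(** * Kantorovich operators and the mean deviation *)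

Section kantorovich_deviation.
Variables (R : realType) (n r : nat).
Local Notation consR a u := (cons_rV ((a : measurableTypeR R), u)).
Local Notation "'lam'" := (@unit_leb R).
Local Notation "'Q' d" := (@unit_cube R d) (at level 10, d at level 9).

Definition cell_point d (k : 'I_d -> nat) (u : 'rV[R]_d) : 'rV[R]_d :=
  \row_i (((k i)%:R + u ord0 i) / n.+1%:R).

(** The density of [cell_point k u] when [u] is uniform on the cube. *)
Definition cell_density d (k : 'I_d -> nat) (y : 'rV[R]_d) : R :=
  \prod_(i < d) (n.+1%:R * \1_(cell n (k i)) (y ord0 i)).

Lemma measurable_cell_point d (k : 'I_d -> nat) :
  measurable_fun setT (cell_point k).
Proof.
apply: measurable_fun_rV_R => i; under eq_fun do rewrite mxE.
apply: measurable_funM => //; apply: measurable_funD => //.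
exact: measurable_coord.
Qed.

Lemma cell_density_ge0 d (k : 'I_d -> nat) y : 0 <= cell_density k y.
Proof. by apply: prodr_ge0 => i _; rewrite mulr_ge0// indicE. Qed.

Lemma measurable_cell_density d (k : 'I_d -> nat) :
  measurable_fun setT (cell_density k).
Proof.
apply: measurable_prod => i _; apply: measurable_funM => //.
apply: (measurableT_comp _ (measurable_coord i)).
by apply: measurable_indic; exact: measurable_cell.
Qed.

(** [ge0_integral_cell] in each coordinate. *)
Lemma ge0_integral_cell_point d (k : 'I_d -> nat) (F : 'rV[R]_d -> \bar R) :
  (forall i, (k i <= n)%N) -> measurable_fun setT F -> (forall x, 0 <= F x)%E ->
  (\int[Q d]_u F (cell_point k u) = \int[Q d]_y ((cell_density k y)%:E * F y))%E.
Proof.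
elim: d k F => [|d IH] k F kn mF F0.
  by apply: eq_integral => u _; rewrite /cell_density big_ord0 mul1e; congr F; apply/rowP => -[].
pose k' (i : 'I_d) := k (lift ord0 i).
have mFp : measurable_fun setT (fun u => F (cell_point k u)).
  exact: (measurableT_comp mF (measurable_cell_point k)).
have mFd : measurable_fun setT (fun y => (cell_density k y)%:E * F y)%E.
  by apply: emeasurable_funM => //; apply/measurable_EFinP; exact: measurable_cell_density.
have dF0 d' (k0 : 'I_d' -> nat) y z : (0 <= z -> 0 <= (cell_density k0 y)%:E * z)%E.
  by move=> z0; rewrite mule_ge0// lee_fin cell_density_ge0.
rewrite !ge0_integral_unit_cubeS//; last by move=> y; exact: dF0.
have mFc (b : R) : measurable_fun setT (fun v => F (consR b v)).
  by apply: (measurableT_comp mF); exact: measurable_fun_cons.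
pose G (b : R) := (\int[Q d]_v ((cell_density k' v)%:E * F (consR b v)))%E.
have mG : measurable_fun setT G.
  apply: measurable_fun_integral_r; last by move=> x y; exact: dF0.
  apply: emeasurable_funM.
    apply/measurable_EFinP; exact: (measurableT_comp (measurable_cell_density k') measurable_snd).
  exact: (measurableT_comp mF (measurable_fun_cons measurable_fst measurable_snd)).
transitivity (\int[lam]_a G (((k ord0)%:R + a) / n.+1%:R)%R)%E.
  apply: eq_integral => a _; rewrite /G -IH//; last by move=> i; exact: kn.
  apply: eq_integral => u _; congr F; apply/rowP => i; rewrite mxE.
  by have [j ->|->] := unliftP ord0 i; rewrite ?cons_rV0 ?cons_rVS// mxE.
rewrite (ge0_integral_cell (kn ord0) mG); last by move=> b; apply: integral_ge0 => v _; exact: dF0.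
apply: eq_integral => a _; rewrite /G -ge0_integralZl//; last 2 first.
- apply: emeasurable_funM => //; apply/measurable_EFinP; exact: measurable_cell_density.
- by move=> v _; exact: dF0.
apply: eq_integral => v _; rewrite muleA -EFinM; congr (_%:E * _)%E.
rewrite /cell_density big_ord_recl cons_rV0; congr (_ * _).
by apply: eq_bigr => i _; rewrite cons_rVS.
Qed.

Lemma stancu_prod_ge0 d (k : {ffun 'I_d -> 'I_n.+1}) (x : 'rV[R]_d) :
  cube x -> 0 <= stancu_prod k r x.
Proof. by move=> x01; apply: prodr_ge0 => i _; exact: stancu_ge0. Qed.

Lemma measurable_stancu_prod d (k : {ffun 'I_d -> 'I_n.+1}) :
  measurable_fun setT (@stancu_prod R d n k r).
Proof.
apply: measurable_prod => i _.
exact: (measurableT_comp (@measurable_stancu R n (k i) r) (measurable_coord i)).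
Qed.

(** The product of sums over cells is a sum over multi-indices of
    products. *)
Lemma kern_cells d (x y : 'rV[R]_d) : cube x ->
  kern n r x y = \sum_(k : {ffun 'I_d -> 'I_n.+1}) stancu_prod k r x * cell_density (fun i => k i) y.
Proof.
move=> x01; rewrite /kern /kern1.
under eq_bigr => i _.
  rewrite indicE mem_set ?mul1r; last by rewrite /= in_itv /=; exact: x01.
  over.
by rewrite bigA_distr_bigA; apply: eq_bigr => k _; rewrite -big_split.
Qed.

Hypothesis rn : (2 * r < n)%N.

Lemma sum_stancu_prod d (x : 'rV[R]_d) :
  \sum_(k : {ffun 'I_d -> 'I_n.+1}) stancu_prod k r x = 1.
Proof.
rewrite /stancu_prod -(bigA_distr_bigA (fun (i : 'I_d) (k : 'I_n.+1) => stancu n k r (x ord0 i))).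
by rewrite big1// => i _; rewrite sum_stancu1.
Qed.

Lemma integrable_cell_point d (k : 'I_d -> nat) (f : 'rV[R]_d -> R) :
  (forall i, (k i <= n)%N) -> (Q d).-integrable setT (EFin \o f) ->
  (Q d).-integrable setT (fun u => (f (cell_point k u))%:E).
Proof.
move=> kn if_; have mf := measurable_int _ if_.
apply/integrableP; split; first exact: (measurableT_comp mf (measurable_cell_point k)).
rewrite (ge0_integral_cell_point (F := fun y => `|f y|%:E))//; last first.
  by apply/measurable_EFinP; apply: measurableT_comp => //; exact/measurable_EFinP.
have dM y : `|cell_density k y| <= n.+1%:R ^+ d.
  rewrite /cell_density normr_prod -[X in _ ^+ X]card_ord -prodr_const.
  apply: ler_prod => i _; rewrite normr_ge0 normrM normr_nat.
  by rewrite -[leRHS]mulr1 ler_wpM2l// indicE normr_nat lern1 leq_b1.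
have /integrableP[_] := integrable_bounded_mul if_ (measurable_cell_density k) dM.
congr (_ < _)%E; apply: eq_integral => y _.
by rewrite /= normrM EFinM muleC (ger0_norm (cell_density_ge0 k y)).
Qed.

(** The weights sum to 1, so that the error is a weighted sum of means of
    [f - f x]; the triangle inequality and the change of variables of
    [ge0_integral_cell_point] recombine the absolute values into the kernel. *)
Lemma kantorovich_edev d (f : 'rV[R]_d -> R) (x : 'rV[R]_d) :
  (Q d).-integrable setT (EFin \o f) -> cube x ->
  (`|kantorovich n r f x - f x|%:E <= edev n r f x)%E.
Proof.
move=> if_ x01; have /measurable_EFinP mf := measurable_int _ if_.
have kn (k : {ffun 'I_d -> 'I_n.+1}) i : (k i <= n)%N by rewrite -ltnS.
pose I (k : {ffun 'I_d -> 'I_n.+1}) := fine (\int[Q d]_u (f (cell_point (fun i => k i) u))%:E)%E.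
have ick (k : {ffun 'I_d -> 'I_n.+1}) := integrable_cell_point (kn k) if_.
have IE (k : {ffun 'I_d -> 'I_n.+1}) : (\int[Q d]_u (f (cell_point (fun i => k i) u))%:E = (I k)%:E)%E.
  by rewrite /I fineK//; exact: integrable_fin_num.
have KE : kantorovich n r f x - f x = \sum_(k : {ffun 'I_d -> 'I_n.+1}) stancu_prod k r x * (I k - f x).
  under [RHS]eq_bigr do rewrite mulrBr.
  rewrite big_split /= sumrN -mulr_suml sum_stancu_prod mul1r; congr (_ - _).
  apply: eq_bigr => k _; congr (_ * _).
  by rewrite /I integral_unit_cube//; exact: measurable_int (ick k).
have ifx (k : {ffun 'I_d -> 'I_n.+1}) : (Q d).-integrable setT (fun u => (f (cell_point (fun i => k i) u) - f x)%:E).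
  have := integrableB measurableT (ick k) (finite_measure_integrable_cst (Q d) (f x) measurableT).
  by apply: eq_integrable => // u _; rewrite /= EFinB.
have Ik (k : {ffun 'I_d -> 'I_n.+1}) : (`|I k - f x|%:E <= \int[Q d]_u `|f (cell_point (fun i => k i) u) - f x|%:E)%E.
  have -> : (`|I k - f x|%:E = `|\int[Q d]_u (f (cell_point (fun i => k i) u) - f x)%:E|)%E.
    rewrite -abse_EFin EFinB -IE; congr abse.
    under [RHS]eq_integral do rewrite EFinB.
    rewrite integralB//; last exact: finite_measure_integrable_cst.
    by rewrite integral_unit_cube_cst.
  exact: le_abse_integral measurableT (measurable_int _ (ifx k)).
have mdev : measurable_fun setT (fun y => `|f y - f x|%:E).
  by apply/measurable_EFinP; apply: measurableT_comp => //; exact: measurable_funB.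
have mden (k : 'I_d -> nat) : measurable_fun setT (fun y => (cell_density k y)%:E * `|f y - f x|%:E)%E.
  by apply: emeasurable_funM => //; apply/measurable_EFinP; exact: measurable_cell_density.
have den0 (k : 'I_d -> nat) y : (0 <= (cell_density k y)%:E * `|f y - f x|%:E)%E.
  by rewrite mule_ge0// lee_fin cell_density_ge0.
apply: (@le_trans _ _ (\sum_(k : {ffun 'I_d -> 'I_n.+1}) (stancu_prod k r x)%:E *
   \int[Q d]_u `|f (cell_point (fun i => k i) u) - f x|%:E)%E).
  rewrite KE; apply: (@le_trans _ _ (\sum_(k : {ffun 'I_d -> 'I_n.+1}) `|stancu_prod k r x * (I k - f x)|)%:E).
    by rewrite lee_fin; exact: ler_norm_sum.
  rewrite -sumEFin; apply: lee_sum => k _.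
  have w0 := stancu_prod_ge0 k x01.
  by rewrite normrM (ger0_norm w0) EFinM; apply: lee_wpmul2l; rewrite ?lee_fin.
rewrite le_eqVlt; apply/orP; left; apply/eqP.
under eq_bigr => k _.
  rewrite (ge0_integral_cell_point (F := fun y => `|f y - f x|%:E))//.
  rewrite -ge0_integralZl//; last by rewrite lee_fin stancu_prod_ge0.
  over.
rewrite -ge0_integral_sum//; last 2 first.
- by move=> k; exact: measurable_funeM.
- by move=> k y _; rewrite mule_ge0// lee_fin stancu_prod_ge0.
apply: eq_integral => y _; rewrite kern_cells// mulr_suml -sumEFin.
by apply: eq_bigr => k _; rewrite !EFinM muleA.
Qed.

Lemma measurable_kantorovich d (f : 'rV[R]_d -> R) :
  measurable_fun setT (kantorovich n r f).
Proof.
apply: measurable_sum => k; apply: measurable_funM => //.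
exact: measurable_stancu_prod.
Qed.

End kantorovich_deviation.

(** * The error estimate *)

Section unit_multi_index.
Variables (R : realType) (d : nat).
Local Notation Q := (@unit_cube R d).

Definition unit_mi (i : 'I_d) : {ffun 'I_d -> 'I_2} := [ffun j => inord (j == i)].

Lemma unit_miE i j : mi_of_binary (unit_mi i) j = (j == i).
Proof. by rewrite !ffunE inordK// ltnS leq_b1. Qed.

Lemma unit_mi_inj : injective unit_mi.
Proof.
move=> i j ij; have := unit_miE i i; rewrite ij unit_miE eqxx.
by case: eqP.
Qed.

Lemma mi_length_unit i : mi_length (mi_of_binary (unit_mi i)) = 1%N.
Proof.
rewrite /mi_length (bigD1 i)//= unit_miE eqxx big1// => j /negbTE ji.
by rewrite unit_miE ji.
Qed.

Lemma partials_unit i (phi : 'rV[R]_d -> R) :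
  partials (mi_of_binary (unit_mi i)) phi = partial i phi.
Proof.
rewrite /partials.
have H (s : seq 'I_d) : uniq s ->
    foldr (fun j => iter (mi_of_binary (unit_mi i) j) (partial j)) phi s =
    if i \in s then partial i phi else phi.
  elim: s => //= j s IH /andP[js us]; rewrite IH// unit_miE in_cons eq_sym.
  by case: eqP js => [->|] //= /negbTE ->.
by rewrite H ?enum_uniq// mem_enum.
Qed.

Lemma weak_partial_tens_unit i (f g : 'rV[R]_d -> R) :
  Q.-integrable setT (EFin \o f) -> Q.-integrable setT (EFin \o g) ->
  is_weak_derivative (mi_of_binary (unit_mi i)) f g -> weak_partial_tens i f g.
Proof.
move=> if_ ig fg th e e0 sth th0 dth0.
have sdth := smooth1_tens_derive i sth.
have RE u (v : 'I_d -> R -> R) : Q.-integrable setT (EFin \o u) ->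
    (forall j, smooth1 (v j)) -> (forall j t, t \notin `[e, 1 - e] -> v j t = 0) ->
    (\int[Q]_x (u x * tens v x)%:E =
     (\int[lebesgue_rV R d]_(x in cube) (u x * tens v x))%:E)%E.
  move=> iu sv v0; have [M hM] := tens_smooth_bounded sv v0.
  have mv : measurable_fun setT (tens v).
    apply: measurable_tens => j.
    by apply: continuous_measurable_fun; exact: smooth1_continuous.
  have iuv := integrable_bounded_mul iu mv hM.
  rewrite -[LHS]fineK; last exact: integrable_fin_num.
  by rewrite /Rintegral integral_unit_cube//; exact: measurable_int iuv.
have := fg _ (test_function_tens e0 sth th0).
rewrite partials_unit partial_tens// mi_length_unit expr1 mulN1r.
by rewrite !RE// => ->.
Qed.

End unit_multi_index.

Section Lp_bounds.
Context dT (T : measurableType dT) (R : realType) (mu : {measure set T -> \bar R}).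

(** Each integral is the [p]-th power of a norm, which is at most the
    [p]-th power of the sum of the norms. *)
Lemma sum_integral_poweR_le d (g : 'I_d -> T -> R) (p : R) : 1 <= p ->
  (\sum_(i < d) \int[mu]_x (`|g i x|%:E `^ p) <=
   d%:R%:E * (\sum_(i < d) 'N[mu]_p%:E[EFin \o g i]) `^ p)%E.
Proof.
move=> p1; have p0 : 0 < p by apply: lt_le_trans p1.
set S := (\sum_(i < d) 'N[mu]_p%:E[EFin \o g i])%E.
have S0 : (0 <= S `^ p)%E by exact: poweR_ge0.
have -> : (d%:R%:E * S `^ p = \sum_(i < d) S `^ p)%E.
  rewrite big_const card_ord; elim: (d) => [|k IH] /=; first by rewrite mul0e.
  by rewrite -IH -natr1 addrC EFinD ge0_muleDl ?lee_fin// mul1e.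
apply: lee_sum => i _.
have -> : (\int[mu]_x (`|g i x|%:E `^ p) = 'N[mu]_p%:E[EFin \o g i] `^ p)%E.
  by rewrite poweR_Lnorm ?gt_eqF.
apply: ge0_ler_poweR; [exact: ltW|exact: Lnorm_ge0|].
by rewrite /S (bigD1 i)//= leeDl//; apply: sume_ge0 => j _; exact: Lnorm_ge0.
Qed.

End Lp_bounds.

Section kantorovich_Lp.
Variables (R : realType) (d n r : nat).
Hypothesis rn : (2 * r < n)%N.
Local Notation Q := (@unit_cube R d).

Lemma kantorovich_power_bound (f : 'rV[R]_d -> R) (g : 'I_d -> 'rV[R]_d -> R) (p : R) :
  1 <= p -> measurable_fun setT f -> (forall i, measurable_fun setT (g i)) ->
  Q.-integrable setT (EFin \o f) -> (forall i, line_bound i f (g i)) ->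
  (\int[Q]_x (`|kantorovich n r f x - f x|%:E `^ p) <=
   (dev_const p d * mesh R n r `^ p)%:E * \sum_(i < d) \int[Q]_x (`|g i x|%:E `^ p))%E.
Proof.
move=> p1 mf mg if_ lb; have p0 : 0 <= p by apply: le_trans p1.
apply: le_trans (edev_power_bound rn p1 mf mg lb).
apply: ae_ge0_le_integral => //.
- by move=> x _; exact: poweR_ge0.
- apply: measurable_fun_poweR.
  apply/measurable_EFinP; apply: measurableT_comp => //.
  apply: measurable_funB => //; exact: measurable_kantorovich.
- by move=> x _; exact: poweR_ge0.
- apply: measurable_fun_poweR.
  exact: measurable_edev.
move: (unit_cube_open R d); apply: filterS => x x01 _.
apply: ge0_ler_poweR => //; apply: kantorovich_edev => // i.
by have /andP[/ltW -> /ltW ->] := x01 i.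
Qed.

Lemma kantorovich_norm_bound (f : 'rV[R]_d -> R) (g : 'I_d -> 'rV[R]_d -> R) (p : R) :
  1 <= p -> measurable_fun setT f -> (forall i, measurable_fun setT (g i)) ->
  Q.-integrable setT (EFin \o f) -> (forall i, line_bound i f (g i)) ->
  ('N[Q]_p%:E[EFin \o (kantorovich n r f \- f)%R] <=
   ((dev_const p d * d%:R) `^ p^-1 * mesh R n r)%:E * \sum_(i < d) 'N[Q]_p%:E[EFin \o g i])%E.
Proof.
move=> p1 mf mg if_ lb; have p0 : 0 < p by apply: lt_le_trans p1.
have m0 := mesh_gt0 R n r.
set S := (\sum_(i < d) 'N[Q]_p%:E[EFin \o g i])%E.
have S0 : (0 <= S)%E by apply: sume_ge0 => i _; exact: Lnorm_ge0.
have D0 := dev_const_ge0 p d.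
have C0 : 0 <= dev_const p d * mesh R n r `^ p by rewrite mulr_ge0// powR_ge0.
have h := le_trans (kantorovich_power_bound p1 mf mg if_ lb)
  (lee_wpmul2l (C0 : (0 <= _%:E)%E) (sum_integral_poweR_le Q g p1)).
rewrite unlock.
apply: le_trans (ge0_ler_poweR _ (integral_ge0 _ _) h) _.
- by rewrite invr_ge0 ltW.
- by move=> x _; exact: poweR_ge0.
rewrite muleA -EFinM mulrAC poweRM//; last exact: poweR_ge0.
  rewrite -poweRrM mulfV ?gt_eqF// poweRe1// poweR_EFin.
  rewrite (powRM _ (mulr_ge0 D0 (ler0n _ d)) (powR_ge0 _ _)) -powRrM mulfV ?gt_eqF// powRr1//.
  exact: ltW.
by rewrite lee_fin mulr_ge0 ?mulr_ge0 ?powR_ge0.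
Qed.

End kantorovich_Lp.

(** Since [d >= 1], the exponent [1 / (2 d)] is at most [1 / 2]. *)
Lemma mesh_le (R : realType) (d n r : nat) : (0 < d)%N ->
  mesh R n r <= 2 * r.+1%:R * (n.+1%:R `^ ((2 * d)%:R^-1))^-1.
Proof.
move=> d0; rewrite /mesh; apply: ler_wpM2l; first by rewrite mulr_ge0.
rewrite lef_pV2 ?posrE ?sqrtr_gt0 ?powR_gt0//.
rewrite -powR12_sqrt//; apply: ler_powR; first by rewrite ler1n.
by rewrite lef_pV2 ?posrE ?ltr0n ?muln_gt0// ler_nat; lia.
Qed.

(** The unit multi-indices are distinct and have length one. *)
Lemma sum_unit_mi_le (R : realType) (d : nat) (X : {ffun 'I_d -> 'I_2} -> \bar R) :
  (forall a, 0 <= X a)%E ->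
  (\sum_(i < d) X (unit_mi i) <=
   \sum_(a : {ffun 'I_d -> 'I_2} | (1 <= mi_length (mi_of_binary a))%N) X a)%E.
Proof.
move=> X0.
have -> : (\sum_(i < d) X (unit_mi i) = \sum_(a in (@unit_mi d @: 'I_d)%SET) X a)%E.
  by rewrite (big_imset X (in2W (@unit_mi_inj d))).
apply: lee_sum_nneg_subset => // a /imsetP[i _ ->].
by rewrite unfold_in /= mi_length_unit.
Qed.

Theorem theorem4p2 (R : realType) (d r : nat) (p : R)
    (d_gt0 : (0 < d)%N) (p_ge1 : 1 <= p) :
  exists2 C : R, 0 < C &
    forall (f : 'rV[R]_d -> R) (Df : multi_index d -> 'rV[R]_d -> R),
      f \in Lfun lebesgue_cube p%:E ->
      (forall a : {ffun 'I_d -> 'I_2}, (1 <= mi_length (mi_of_binary a))%N ->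
        Df (mi_of_binary a) \in Lfun lebesgue_cube p%:E /\
        is_weak_derivative (mi_of_binary a) f (Df (mi_of_binary a))) ->
      forall n : nat, (2 * r < n)%N ->
        ('N[lebesgue_cube]_(p%:E)[EFin \o (kantorovich n r f \- f)%R] <=
         (2 * C)%:E *
         \sum_(a : {ffun 'I_d -> 'I_2} | (1 <= mi_length (mi_of_binary a))%N)
           ((n.+1%:R `^ ((2 * d)%:R^-1))^-1 ^+ mi_length (mi_of_binary a))%:E *
           'N[lebesgue_cube]_(p%:E)[EFin \o Df (mi_of_binary a)])%E.
Proof.
pose B := (dev_const p d * d%:R) `^ p^-1.
have B0 : 0 <= B by exact: powR_ge0.
exists (B * r.+1%:R + 1) => [|f Df fp Dfp n rn].
  by rewrite ltr_wpDl// mulr_ge0.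
have Lp_int (u : 'rV[R]_d -> R) : u \in Lfun lebesgue_cube p%:E ->
    measurable_fun setT u /\ (@unit_cube R d).-integrable setT (EFin \o u).
  move=> up; have p1 : (1 <= p%:E)%E by rewrite lee_fin.
  have : u \in Lfun (@unit_cube R d) 1.
    apply: (Lfun_subset (lexx _) p1 _ p1 up).
    by rewrite [X in X \is a fin_num]unit_cube_setT.
  move=> /Lfun1_integrable iu; split=> //.
  by apply/measurable_EFinP; exact: measurable_int iu.
have [mf if_] := Lp_int _ fp.
pose g i := Df (mi_of_binary (unit_mi i)).
have gp i : g i \in Lfun lebesgue_cube p%:E /\ is_weak_derivative (mi_of_binary (unit_mi i)) f (g i).
  by apply: Dfp; rewrite mi_length_unit.
have mg i : measurable_fun setT (g i) by have [] := Lp_int _ (gp i).1.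
have ig i : (@unit_cube R d).-integrable setT (EFin \o g i) by have [] := Lp_int _ (gp i).1.
have lb i : line_bound i f (g i).
  apply: weak_partial_line_bound => //; apply: weak_partial_tens_unit => //.
  exact: (gp i).2.
apply: le_trans (kantorovich_norm_bound rn p_ge1 mf mg if_ lb) _.
pose w : R := (n.+1%:R `^ ((2 * d)%:R^-1))^-1.
have w0 : 0 <= w by rewrite invr_ge0 powR_ge0.
have C2 : 0 <= 2 * (B * r.+1%:R + 1) by rewrite mulr_ge0// addr_ge0// mulr_ge0.
apply: (@le_trans _ _ ((2 * (B * r.+1%:R + 1))%:E *
   \sum_(i < d) (w ^+ 1)%:E * 'N[@unit_cube R d]_p%:E[EFin \o g i])%E); last first.
  apply: lee_wpmul2l; first by rewrite lee_fin.
  pose X a := ((w ^+ mi_length (mi_of_binary a))%:E *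
    'N[@unit_cube R d]_p%:E[EFin \o Df (mi_of_binary a)])%E.
  rewrite (eq_bigr (fun i => X (unit_mi i))); last by move=> i _; rewrite /X mi_length_unit.
  by apply: sum_unit_mi_le => a; rewrite mule_ge0 ?Lnorm_ge0// lee_fin exprn_ge0.
rewrite expr1 -ge0_sume_distrr; last by move=> i _; exact: Lnorm_ge0.
rewrite muleA -EFinM; apply: lee_wpmul2r; first by apply: sume_ge0 => i _; exact: Lnorm_ge0.
rewrite lee_fin -/B; apply: le_trans (ler_wpM2l B0 (mesh_le R n r d_gt0)) _.
rewrite -/w mulrA ler_wpM2r//; lra.
Qed.
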